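(* Let $A,H$ be dually paired Hopf algebras with pairing $\langle\ ,\ \rangle:H\otimes A\to k$ and generalised quantum double $D(A,H)=A^{\mathrm{op}}\bowtie H$. Let $\Omega(A)$ and $\Omega(H)$ be strongly bicovariant exterior algebras, dually paired by extending $\langle\ ,\ \rangle$ by zero in degrees $\ge1$. Then $\Omega(D(A,H)):=\Omega(A)^{\mathrm{op}}\bowtie\Omega(H)$ is a strongly bicovariant exterior algebra on the generalised quantum double $D(A,H)$ with differential $$\mathrm d(\omega\otimes\eta)=\mathrm d_A\omega\otimes\eta+(-1)^{|\omega|}\omega\otimes \mathrm d_H\eta$$ for all $\eta\in\Omega(H)$, $\omega\in\Omega(A)$. Moreover, the right action of $D(A,H)$ on $H$ defined by $g\triangleleft(a\otimes h)=\langle g_{(2)},a\rangle(Sh_{(1)})g_{(1)}h_{(2)}$, for $g,h\in H$, $a\in A$, is differentiable, and extends to an action of $\Omega(D(A,H))$ on $\Omega(H)$ by $$\xi\triangleleft(\omega\otimes\eta)=\begin{cases}(-1)^{|\eta_{(1)}||\xi|}\langle\xi_{(2)},\omega\rangle(S\eta_{(1)})\xi_{(1)}\eta_{(2)}&\text{if }\omega\in A\\0&\text{otherwise}\end{cases}$$ for $\xi,\eta\in\Omega(H)$, where only the part of $\Delta_*\xi$ in $\Omega(H)\otimes H$ contributes. Explicitly, $$\xi\triangleleft(a\otimes\eta)=(-1)^{|\eta_{(1)}||\xi|}\langle\xi^{(1)},a\rangle(S\eta_{(1)})\xi^{(0)}\eta_{(2)},$$ where $\Delta_R\xi=\xi^{(0)}\otimes\xi^{(1)}$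 is the right coaction of $H$ on $\Omega(H)$. Similarly, with left-right reversal (swapping the roles of $A,H$ and of left and right), for a differentiable left action of $D(A,H)$ on $A$.
   Context: Work over a field $k$. An exterior algebra on an algebra $A$ is a differential graded algebra $\Omega(A)=\oplus_{n\ge0}\Omega^n(A)$ with $\Omega^0=A$, generated by $A$ and $\Omega^1=\mathrm{span}\{a\,\mathrm db\}$, with $\mathrm d^2=0$ and $\mathrm d(\omega\eta)=(\mathrm d\omega)\eta+(-1)^{|\omega|}\omega\,\mathrm d\eta$. Here $\underline\otimes$ is the super tensor product, $(a\otimes b)(c\otimes d)=(-1)^{|b||c|}ac\otimes bd$. For $A$ a Hopf algebra, $\Omega(A)$ is strongly bicovariant if it is a super-Hopf algebra (super grade = form degree mod 2) with coproduct $\Delta_*$ preserving total degree, restricting to $\Delta$ on $A$, and $\Delta_*\mathrm d\omega=(\mathrm d\otimes\mathrm{id}+(-1)^{|\ |}\mathrm{id}\otimes \mathrm d)\Delta_*\omega$. Sweedler notation is used for $\Delta$ and $\Delta_*$, with homogeneous components. The component of $\Delta_*|_{\Omega^i(H)}$ in $\Omega^i(H)\otimes H$ is the right coaction $\Delta_R$. $S$ denotes the (super) antipode. $A,H$ dually paired means $\langle hg,a\rangle=\langle h,a_{(1)}\rangle\langle g,a_{(2)}\rangle$, $\langle h,ab\rangle=\langle h_{(1)},a\rangle\langle h_{(2)},b\rangle$, with unit, counit and antipode compatibility. $A^{\mathrm{op}}$ is $A$ with the opposite product and the same coproduct, the antipode of $A$ being invertible so that this is a Hopf algebra. $D(A,H)=A^{\mathrm{op}}\bowtie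 H$ is $A\otimes H$ with tensor product coalgebra and product $(a\otimes h)(b\otimes g)=\langle Sh_{(1)},b_{(1)}\rangle b_{(2)}a\otimes h_{(2)}g\langle h_{(3)},b_{(3)}\rangle$ (products in $A$, $H$). $\Omega(A)^{\mathrm{op}}=:\Omega(A^{\mathrm{op}})$ is the super-opposite algebra (product of $\omega$ and $\tau$ being $(-1)^{|\omega||\tau|}\tau\omega$) with differential $\mathrm d_A$. $\Omega(A)^{\mathrm{op}}\bowtie\Omega(H)$ is $\Omega(A)\otimes\Omega(H)$ with super tensor product coalgebra and product $$(\omega\otimes\eta)(\tau\otimes\xi)=(-1)^{(|\eta|+|\omega|)|\tau|}\langle S\eta_{(1)},\tau_{(1)}\rangle\tau_{(2)}\omega\otimes\eta_{(2)}\xi\langle\eta_{(3)},\tau_{(3)}\rangle,$$ where the pairing is zero if an argument has degree $\ge1$. Differentiable (right) action: let $K$ be a bialgebra or Hopf algebra with $\Omega(K)$ strongly bicovariant, and let $\Omega(B)$ be an exterior algebra on an algebra $B$ which is a $K$-module algebra. The action is differentiable if it extends to a degree-preserving map $\triangleleft:\Omega(B)\underline\otimes\Omega(K)\to\Omega(B)$ making $\Omega(B)$ a super $\Omega(K)$-module algebra (so $(vw)\triangleleft a=(-1)^{|w||a_{(1)}|}(v\triangleleft a_{(1)})(w\triangleleft a_{(2)})$) with $\mathrm d_B(\eta\triangleleft\omega)=(\mathrm d_B\eta)\triangleleft\omega+(-1)^{|\eta|}\eta\triangleleft \mathrm d_K\omega$. Differentiability of a left action is the left-handed version: it extends to $\triangleright:\Omega(K)\underline\otimes\Omega(B)\to\Omega(B)$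 making $\Omega(B)$ a left super $\Omega(K)$-module algebra, compatibly with the differentials. *)

(* Defs.v *)
From HB Require Import structures.
From mathcomp Require Import all_boot all_algebra.
From mathcomp Require Import boolp classical_sets fsbigop.

(* Algebras, bialgebras and differential graded algebras are given as raw      *)
(* operations on a vector space, with their axioms as separate predicates: the *)
(* products that we define on tensor products are only known to be associative *)
(* once theorems about them have been proved.                                  *)

Set Implicit Arguments.
Unset Strict Implicit.
Unset Printing Implicit Defensive.

Import GRing.Theory.
Local Open Scope ring_scope.
Local Open Scope quotient_scope.

Section Bilinear.
Variables (k : fieldType) (V W U : lmodType k).

Definition is_linear (f : V -> U) : Prop :=
  forall (c : k) v v', f (c *: v + v') = c *: f v + f v'.

Definition is_bilinear (f : V -> W -> U) : Prop :=
  (forall w (c : k) v v', f (c *: v + v') w = c *: f v w + f v' w) /\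
  (forall v (c : k) w w', f v (c *: w + w') = c *: f v w + f v w').

End Bilinear.

(* V ⊗ W consists of the formal sums of pairs (v, w), two such sums being      *)
(* identified when no bilinear map distinguishes them.                         *)
Section Tensor.
Variables (k : fieldType) (V W : lmodType k).

Definition pair_sum (U : lmodType k) (f : V -> W -> U) (s : seq (V * W)) : U :=
  \sum_(p <- s) f p.1 p.2.

Definition tensor_equiv (s t : seq (V * W)) : Prop :=
  forall (U : lmodType k) (f : V -> W -> U),
    is_bilinear f -> pair_sum f s = pair_sum f t.

Definition tensor_equivb (s t : seq (V * W)) : bool := `[< tensor_equiv s t >].

Lemma tensor_equivb_refl : reflexive tensor_equivb.
Proof. by move=> s; apply/asboolP. Qed.

Lemma tensor_equivb_sym : symmetric tensor_equivb.
Proof.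
by move=> s t; apply/asboolP/asboolP => st U f fB; rewrite st.
Qed.

Lemma tensor_equivb_trans : transitive tensor_equivb.
Proof.
by move=> t s r /asboolP st /asboolP tr; apply/asboolP => U f fB; rewrite st ?tr.
Qed.

Canonical tensor_equiv_rel :=
  EquivRel tensor_equivb tensor_equivb_refl tensor_equivb_sym tensor_equivb_trans.

Definition tensor : Type := {eq_quot tensor_equiv_rel}.

HB.instance Definition _ := Choice.on tensor.
HB.instance Definition _ := EqQuotient.on tensor.

Implicit Types (s t : seq (V * W)) (x y z : tensor).

Lemma tensor_eqP s t : tensor_equiv s t -> \pi_tensor s = \pi_tensor t.
Proof. by move=> st; apply/eqmodP/asboolP. Qed.

Lemma repr_tensor s : tensor_equiv (repr (\pi_tensor s)) s.
Proof.
have /eqmodP/asboolP : \pi_tensor (repr (\pi_tensor s)) = \pi_tensor s.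
  by rewrite reprK.
exact.
Qed.

Definition scale_seq (c : k) s := [seq (c *: p.1, p.2) | p <- s].

Lemma pair_sum_cat (U : lmodType k) (f : V -> W -> U) s t :
  pair_sum f (s ++ t) = pair_sum f s + pair_sum f t.
Proof. exact: big_cat. Qed.

Lemma pair_sum_scale (U : lmodType k) (f : V -> W -> U) c s :
  is_bilinear f -> pair_sum f (scale_seq c s) = c *: pair_sum f s.
Proof.
move=> [fl _]; rewrite /pair_sum big_map scaler_sumr; apply: eq_bigr => -[v w] _ /=.
have f0 : f 0 w = 0.
  by have := fl w 1 0 0; rewrite !scale1r addr0 -[X in X = _]addr0 => /addrI ->.
by have := fl w c v 0; rewrite f0 !addr0.
Qed.

Definition tensor_add x y : tensor := \pi_tensor (repr x ++ repr y).
Definition tensor_scale (c : k) x : tensor := \pi_tensor (scale_seq c (repr x)).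
Definition tensor_zero : tensor := \pi_tensor [::].
Definition tensor_opp x : tensor := tensor_scale (-1) x.

(* The linear map on V ⊗ W induced by a bilinear map f.                        *)
Definition tsum (U : lmodType k) (f : V -> W -> U) (t : tensor) : U :=
  pair_sum f (repr t).

Definition tens (v : V) (w : W) : tensor := \pi_tensor [:: (v, w)].

Lemma tsum_add (U : lmodType k) (f : V -> W -> U) x y : is_bilinear f ->
  tsum f (tensor_add x y) = tsum f x + tsum f y.
Proof. by move=> fB; rewrite /tsum repr_tensor// pair_sum_cat. Qed.

Lemma tsum_scale (U : lmodType k) (f : V -> W -> U) c x : is_bilinear f ->
  tsum f (tensor_scale c x) = c *: tsum f x.
Proof. by move=> fB; rewrite /tsum repr_tensor// pair_sum_scale. Qed.

Lemma tsum_zero (U : lmodType k) (f : V -> W -> U) : is_bilinear f ->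
  tsum f tensor_zero = 0.
Proof. by move=> fB; rewrite /tsum repr_tensor// /pair_sum big_nil. Qed.

Lemma tsum_tens (U : lmodType k) (f : V -> W -> U) v w : is_bilinear f ->
  tsum f (tens v w) = f v w.
Proof. by move=> fB; rewrite /tsum repr_tensor// /pair_sum big_seq1. Qed.

Lemma tensor_ext x y :
  (forall (U : lmodType k) (f : V -> W -> U), is_bilinear f -> tsum f x = tsum f y) ->
  x = y.
Proof. by move=> xy; rewrite -[x]reprK -[y]reprK; apply: tensor_eqP. Qed.

Lemma tensor_addA : associative tensor_add.
Proof. by move=> x y z; apply: tensor_ext => U f fB; rewrite !tsum_add// addrA. Qed.

Lemma tensor_addC : commutative tensor_add.
Proof. by move=> x y; apply: tensor_ext => U f fB; rewrite !tsum_add// addrC. Qed.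

Lemma tensor_add0 : left_id tensor_zero tensor_add.
Proof.
by move=> x; apply: tensor_ext => U f fB; rewrite tsum_add// tsum_zero// add0r.
Qed.

Lemma tensor_addN : left_inverse tensor_zero tensor_opp tensor_add.
Proof.
move=> x; apply: tensor_ext => U f fB.
by rewrite tsum_add// tsum_scale// tsum_zero// scaleN1r addNr.
Qed.

HB.instance Definition _ :=
  GRing.isZmodule.Build tensor tensor_addA tensor_addC tensor_add0 tensor_addN.

Lemma tensor_scaleA a b x :
  tensor_scale a (tensor_scale b x) = tensor_scale (a * b) x.
Proof. by apply: tensor_ext => U f fB; rewrite !tsum_scale// scalerA. Qed.

Lemma tensor_scale1 : left_id 1 tensor_scale.
Proof. by move=> x; apply: tensor_ext => U f fB; rewrite tsum_scale// scale1r. Qed.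

Lemma tensor_scaleDr : right_distributive tensor_scale +%R.
Proof.
move=> c x y; apply: tensor_ext => U f fB.
by rewrite !(tsum_scale, tsum_add)// scalerDr.
Qed.

Lemma tensor_scaleDl x : {morph tensor_scale^~ x : a b / a + b}.
Proof.
move=> a b; apply: tensor_ext => U f fB.
by rewrite !(tsum_scale, tsum_add)// scalerDl.
Qed.

HB.instance Definition _ := GRing.Zmodule_isLmodule.Build k tensor
  tensor_scaleA tensor_scale1 tensor_scaleDr tensor_scaleDl.

Lemma tens_bilinear : is_bilinear tens.
Proof.
split=> [w c v v' | v c w w']; apply: tensor_ext => U f fB.
- by rewrite tsum_add// tsum_scale// !tsum_tens// fB.1.
- by rewrite tsum_add// tsum_scale// !tsum_tens// fB.2.
Qed.

Lemma tsum_linear (U : lmodType k) (f : V -> W -> U) :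
  is_bilinear f -> is_linear (tsum f).
Proof. by move=> fB c x y; rewrite tsum_add// tsum_scale. Qed.

End Tensor.

Arguments tensor {k} (V W)%_type_scope.

Notation "V ⊗ W" := (tensor V W) (at level 40, left associativity) : type_scope.
Notation "v ⊗ w" := (tens v w) (at level 40, left associativity) : ring_scope.

(* Sweedler notation: \tsum_(a, b <- t) f a b, for f bilinear, is the value    *)
(* at t of the linear map a ⊗ b |-> f a b.                                     *)
Notation "\tsum_ ( a , b <- t ) F" := (tsum (fun a b => F) t)
  (at level 41, F at level 41, a name, b name,
   format "'[' \tsum_ ( a ,  b  <-  t ) '/  '  F ']'") : ring_scope.

Definition tmap (k : fieldType) (V V' W W' : lmodType k)
  (f : V -> V') (g : W -> W') (t : V ⊗ W) : V' ⊗ W' :=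
  \tsum_(v, w <- t) f v ⊗ g w.

Section Algebras.
Variable k : fieldType.

Record alg := Alg {
  asort :> lmodType k;
  amul : asort -> asort -> asort;
  aone : asort }.

Record bialg := Bialg {
  balg :> alg;
  cop : balg -> balg ⊗ balg;
  cou : balg -> k }.

(* gpr n is the projection onto the component of degree n.                     *)
Record dga := Dga {
  dalg :> alg;
  gpr : nat -> dalg -> dalg;
  gd : dalg -> dalg }.

Record dgbialg := DgBialg {
  dgb_dga :> dga;
  dgb_cop : dgb_dga -> dgb_dga ⊗ dgb_dga;
  dgb_cou : dgb_dga -> k }.

Definition dgb_bialg (X : dgbialg) : bialg := Bialg (@dgb_cop X) (@dgb_cou X).

End Algebras.

Coercion dgb_bialg : dgbialg >-> bialg.
Canonical dgb_bialg.

Notation "x ∙ y" := (amul x y) (at level 40, left associativity) : ring_scope.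

Section HopfAlgebras.
Variable k : fieldType.

Record is_alg (A : alg k) : Prop := IsAlg {
  is_alg_bilinear : is_bilinear (@amul k A);
  is_alg_assoc : associative (@amul k A);
  is_alg_left_id : left_id (aone A) (@amul k A);
  is_alg_right_id : right_id (aone A) (@amul k A) }.

Record is_coalg (C : bialg k) : Prop := IsCoalg {
  is_coalg_cop_linear : is_linear (@cop k C);
  is_coalg_cou_linear : is_linear (@cou k C : C -> k^o);
  is_coalg_coassoc : forall x : C,
    \tsum_(x1, x2 <- cop x) \tsum_(x11, x12 <- cop x1) x11 ⊗ (x12 ⊗ x2) =
    \tsum_(x1, x2 <- cop x) x1 ⊗ cop x2;
  is_coalg_left_counit : forall x : C, \tsum_(x1, x2 <- cop x) cou x1 *: x2 = x;
  is_coalg_right_counit : forall x : C, \tsum_(x1, x2 <- cop x) cou x2 *: x1 = x }.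

Definition tensor_mul (A B : alg k) (s t : A ⊗ B) : A ⊗ B :=
  \tsum_(a, b <- s) \tsum_(c, d <- t) (a ∙ c) ⊗ (b ∙ d).

Record is_bialg (A : bialg k) : Prop := IsBialg {
  is_bialg_alg : is_alg A;
  is_bialg_coalg : is_coalg A;
  is_bialg_cop_mul : forall x y : A, cop (x ∙ y) = tensor_mul (cop x) (cop y);
  is_bialg_cop_one : cop (aone A) = aone A ⊗ aone A;
  is_bialg_cou_mul : forall x y : A, cou (x ∙ y) = cou x * cou y;
  is_bialg_cou_one : cou (aone A) = 1 }.

Record is_antipode (A : bialg k) (S : A -> A) : Prop := IsAntipode {
  is_antipode_linear : is_linear S;
  is_antipode_left : forall x, \tsum_(x1, x2 <- cop x) S x1 ∙ x2 = cou x *: aone A;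
  is_antipode_right : forall x, \tsum_(x1, x2 <- cop x) x1 ∙ S x2 = cou x *: aone A }.

Record is_hopf (A : bialg k) (S : A -> A) : Prop := IsHopf {
  is_hopf_bialg : is_bialg A;
  is_hopf_antipode : is_antipode S }.

Record dually_paired (A H : bialg k) (SA : A -> A) (SH : H -> H)
    (p : H -> A -> k) : Prop := DuallyPaired {
  pairing_bilinear : is_bilinear (p : H -> A -> k^o);
  pairing_mull : forall (h g : H) (a : A),
    p (h ∙ g) a = \tsum_(a1, a2 <- cop a) ((p h a1 * p g a2 : k) : k^o);
  pairing_mulr : forall (h : H) (a b : A),
    p h (a ∙ b) = \tsum_(h1, h2 <- cop h) ((p h1 a * p h2 b : k) : k^o);
  pairing_onel : forall a : A, p (aone H) a = cou a;
  pairing_oner : forall h : H, p h (aone A) = cou h;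
  pairing_antipode : forall (h : H) (a : A), p (SH h) a = p h (SA a) }.

End HopfAlgebras.

Section Graded.
Variable k : fieldType.

Definition homog (V : lmodType k) (pr : nat -> V -> V) (n : nat) (v : V) : Prop :=
  pr n v = v.

(* V is the direct sum of the images of the projections pr n.                  *)
Record is_grading (V : lmodType k) (pr : nat -> V -> V) : Prop := IsGrading {
  grading_linear : forall n, is_linear (pr n);
  grading_orthogonal : forall m n v, pr m (pr n v) = if m == n then pr n v else 0;
  grading_finite : forall v, exists N, v = \sum_(n < N) pr n v }.

Definition degree_preserving (V W : lmodType k) (prV : nat -> V -> V)
    (prW : nat -> W -> W) (f : V -> W) : Prop :=
  forall n v, homog prV n v -> homog prW n (f v).

Definition even_map (V W : lmodType k) (prV : nat -> V -> V)
    (prW : nat -> W -> W) (f : V -> W) : Prop :=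
  forall m n v, odd m != odd n -> homog prV n v -> prW m (f v) = 0.

Definition trivial_grading (V : lmodType k) (n : nat) (v : V) : V :=
  if n == 0%N then v else 0.

Definition tensor_grading (V W : lmodType k) (prV : nat -> V -> V)
    (prW : nat -> W -> W) (n : nat) (t : V ⊗ W) : V ⊗ W :=
  \tsum_(v, w <- t) \sum_(i < n.+1) prV i v ⊗ prW (n - i)%N w.

(* Sum of F n w over the homogeneous components w of v, where n is the degree  *)
(* of w; only finitely many of these components are nonzero.                   *)
Definition hsum (X : dga k) (U : lmodType k) (F : nat -> X -> U) (v : X) : U :=
  \sum_(n \in [set: nat]) F n (gpr n v).

End Graded.

Notation "\hsum_ ( w @ n <- v ) F" := (hsum (fun n w => F) v)
  (at level 41, F at level 41, w name, n name,
   format "'[' \hsum_ ( w  @  n  <-  v ) '/  '  F ']'") : ring_scope.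

Section ExteriorAlgebras.
Variable k : fieldType.

Definition super_tensor_mul (X Y : dga k) (s t : X ⊗ Y) : X ⊗ Y :=
  \tsum_(a, b <- s) \tsum_(c, d <- t) \hsum_(b' @ m <- b) \hsum_(c' @ n <- c)
    (-1) ^+ (m * n) *: ((a ∙ c') ⊗ (b' ∙ d)).

Definition super_tensor_d (X Y : dga k) (t : X ⊗ Y) : X ⊗ Y :=
  \tsum_(v, w <- t) (gd v ⊗ w + \hsum_(v' @ n <- v) (-1) ^+ n *: (v' ⊗ gd w)).

Record is_dga (X : dga k) : Prop := IsDga {
  is_dga_alg : is_alg X;
  is_dga_grading : is_grading (@gpr k X);
  is_dga_one : homog (@gpr k X) 0 (aone X);
  is_dga_mul : forall m n (v w : X),
    homog (@gpr k X) m v -> homog (@gpr k X) n w ->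
    homog (@gpr k X) (m + n) (v ∙ w);
  is_dga_d_linear : is_linear (@gd k X);
  is_dga_d_degree : forall n (v : X),
    homog (@gpr k X) n v -> homog (@gpr k X) n.+1 (gd v);
  is_dga_dd : forall v : X, gd (gd v) = 0;
  is_dga_leibniz : forall n (v w : X), homog (@gpr k X) n v ->
    gd (v ∙ w) = gd v ∙ w + (-1) ^+ n *: (v ∙ gd w) }.

Definition is_subalgebra (X : alg k) (P : X -> Prop) : Prop :=
  [/\ P (aone X),
      forall (c : k) x y, P x -> P y -> P (c *: x + y)
    & forall x y, P x -> P y -> P (x ∙ y)].

(* The map i identifies A with the component of degree 0 of X.                 *)
Record is_exterior_algebra (A : alg k) (X : dga k) (i : A -> X) : Prop :=
  IsExteriorAlgebra {
  exterior_dga : is_dga X;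
  exterior_linear : is_linear i;
  exterior_mul : forall a b, i (a ∙ b) = i a ∙ i b;
  exterior_one : i (aone A) = aone X;
  exterior_injective : injective i;
  exterior_degree0 : forall x, homog (@gpr k X) 0 x <-> exists a, x = i a;
  exterior_degree1 : forall x, homog (@gpr k X) 1 x <->
    exists s : seq (A * A), x = \sum_(p <- s) i p.1 ∙ gd (i p.2);
  exterior_generated : forall P : X -> Prop, is_subalgebra P ->
    (forall x, homog (@gpr k X) 0 x \/ homog (@gpr k X) 1 x -> P x) ->
    forall x, P x }.

(* Bialgebras and Hopf algebras in super vector spaces, the super grade being  *)
(* the degree mod 2.                                                           *)
Record is_super_hopf (X : dgbialg k) (S : X -> X) : Prop := IsSuperHopf {
  super_hopf_alg : is_alg X;
  super_hopf_coalg : is_coalg X;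
  super_hopf_cop_even :
    even_map (@gpr k X) (tensor_grading (@gpr k X) (@gpr k X)) (@cop k X);
  super_hopf_cou_even :
    even_map (@gpr k X) (@trivial_grading k k^o) (@cou k X : X -> k^o);
  super_hopf_S_even : even_map (@gpr k X) (@gpr k X) S;
  super_hopf_cop_mul : forall x y : X,
    cop (x ∙ y) = super_tensor_mul (cop x) (cop y);
  super_hopf_cop_one : cop (aone X) = aone X ⊗ aone X;
  super_hopf_cou_mul : forall x y : X, cou (x ∙ y) = cou x * cou y;
  super_hopf_cou_one : cou (aone X) = 1;
  super_hopf_antipode : is_antipode S }.

Record is_strongly_bicovariant (A : bialg k) (X : dgbialg k) (i : A -> X)
    (S : X -> X) : Prop := IsStronglyBicovariant {
  bicovariant_exterior : is_exterior_algebra i;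
  bicovariant_super_hopf : is_super_hopf S;
  bicovariant_cop_degree :
    degree_preserving (@gpr k X) (tensor_grading (@gpr k X) (@gpr k X)) (@cop k X);
  bicovariant_cop0 : forall a, cop (i a) = tmap i i (cop a);
  bicovariant_cop_d : forall x : X, cop (gd x) = super_tensor_d (cop x) }.

(* The element of A given by the component of degree 0 of x; it is unique when *)
(* i is the inclusion of A in an exterior algebra.                             *)
Definition deg0 (A : alg k) (X : dga k) (i : A -> X) (x : X) : A :=
  xget 0 [set a | i a = gpr 0 x]%classic.

Definition extend_pairing (A H : alg k) (OA OH : dga k) (iA : A -> OA)
    (iH : H -> OH) (p : H -> A -> k) (y : OH) (x : OA) : k :=
  p (deg0 iH y) (deg0 iA x).

(* The component of cop x in X ⊗ A.                                            *)
Definition right_coaction (A : alg k) (X : dgbialg k) (i : A -> X) (x : X) : X ⊗ A :=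
  \tsum_(x1, x2 <- cop x) x1 ⊗ deg0 i x2.

End ExteriorAlgebras.

Section Actions.
Variable k : fieldType.

Record is_right_module_algebra (K : bialg k) (B : alg k) (act : B -> K -> B) : Prop :=
  IsRightModuleAlgebra {
  right_act_bilinear : is_bilinear act;
  right_act_mul : forall v x y, act (act v x) y = act v (x ∙ y);
  right_act_one : forall v, act v (aone K) = v;
  right_act_alg_mul : forall v w x,
    act (v ∙ w) x = \tsum_(x1, x2 <- cop x) act v x1 ∙ act w x2;
  right_act_alg_one : forall x, act (aone B) x = cou x *: aone B }.

Record is_left_module_algebra (K : bialg k) (B : alg k) (act : K -> B -> B) : Prop :=
  IsLeftModuleAlgebra {
  left_act_bilinear : is_bilinear act;
  left_act_mul : forall v x y, act x (act y v) = act (x ∙ y) v;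
  left_act_one : forall v, act (aone K) v = v;
  left_act_alg_mul : forall v w x,
    act x (v ∙ w) = \tsum_(x1, x2 <- cop x) act x1 v ∙ act x2 w;
  left_act_alg_one : forall x, act x (aone B) = cou x *: aone B }.

Record is_right_super_module_algebra (OK : dgbialg k) (OB : dga k)
    (oact : OB -> OK -> OB) : Prop := IsRightSuperModuleAlgebra {
  right_sact_bilinear : is_bilinear oact;
  right_sact_degree : forall m n v x, homog (@gpr k OB) m v -> homog (@gpr k OK) n x ->
    homog (@gpr k OB) (m + n) (oact v x);
  right_sact_mul : forall v x y, oact (oact v x) y = oact v (x ∙ y);
  right_sact_one : forall v, oact v (aone OK) = v;
  right_sact_alg_mul : forall v n w x, homog (@gpr k OB) n w ->
    oact (v ∙ w) x = \tsum_(x1, x2 <- cop x) \hsum_(x1' @ m <- x1)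
      (-1) ^+ (n * m) *: (oact v x1' ∙ oact w x2);
  right_sact_alg_one : forall x : OK, oact (aone OB) x = cou x *: aone OB }.

Record is_left_super_module_algebra (OK : dgbialg k) (OB : dga k)
    (oact : OK -> OB -> OB) : Prop := IsLeftSuperModuleAlgebra {
  left_sact_bilinear : is_bilinear oact;
  left_sact_degree : forall m n v x, homog (@gpr k OB) m v -> homog (@gpr k OK) n x ->
    homog (@gpr k OB) (n + m) (oact x v);
  left_sact_mul : forall v x y, oact x (oact y v) = oact (x ∙ y) v;
  left_sact_one : forall v, oact (aone OK) v = v;
  left_sact_alg_mul : forall n v w x, homog (@gpr k OB) n v ->
    oact x (v ∙ w) = \tsum_(x1, x2 <- cop x) \hsum_(x2' @ m <- x2)
      (-1) ^+ (m * n) *: (oact x1 v ∙ oact x2' w);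
  left_sact_alg_one : forall x : OK, oact x (aone OB) = cou x *: aone OB }.

Record is_right_differentiable_extension (K : bialg k) (B : alg k)
    (OK : dgbialg k) (OB : dga k) (iK : K -> OK) (iB : B -> OB)
    (act : B -> K -> B) (oact : OB -> OK -> OB) : Prop :=
  IsRightDifferentiableExtension {
  right_diff_extends : forall b x, oact (iB b) (iK x) = iB (act b x);
  right_diff_module : is_right_super_module_algebra oact;
  right_diff_d : forall n v x, homog (@gpr k OB) n v ->
    gd (oact v x) = oact (gd v) x + (-1) ^+ n *: oact v (gd x) }.

Record is_left_differentiable_extension (K : bialg k) (B : alg k)
    (OK : dgbialg k) (OB : dga k) (iK : K -> OK) (iB : B -> OB)
    (act : K -> B -> B) (oact : OK -> OB -> OB) : Prop :=
  IsLeftDifferentiableExtension {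
  left_diff_extends : forall b x, oact (iK x) (iB b) = iB (act x b);
  left_diff_module : is_left_super_module_algebra oact;
  left_diff_d : forall n v x, homog (@gpr k OK) n x ->
    gd (oact x v) = oact (gd x) v + (-1) ^+ n *: oact x (gd v) }.

Definition right_differentiable (K : bialg k) (B : alg k) (OK : dgbialg k)
    (OB : dga k) (iK : K -> OK) (iB : B -> OB) (act : B -> K -> B) : Prop :=
  exists oact, is_right_differentiable_extension iK iB act oact.

Definition left_differentiable (K : bialg k) (B : alg k) (OK : dgbialg k)
    (OB : dga k) (iK : K -> OK) (iB : B -> OB) (act : K -> B -> B) : Prop :=
  exists oact, is_left_differentiable_extension iK iB act oact.

End Actions.

(* D(A, H) = A^op ⋈ H.                                                         *)
Section QuantumDouble.
Variables (k : fieldType) (A H : bialg k).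
Variables (SA : A -> A) (SH : H -> H) (p : H -> A -> k).

Definition double_mul (s t : A ⊗ H) : A ⊗ H :=
  \tsum_(a, h <- s) \tsum_(b, g <- t)
    \tsum_(h1, h23 <- cop h) \tsum_(h2, h3 <- cop h23)
    \tsum_(b1, b23 <- cop b) \tsum_(b2, b3 <- cop b23)
      (p (SH h1) b1 * p h3 b3) *: ((b2 ∙ a) ⊗ (h2 ∙ g)).

Definition double_cop (t : A ⊗ H) : (A ⊗ H) ⊗ (A ⊗ H) :=
  \tsum_(a, h <- t) \tsum_(a1, a2 <- cop a) \tsum_(h1, h2 <- cop h)
    (a1 ⊗ h1) ⊗ (a2 ⊗ h2).

Definition double_cou (t : A ⊗ H) : k :=
  \tsum_(a, h <- t) ((cou a * cou h : k) : k^o).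

Definition quantum_double : bialg k :=
  @Bialg k (@Alg k (tensor A H) double_mul (aone A ⊗ aone H)) double_cop double_cou.

Definition double_right_act (g : H) (x : quantum_double) : H :=
  \tsum_(a, h <- x) \tsum_(g1, g2 <- cop g) \tsum_(h1, h2 <- cop h)
    p g2 a *: (SH h1 ∙ g1 ∙ h2).

(* The left-right reversal of double_right_act: the flip identifies D(A, H)    *)
(* with the opposite algebra of D(H, A), so that the right action of D(H, A)   *)
(* on A is a left action of D(A, H).                                           *)
Definition double_left_act (x : quantum_double) (b : A) : A :=
  \tsum_(a, h <- x) \tsum_(b1, b2 <- cop b) \tsum_(a1, a2 <- cop a)
    p h b2 *: (SA a1 ∙ b1 ∙ a2).

End QuantumDouble.

Arguments double_right_act {k A H} SH p g x.
Arguments double_left_act {k A H} SA SH p x b.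

(* Ω(A)^op ⋈ Ω(H).                                                             *)
Section ExteriorDouble.
Variables (k : fieldType) (A H : bialg k) (OA OH : dgbialg k).
Variables (iA : A -> OA) (iH : H -> OH) (SOA : OA -> OA) (SOH : OH -> OH).
Variable p : H -> A -> k.

Local Notation op := (extend_pairing iA iH p).

Definition ext_double_mul (s s' : OA ⊗ OH) : OA ⊗ OH :=
  \tsum_(w, y <- s) \tsum_(t, z <- s')
  \hsum_(w' @ i <- w) \hsum_(y' @ j <- y) \hsum_(t' @ l <- t)
    (-1) ^+ ((j + i) * l) *:
    \tsum_(y1, y23 <- cop y') \tsum_(y2, y3 <- cop y23)
    \tsum_(t1, t23 <- cop t') \tsum_(t2, t3 <- cop t23)
      (op (SOH y1) t1 * op y3 t3) *: ((t2 ∙ w') ⊗ (y2 ∙ z)).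

Definition ext_double_cop (s : OA ⊗ OH) : (OA ⊗ OH) ⊗ (OA ⊗ OH) :=
  \tsum_(w, y <- s) \tsum_(w1, w2 <- cop w) \tsum_(y1, y2 <- cop y)
  \hsum_(w2' @ m <- w2) \hsum_(y1' @ n <- y1)
    (-1) ^+ (m * n) *: ((w1 ⊗ y1') ⊗ (w2' ⊗ y2)).

Definition ext_double_cou (s : OA ⊗ OH) : k :=
  \tsum_(w, y <- s) ((cou w * cou y : k) : k^o).

Definition ext_double : dgbialg k :=
  @DgBialg k
    (@Dga k (@Alg k (tensor OA OH) ext_double_mul (aone OA ⊗ aone OH))
      (tensor_grading (@gpr k OA) (@gpr k OH)) (@super_tensor_d k OA OH))
    ext_double_cop ext_double_cou.

(* The extended pairing takes care of the case distinction: it vanishes on     *)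
(* (x2, w) unless both have a component of degree 0.                           *)
Definition ext_double_right_act (x : OH) (s : ext_double) : OH :=
  \tsum_(w, y <- s) \hsum_(x' @ n <- x)
  \tsum_(x1, x2 <- cop x') \tsum_(y1, y2 <- cop y) \hsum_(y1' @ m <- y1)
    (-1) ^+ (m * n) *: (op x2 w *: (SOH y1' ∙ x1 ∙ y2)).

(* Reversal in the super sense: with v * s the right action of the exterior    *)
(* double of (H, A) on Ω(A), a left action of that of (A, H) is obtained as    *)
(*   (w ⊗ y) |> v = (-1)^(|w ⊗ y| |v|) (-1)^(|w| |y|) v * (y ⊗ w),             *)
(* and (-1)^(|w| |v|) (-1)^(|w1| |v|) = (-1)^(|w2| |v|).                       *)
Definition ext_double_left_act (s : ext_double) (v : OA) : OA :=
  \tsum_(w, y <- s) \hsum_(v' @ n <- v)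
  \tsum_(v1, v2 <- cop v') \tsum_(w1, w2 <- cop w) \hsum_(w2' @ m <- w2)
    (-1) ^+ (m * n) *: (op y v2 *: (SOA w1 ∙ v1 ∙ w2')).

End ExteriorDouble.

Arguments ext_double_right_act {k A H OA OH} iA iH SOH p x s.
Arguments ext_double_left_act {k A H OA OH} iA iH SOA SOH p s v.

(* Main.v *)
Require Import Defs.
From HB Require Import structures.
From mathcomp Require Import all_boot all_algebra.
From mathcomp Require Import boolp classical_sets fsbigop ring.

(* Ω(A)^op ⋈ Ω(H) is the Doi-Takeuchi twist of the super tensor product        *)
(* Ω(A)^op ⊗ Ω(H) by the 2-cocycle which the extended pairing induces on it.   *)
(* This cocycle vanishes in positive degrees, so that no signs occur in the    *)
(* conjugation of the product, and the axioms of a differential graded         *)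
(* bialgebra carry over from the super tensor product. D(A, H) is the          *)
(* component of degree 0 and inherits its axioms. Its antipode is built from   *)
(* that of H and the inverse of that of A; it extends to all degrees since, by *)
(* an argument of Takeuchi, a map which is convolution invertible in degree 0  *)
(* is convolution invertible.                                                  *)
(*   The right action of ω ⊗ η is the action of ω on Ω(H) given by the pairing *)
(* and the coproduct, followed by the right super adjoint action of η. The     *)
(* left action is the right action for the pair (H, A), transported by the     *)
(* super flip, which is antimultiplicative from the exterior double of (A, H)  *)
(* to that of (H, A).                                                          *)

Set Implicit Arguments.
Unset Strict Implicit.
Unset Printing Implicit Defensive.

Import GRing.Theory.
Local Open Scope ring_scope.

(** * Multilinear maps and gradings *)

(* Let P be the super tensor product of the super-opposite algebra of Ω(A) with Ω(H); keeping track
   of signs shows that it is a differential graded bialgebra ([sop_dgbi], [stens_dgbi]). Put on P ⊗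
   P the form g(w ⊗ y, x ⊗ z) = ε(w) <Sy, x> ε(z). Its convolution inverse is gb(w ⊗ y, x ⊗ z) =
   ε(w) <y, x> ε(z), and the axioms of a Hopf pairing give the 2-cocycle identity for g and the
   reversed one for gb ([double_cocycle]). The twisted product s · t = g(s1, t1) s2 t2 gb(s3, t3) is
   exactly the product of Ω(A)^op ⋈ Ω(H) ([ext_double_mul_twist]).

   Twisting leaves coalgebra, grading and differential alone. Associativity comes from the cocycle
   identities, and Δ stays multiplicative since the gb of the first leg cancels against the g of the
   second. Both forms vanish in positive degrees, hence also on the image of d; so degrees and the
   Leibniz rule persist and no Koszul sign arises when a form is moved ([twist_dgbi]).

   D(A, H) is embedded in degree 0 with a linear retraction, and signs are trivial there, so its
   bialgebra axioms are restrictions ([sub_bialg]). Its antipode is h -> Sh and a -> S^-1 a,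
   multiplied in the reverse order ([double_hopf]). Extended by zero this is a map j inverting the
   identity in degree 0; the geometric series in 1 - j * id then gives an antipode in all degrees
   ([conv_left_inverse], [graded_antipode]). Finally Ω(A)^op ⊗ 1 and 1 ⊗ Ω(H) together generate the
   double, so generation and the shape of 1-forms are inherited from the two factors
   ([ext_double_generated], [ext_double_degree1]).

   The right action is a composite: first x -> x1 <x2, w>, then the right super adjoint action of y
   ([ract_ext_adj]). Each of the two respects products and d; for the second this rests on the super
   antipode being antimultiplicative and commuting with d ([antipode_mul], [antipode_d]). They fit
   together into an action of the double because of the exchange relation (v ◁ y) ◁ t = <Sy1, t1> (v
   ◁ t2) ◁ y2 <y3, t3> ([pact_super_adj]), found by applying the pairing action to the product S(y1)
   v y2.

   The left action is (-1)^(|s||v|) times the right action of the exterior double of (H, A) at the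
   flipped element ([lact_ext_flip]). The super flip is a map of coalgebras, commutes with d and
   reverses products up to the Koszul sign ([flip_mul]), so every property is transported. *)
Create HintDb multilinear.

Section LinearMaps.
Variable k : fieldType.
Implicit Types V W U Z : lmodType k.

Lemma is_bilinearP V W U (f : V -> W -> U) :
  (forall w, is_linear (fun v => f v w)) -> (forall v, is_linear (fun w => f v w)) ->
  is_bilinear f.
Proof. by move=> fl fr; split=> [w c v v'|v c w w']; [exact: fl|exact: fr]. Qed.

Lemma lin0 V U (f : V -> U) : is_linear f -> f 0 = 0.
Proof.
by move=> fl; have := fl 1 0 0; rewrite !scale1r addr0 -[X in X = _]addr0 => /addrI ->.
Qed.

Lemma linD V U (f : V -> U) x y : is_linear f -> f (x + y) = f x + f y.
Proof. by move=> fl; rewrite -[x]scale1r fl !scale1r. Qed.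

Lemma linZ V U (f : V -> U) c x : is_linear f -> f (c *: x) = c *: f x.
Proof. by move=> fl; rewrite -[c *: x]addr0 fl (lin0 fl) addr0. Qed.

Lemma lin_sumE V U (f : V -> U) (I : Type) (r : seq I) (P : pred I) (F : I -> V) :
  is_linear f -> f (\sum_(i <- r | P i) F i) = \sum_(i <- r | P i) f (F i).
Proof.
by move=> fl; apply: (big_morph f) => [x y|]; [exact: linD|exact: lin0].
Qed.

Lemma lin_id V : is_linear (fun x : V => x).
Proof. by []. Qed.

Lemma lin_zero V U : is_linear (fun _ : V => 0 : U).
Proof. by move=> c x y; rewrite scaler0 addr0. Qed.

Lemma lin_comp V W U (f : W -> U) (g : V -> W) :
  is_linear f -> is_linear g -> is_linear (fun x => f (g x)).
Proof. by move=> fl gl c x y; rewrite gl fl. Qed.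

Lemma lin_bil_l V W U Z (f : W -> Z -> U) (g : V -> W) z :
  is_bilinear f -> is_linear g -> is_linear (fun x => f (g x) z).
Proof. by move=> fl gl c x y; rewrite gl fl.1. Qed.

Lemma lin_bil_r V W U Z (f : W -> Z -> U) (g : V -> Z) w :
  is_bilinear f -> is_linear g -> is_linear (fun x => f w (g x)).
Proof. by move=> fl gl c x y; rewrite gl fl.2. Qed.

Lemma lin_scale_l V U (f : V -> k) (u : U) :
  is_linear (f : V -> k^o) -> is_linear (fun x => f x *: u).
Proof. by move=> fl c x y; rewrite fl scalerDl scalerA. Qed.

Lemma lin_scale_r V U (c : k) (f : V -> U) :
  is_linear f -> is_linear (fun x => c *: f x).
Proof. by move=> fl d x y; rewrite fl scalerDr !scalerA mulrC. Qed.

Lemma lin_mul_l V (c : k) (f : V -> k) :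
  is_linear (f : V -> k^o) -> is_linear ((fun x => f x * c) : V -> k^o).
Proof. by move=> fl d x y; rewrite fl mulrDl -mulrA. Qed.

Lemma lin_mul_r V (c : k) (f : V -> k) :
  is_linear (f : V -> k^o) -> is_linear ((fun x => c * f x) : V -> k^o).
Proof. by move=> fl d x y; rewrite fl mulrDr mulrCA. Qed.

Lemma lin_add V U (f g : V -> U) :
  is_linear f -> is_linear g -> is_linear (fun x => f x + g x).
Proof. by move=> fl gl c x y; rewrite fl gl scalerDr addrACA. Qed.

Lemma lin_opp V U (f : V -> U) :
  is_linear f -> is_linear (fun x => - f x).
Proof. by move=> fl c x y; rewrite fl opprD scalerN. Qed.

Lemma lin_sum V U (I : Type) (r : seq I) (P : pred I) (f : I -> V -> U) :
  (forall i, is_linear (f i)) -> is_linear (fun x => \sum_(i <- r | P i) f i x).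
Proof.
by move=> fl c x y; rewrite scaler_sumr -big_split; apply: eq_bigr => i _; exact: fl.
Qed.

Lemma lin_tsum V W Z U (f : W -> Z -> U) (g : V -> W ⊗ Z) :
  is_bilinear f -> is_linear g -> is_linear (fun x => tsum f (g x)).
Proof. by move=> fB gl; apply: lin_comp => //; exact: tsum_linear. Qed.

(** A fixed tensor has one fixed representative, so linearity in a parameter of the summand holds
    term by term. *)
Lemma lin_tsum_fun V W Z U (f : V -> W -> Z -> U) (t : W ⊗ Z) :
  (forall a b, is_linear (fun x => f x a b)) -> is_linear (fun x => tsum (f x) t).
Proof. by move=> fl; apply: lin_sum => -[a b]; exact: fl. Qed.

Lemma tens_lin_l V W U (g : U -> V) (w : W) :
  is_linear g -> is_linear (fun x => g x ⊗ w).
Proof. by apply: lin_bil_l; exact: tens_bilinear. Qed.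

Lemma tens_lin_r V W U (g : U -> W) (v : V) :
  is_linear g -> is_linear (fun x => v ⊗ g x).
Proof. by apply: lin_bil_r; exact: tens_bilinear. Qed.

Lemma tensZl V W (c : k) (v : V) (w : W) : (c *: v) ⊗ w = c *: (v ⊗ w).
Proof. by apply: (linZ (f := fun v => v ⊗ w)); exact: tens_lin_l. Qed.

Lemma tensZr V W (c : k) (v : V) (w : W) : v ⊗ (c *: w) = c *: (v ⊗ w).
Proof. by apply: (linZ (f := fun w => v ⊗ w)); exact: tens_lin_r. Qed.

Lemma tens0l V W (w : W) : (0 : V) ⊗ w = 0.
Proof. by apply: (lin0 (f := fun v => v ⊗ w)); exact: tens_lin_l. Qed.

Lemma tens0r V W (v : V) : v ⊗ (0 : W) = 0.
Proof. by apply: (lin0 (f := fun w => v ⊗ w)); exact: tens_lin_r. Qed.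

(** Bilinear maps separate tensors, and each of them takes the same value on both sides. *)
Lemma tensE V W (t : V ⊗ W) : t = \sum_(q <- repr t) q.1 ⊗ q.2.
Proof.
apply: tensor_ext => U f fB; have fl := tsum_linear fB.
by rewrite (lin_sumE _ _ _ fl); apply: eq_bigr => q _; rewrite tsum_tens.
Qed.

Lemma tens_ext V W U (f g : V ⊗ W -> U) : is_linear f -> is_linear g ->
  (forall v w, f (v ⊗ w) = g (v ⊗ w)) -> forall t, f t = g t.
Proof.
move=> fl gl fg t; rewrite (tensE t) !lin_sumE //.
by apply: eq_bigr => q _.
Qed.

Lemma tsum_eta V W (t : V ⊗ W) : \tsum_(v, w <- t) v ⊗ w = t.
Proof. by rewrite {2}(tensE t). Qed.

Lemma eq_tsum V W U (f g : V -> W -> U) (t : V ⊗ W) :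
  (forall v w, f v w = g v w) -> tsum f t = tsum g t.
Proof. by move=> fg; apply: eq_bigr => q _. Qed.

Lemma eq_tsumk V W (f g : V -> W -> k) (t : V ⊗ W) : (forall v w, f v w = g v w) ->
  tsum (f : V -> W -> k^o) t = tsum (g : V -> W -> k^o) t :> k.
Proof. by move=> fg; apply: eq_bigr => q _; exact: fg. Qed.

Lemma lin_tsumE V W U Z (g : U -> Z) (f : V -> W -> U) (t : V ⊗ W) :
  is_linear g -> g (tsum f t) = \tsum_(v, w <- t) g (f v w).
Proof. by move=> gl; exact: lin_sumE. Qed.

Lemma tsumZ V W U c (f : V -> W -> U) (t : V ⊗ W) :
  c *: tsum f t = \tsum_(v, w <- t) c *: f v w.
Proof. exact: scaler_sumr. Qed.

Lemma tsumD V W U (f g : V -> W -> U) (t : V ⊗ W) :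
  tsum f t + tsum g t = \tsum_(v, w <- t) (f v w + g v w).
Proof. by rewrite [RHS]big_split. Qed.

Lemma exchange_tsum V W (V' W' : lmodType k) U (f : V -> W -> V' -> W' -> U) (t : V ⊗ W)
    (t' : V' ⊗ W') :
  \tsum_(v, w <- t) \tsum_(v', w' <- t') f v w v' w' =
  \tsum_(v', w' <- t') \tsum_(v, w <- t) f v w v' w'.
Proof. exact: exchange_big. Qed.

Lemma tsum_tsum V W (V' W' : lmodType k) U (f : V' -> W' -> U) (F : V -> W -> V' ⊗ W') (t : V ⊗ W) :
  is_bilinear f -> tsum f (tsum F t) = \tsum_(v, w <- t) tsum f (F v w).
Proof. by move=> fB; apply: lin_tsumE; exact: tsum_linear. Qed.

Lemma tsum0 V W U (f : V -> W -> U) (t : V ⊗ W) :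
  (forall v w, f v w = 0) -> tsum f t = 0.
Proof. by move=> f0; apply: big1 => q _. Qed.

End LinearMaps.

(** * Gradings given by projections, and gradings of tensor products *)

Section Gradings.
Variable k : fieldType.
Implicit Types V W U Z : lmodType k.

Section OneGrading.
Variables (V : lmodType k) (pr : nat -> V -> V).
Hypothesis gr : is_grading pr.

Lemma homog_pr n v : homog pr n (pr n v).
Proof. by rewrite /homog (grading_orthogonal gr) eqxx. Qed.

Lemma pr_homog m n v : homog pr n v -> pr m v = if m == n then v else 0.
Proof. by move=> hv; rewrite -{1}hv (grading_orthogonal gr) hv. Qed.

Lemma pr_lin n : is_linear (pr n).
Proof. exact: grading_linear. Qed.

Lemma homog_lin n c v w : homog pr n v -> homog pr n w -> homog pr n (c *: v + w).
Proof. by move=> hv hw; rewrite /homog pr_lin hv hw. Qed.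

Lemma homog0 n : homog pr n 0.
Proof. exact: (lin0 (pr_lin n)). Qed.

Lemma homogZ n c v : homog pr n v -> homog pr n (c *: v).
Proof. by move=> hv; rewrite -[c *: v]addr0; apply: homog_lin => //; exact: homog0. Qed.

Lemma homogD n v w : homog pr n v -> homog pr n w -> homog pr n (v + w).
Proof. by move=> hv hw; rewrite -[v]scale1r; exact: homog_lin. Qed.

Lemma homog_sum n (I : Type) (r : seq I) (P : pred I) (F : I -> V) :
  (forall i, P i -> homog pr n (F i)) -> homog pr n (\sum_(i <- r | P i) F i).
Proof.
by move=> hF; elim/big_rec: _ => [|i x Pi hx]; [exact: homog0|exact: homogD (hF _ Pi) hx].
Qed.

Lemma grading_bound v : exists N, forall n, (N <= n)%N -> pr n v = 0.
Proof.
have [N vE] := grading_finite gr v; exists N => n Nn.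
rewrite vE (lin_sumE _ _ _ (pr_lin n)) big1 // => i _.
rewrite (grading_orthogonal gr); case: eqP => // ni.
by have := ltn_ord i; rewrite -ni ltnNge Nn.
Qed.

(** Signs depend on degrees. This lemma and its multilinear variants reduce identities to
    homogeneous arguments, for which the signs are explicit. *)
Lemma homog_ext U (f g : V -> U) : is_linear f -> is_linear g ->
  (forall n v, homog pr n v -> f v = g v) -> forall v, f v = g v.
Proof.
move=> fl gl fg v; have [N ->] := grading_finite gr v.
rewrite !lin_sumE //; apply: eq_bigr => i _; apply: (fg i); exact: homog_pr.
Qed.

End OneGrading.

Lemma homog_ext2 V W U (prV : nat -> V -> V) (prW : nat -> W -> W)
    (f g : V -> W -> U) : is_grading prV -> is_grading prW ->
  is_bilinear f -> is_bilinear g ->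
  (forall m n v w, homog prV m v -> homog prW n w -> f v w = g v w) ->
  forall v w, f v w = g v w.
Proof.
move=> gV gW fB gB fg v w; move: v.
apply: (homog_ext gV) => [c x y|c x y|m v hv]; [exact: fB.1|exact: gB.1|].
move: w; apply: (homog_ext gW) => [c x y|c x y|n w hw]; [exact: fB.2|exact: gB.2|].
exact: fg hv hw.
Qed.

Lemma tsum_hext V W U (prV : nat -> V -> V) (prW : nat -> W -> W)
    (f g : V -> W -> U) (t : V ⊗ W) : is_grading prV -> is_grading prW ->
  is_bilinear f -> is_bilinear g ->
  (forall m n v w, homog prV m v -> homog prW n w -> f v w = g v w) ->
  tsum f t = tsum g t.
Proof. by move=> gV gW fB gB fg; apply: eq_tsum; exact: homog_ext2 fg. Qed.

Section TensorGrading.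
Variables (V W : lmodType k) (prV : nat -> V -> V) (prW : nat -> W -> W).
Hypotheses (gV : is_grading prV) (gW : is_grading prW).

Lemma tensor_grading_bil n :
  is_bilinear (fun v w => \sum_(i < n.+1) prV i v ⊗ prW (n - i)%N w).
Proof.
apply: is_bilinearP => x; apply: lin_sum => i.
  by apply: tens_lin_l; exact: pr_lin.
by apply: tens_lin_r; exact: pr_lin.
Qed.

Lemma tensor_grading_tens m i j v w : homog prV i v -> homog prW j w ->
  tensor_grading prV prW m (v ⊗ w) = if m == (i + j)%N then v ⊗ w else 0.
Proof.
move=> hv hw; rewrite /tensor_grading tsum_tens; last exact: tensor_grading_bil.
case: eqP => [->|ne].
  have lt : (i < (i + j).+1)%N by rewrite ltnS leq_addr.
  rewrite (bigD1 (Ordinal lt)) //= addKn hv hw big1 ?addr0 // => l nl.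
  rewrite (pr_homog gV _ hv); case: eqP => [il|_]; last by rewrite tens0l.
  by case/eqP: nl; apply: val_inj; rewrite /= il.
rewrite big1 // => l _; rewrite (pr_homog gV _ hv); case: eqP => [il|_]; last by rewrite tens0l.
rewrite (pr_homog gW _ hw); case: eqP => [jl|_]; last by rewrite tens0r.
by case: ne; rewrite -il -jl subnKC // -ltnS.
Qed.

Lemma homog_tens i j v w : homog prV i v -> homog prW j w ->
  homog (tensor_grading prV prW) (i + j) (v ⊗ w).
Proof. by move=> hv hw; rewrite /homog (tensor_grading_tens _ hv hw) eqxx. Qed.

Lemma tensor_grading_lin n : is_linear (tensor_grading prV prW n).
Proof. exact: tsum_linear (tensor_grading_bil n). Qed.

Lemma tens_hext U (f g : V ⊗ W -> U) : is_linear f -> is_linear g ->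
  (forall m n v w, homog prV m v -> homog prW n w -> f (v ⊗ w) = g (v ⊗ w)) ->
  forall t, f t = g t.
Proof.
move=> fl gl fg; apply: tens_ext => //; apply: (homog_ext2 gV gW) => //.
- by apply: is_bilinearP => x; apply: lin_comp => //; [exact: tens_lin_l|exact: tens_lin_r].
- by apply: is_bilinearP => x; apply: lin_comp => //; [exact: tens_lin_l|exact: tens_lin_r].
Qed.

Lemma tensor_is_grading : is_grading (tensor_grading prV prW).
Proof.
have lin := tensor_grading_lin; split=> // [m n t|t].
  have lC (b : bool) : is_linear (fun t : V ⊗ W => if b then tensor_grading prV prW n t else 0).
    by case: b => //; exact: lin_zero.
  move: t; apply: tens_hext => // [|i j v w hv hw]; first exact: lin_comp.
  rewrite !(tensor_grading_tens _ hv hw); case: (n =P _) => [->|_].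
    by rewrite (tensor_grading_tens _ hv hw).
  by rewrite (lin0 (lin m)) if_same.
(* The expansion is claimed for every large bound and not for a single one, so that it passes to
   sums of tensors. *)
suff [N tN] : exists N, forall M, (N <= M)%N -> t = \sum_(n < M) tensor_grading prV prW n t.
  by exists N; exact: tN.
rewrite [t]tensE; elim/big_ind: _ => [|x y [N xN] [N' yN]|[v w] _ /=].
- by exists 0%N => M _; rewrite big1 // => i _; rewrite (lin0 (lin i)).
- exists (maxn N N') => M; rewrite geq_max => /andP[/xN {1}-> /yN {1}->].
  by rewrite -big_split; apply: eq_bigr => i _; rewrite linD.
have [N vE] := grading_finite gV v; have [N' wE] := grading_finite gW w.
rewrite vE (lin_sumE (f := fun v => v ⊗ w)); last exact: tens_lin_l.
rewrite wE; elim/big_ind: _ => [|x y [Nx xN] [Ny yN]|i _].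
- by exists 0%N => M _; rewrite big1 // => i _; rewrite (lin0 (lin i)).
- exists (maxn Nx Ny) => M; rewrite geq_max => /andP[/xN {1}-> /yN {1}->].
  by rewrite -big_split; apply: eq_bigr => i _; rewrite linD.
rewrite (lin_sumE (f := fun w => prV i v ⊗ w)); last exact: tens_lin_r.
elim/big_ind: _ => [|x y [Nx xN] [Ny yN]|j _].
- by exists 0%N => M _; rewrite big1 // => l _; rewrite (lin0 (lin l)).
- exists (maxn Nx Ny) => M; rewrite geq_max => /andP[/xN {1}-> /yN {1}->].
  by rewrite -big_split; apply: eq_bigr => l _; rewrite linD.
have hv := homog_pr gV i v; have hw := homog_pr gW j w.
exists (i + j).+1 => M ijM; rewrite (bigD1 (Ordinal ijM)) //=.
rewrite (tensor_grading_tens _ hv hw) eqxx big1 ?addr0 // => l nl.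
rewrite (tensor_grading_tens _ hv hw); case: eqP => // ll.
by case/eqP: nl; apply: val_inj.
Qed.

(** A tensor of degree N equals its own component of degree N, in which only pairs with degrees
    adding up to N occur. *)
Lemma tsum_hextN U (f g : V -> W -> U) N (t : V ⊗ W) :
  homog (tensor_grading prV prW) N t -> is_bilinear f -> is_bilinear g ->
  (forall m n v w, (m + n)%N = N -> homog prV m v -> homog prW n w -> f v w = g v w) ->
  tsum f t = tsum g t.
Proof.
move=> <- fB gB fg; rewrite /tensor_grading !tsum_tsum //; apply: eq_tsum => v w.
rewrite !(lin_sumE _ _ _ (tsum_linear _)) //; apply: eq_bigr => i _.
rewrite !tsum_tens //; apply: (fg i (N - i)%N); [|exact: homog_pr..].
by rewrite subnKC // -ltnS.
Qed.

End TensorGrading.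
End Gradings.

(** * Sums over homogeneous components *)

Section HomogeneousSums.
Variables (k : fieldType) (X : dga k).
Hypothesis gr : is_grading (@gpr k X).
Implicit Types V W U : lmodType k.

Lemma hsumE U (F : nat -> X -> U) v N : (forall n, F n 0 = 0) ->
  (forall n, (N <= n)%N -> gpr n v = 0) ->
  hsum F v = \sum_(n < N) F n (gpr n v).
Proof.
move=> F0 vN; rewrite /hsum (fsbigE (iota 0 N)) ?iota_uniq //.
  rewrite (eq_bigl xpredT) => [|i]; last by rewrite in_setT.
  by rewrite -[N in iota 0 N]subn0 big_mkord.
move=> n _; rewrite mem_iota /= add0n -leqNgt => /vN ->; exact: F0.
Qed.

(** All other components are 0 and linearity kills their terms. This turns a sum over components
    into a single term with a definite sign. *)
Lemma hsum_homog U (F : nat -> X -> U) n v : homog (@gpr k X) n v ->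
  (forall n, is_linear (F n)) -> hsum F v = F n v.
Proof.
move=> hv Fl; rewrite (@hsumE _ _ _ n.+1) => [|m|m nm].
- rewrite big_ord_recr /= hv big1 ?add0r // => i _.
  rewrite (pr_homog gr _ hv) ltn_eqF //; exact: lin0 (Fl _).
- exact: (lin0 (Fl _)).
- by rewrite (pr_homog gr _ hv) gtn_eqF.
Qed.

Lemma lin_hsum V U (F : nat -> X -> U) (g : V -> X) :
  (forall n, is_linear (F n)) -> is_linear g -> is_linear (fun x => hsum F (g x)).
Proof.
move=> Fl gl; apply: lin_comp => // c x y.
have F0 n : F n 0 = 0 by exact: (lin0 (Fl n)).
have [N xN] := grading_bound gr x; have [M yM] := grading_bound gr y.
rewrite !(@hsumE _ _ _ (maxn N M)) // => [|n|n|n].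
- rewrite scaler_sumr -big_split; apply: eq_bigr => i _.
  by rewrite (pr_lin gr) Fl.
- by rewrite geq_max => /andP[_ /yM].
- by rewrite geq_max => /andP[/xN].
- by rewrite geq_max => /andP[/xN xn /yM yn]; rewrite (pr_lin gr) xn yn scaler0 addr0.
Qed.

Lemma lin_hsum_fun V U (F : V -> nat -> X -> U) (v : X) :
  (forall x n, is_linear (F x n)) -> (forall n v, is_linear (fun x => F x n v)) ->
  is_linear (fun x => hsum (F x) v).
Proof.
move=> Fl Fl' c x y; have [N vN] := grading_bound gr v.
rewrite !(hsumE (N := N)) //; try by move=> n; exact: (lin0 (Fl _ n)).
rewrite scaler_sumr -big_split; apply: eq_bigr => i _; exact: Fl'.
Qed.

Lemma eq_hsum U (F G : nat -> X -> U) v :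
  (forall n, is_linear (F n)) -> (forall n, is_linear (G n)) ->
  (forall n v, homog (@gpr k X) n v -> F n v = G n v) -> hsum F v = hsum G v.
Proof.
move=> Fl Gl FG; have [N vN] := grading_bound gr v.
rewrite !(hsumE (N := N)) //; try by move=> n; exact: (lin0 (Fl n)).
  by apply: eq_bigr => i _; apply: FG; exact: homog_pr.
by move=> n; exact: (lin0 (Gl n)).
Qed.

Lemma lin_hsumE U W (g : U -> W) (F : nat -> X -> U) v : is_linear g ->
  (forall n, is_linear (F n)) -> g (hsum F v) = \hsum_(w @ n <- v) g (F n w).
Proof.
move=> gl Fl; have [N vN] := grading_bound gr v.
rewrite !(hsumE (N := N)) //; try by move=> n; rewrite ?(lin0 (Fl n)) ?lin0.
by rewrite lin_sumE.
Qed.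

End HomogeneousSums.

#[global] Hint Resolve tens_bilinear : multilinear.

Ltac mlin_leaf := solve [ assumption | eauto 6 with multilinear nocore ].

Ltac is_const f := lazymatch f with (fun _ => ?c) => idtac end.

(** Linearity is read off the syntax. If the variable occurs only in the summand, linearity is
    checked termwise; if it occurs in the tensor or element that is decomposed, the summand has to
    be multilinear and the induced linear map is composed with the rest. *)
Ltac mlin :=
  cbv beta;
  lazymatch goal with
  | |- forall x, @?P x => intro; mlin
  | |- is_bilinear _ =>
      first [ mlin_leaf | apply: is_bilinearP; mlin ]
  | |- is_grading _ => mlin_leaf
  | |- is_linear (fun x => x) => exact: lin_id
  | |- is_linear (fun x => tsum (@?F x) (@?t x)) =>
      tryif is_const t then (apply: lin_tsum_fun; mlin) else (apply: lin_tsum; mlin)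
  | |- is_linear (fun x => hsum (@?F x) (@?t x)) =>
      tryif is_const t then (apply: lin_hsum_fun; mlin) else (apply: lin_hsum; mlin)
  | |- is_linear (fun x => (@?f x) *: (@?v x)) =>
      tryif is_const v then (apply: lin_scale_l; mlin) else (apply: lin_scale_r; mlin)
  | |- is_linear (fun x => (@?f x) * (@?v x)) =>
      tryif is_const v then (apply: lin_mul_l; mlin) else (apply: lin_mul_r; mlin)
  | |- is_linear (fun x => (@?f x) + (@?g x)) => apply: lin_add; mlin
  | |- is_linear (fun x => - (@?f x)) => apply: lin_opp; mlin
  | |- is_linear (fun x => \sum_(i <- _ | _) _) => apply: lin_sum; mlin
  | |- is_linear _ =>
      first
        [ mlin_leaf
        | lazymatch goal with |- @is_linear ?k ?V ?U (fun x => ?h (@?g x) ?c) =>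
            first [ apply: (@lin_bil_l k V _ _ _ h g c); [mlin_leaf | mlin]
                  | apply: (@lin_bil_l k V _ U _ h g c); [mlin_leaf | mlin] ] end
        | lazymatch goal with |- @is_linear ?k ?V ?U (fun x => ?h ?c (@?g x)) =>
            first [ apply: (@lin_bil_r k V _ _ _ h g c); [mlin_leaf | mlin]
                  | apply: (@lin_bil_r k V _ U _ h g c); [mlin_leaf | mlin] ] end
        | lazymatch goal with |- @is_linear ?k ?V ?U (fun x => ?h (@?g x)) =>
            first [ apply: (@lin_comp k V _ _ h g); [mlin_leaf | mlin]
                  | apply: (@lin_comp k V _ U h g); [mlin_leaf | mlin] ] end
        | lazymatch goal with |- @is_linear ?k ?V ?U (?h ?c) =>
            change (@is_linear k V U (fun x => h c x)); mlin end ]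
  | |- _ => try mlin_leaf
  end.

Lemma eq_sign (k : fieldType) m n : odd m = odd n -> (-1) ^+ m = (-1) ^+ n :> k.
Proof. by move=> mn; rewrite -signr_odd mn signr_odd. Qed.

(** Two powers of -1 agree when their exponents do modulo 2, which is settled by trying both
    parities of each degree. *)
Ltac parity :=
  apply: eq_sign; rewrite ?(oddD, oddM, oddS);
  repeat match goal with |- context [odd ?n] => case: (odd n) end; reflexivity.

Ltac signs :=
  rewrite ?scalerA ?mulrA -?exprD; apply: (congr1 (fun c => c *: _)); parity.

Tactic Notation "hsum_at" constr(g) constr(h) := rewrite (hsum_homog g h); [|mlin..].

(** * Differential graded bialgebras *)

Section TrilinearExt.
Variable k : fieldType.

Lemma homog_ext3 (V1 V2 V3 U : lmodType k) pr1 pr2 pr3 (f g : V1 -> V2 -> V3 -> U) :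
  is_grading pr1 -> is_grading pr2 -> is_grading pr3 ->
  (forall y z, is_linear (fun x => f x y z)) -> (forall x z, is_linear (fun y => f x y z)) ->
  (forall x y, is_linear (fun z => f x y z)) ->
  (forall y z, is_linear (fun x => g x y z)) -> (forall x z, is_linear (fun y => g x y z)) ->
  (forall x y, is_linear (fun z => g x y z)) ->
  (forall l m n x y z, homog pr1 l x -> homog pr2 m y -> homog pr3 n z ->
     f x y z = g x y z) ->
  forall x y z, f x y z = g x y z.
Proof.
move=> g1 g2 g3 f1 f2 f3 e1 e2 e3 fg x y z; move: x.
apply: (homog_ext g1) => // l x hx; move: y z.
by apply: (homog_ext2 g2 g3); [apply: is_bilinearP..|move=> *; apply: fg; eassumption].
Qed.

Lemma tens_hext2 (V W V' W' U : lmodType k) prV prW prV' prW'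
    (f g : V ⊗ W -> V' ⊗ W' -> U) :
  is_grading prV -> is_grading prW -> is_grading prV' -> is_grading prW' ->
  is_bilinear f -> is_bilinear g ->
  (forall i j m n v w v' w', homog prV i v -> homog prW j w ->
     homog prV' m v' -> homog prW' n w' -> f (v ⊗ w) (v' ⊗ w') = g (v ⊗ w) (v' ⊗ w')) ->
  forall s t, f s t = g s t.
Proof.
move=> g1 g2 g3 g4 fB gB fg s t; move: s.
apply: (tens_hext g1 g2) => [c x y|c x y|i j v w hv hw]; [exact: fB.1|exact: gB.1|].
move: t; apply: (tens_hext g3 g4) => [c x y|c x y|m n v' w' hv' hw'].
- exact: fB.2.
- exact: gB.2.
- exact: fg hv hw hv' hw'.
Qed.

(* Unlike in tsum F t, the degrees of the components are available in the sum. *)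
Lemma tens_expand (V W : lmodType k) (prV : nat -> V -> V) (prW : nat -> W -> W) N
    (t : V ⊗ W) : is_grading prV -> is_grading prW ->
  homog (tensor_grading prV prW) N t ->
  exists (I : finType) (d e : I -> nat) (v : I -> V) (w : I -> W),
    [/\ forall i, homog prV (d i) (v i), forall i, homog prW (e i) (w i),
        forall i, N = (d i + e i)%N
      & forall (U : lmodType k) (F : V -> W -> U), is_bilinear F ->
          tsum F t = \sum_i F (v i) (w i)].
Proof.
move=> gV gW ht; pose q j := nth (0, 0) (repr t) j.
exists (('I_(size (repr t)) * 'I_N.+1)%type : finType).
pose I := ('I_(size (repr t)) * 'I_N.+1)%type.
exists (fun i : I => i.2 : nat), (fun i : I => N - i.2)%N.
exists (fun i : I => prV i.2 (q i.1).1), (fun i : I => prW (N - i.2)%N (q i.1).2).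
split=> [i|i|i|U F FB]; [exact: homog_pr..| |].
  by rewrite subnKC // -ltnS.
rewrite -(pair_bigA _ (fun (j : 'I__) (i : 'I_N.+1) => F (prV i (q j).1) (prW (N - i)%N (q j).2))) /=.
have -> : tsum F t = \sum_(r <- repr t) tsum F (\sum_(i < N.+1) prV i r.1 ⊗ prW (N - i)%N r.2).
  by rewrite -{1}ht /tensor_grading tsum_tsum.
rewrite (big_nth (0, 0)) big_mkord; apply: eq_bigr => j _; rewrite (lin_sumE _ _ _ (tsum_linear FB)).
by apply: eq_bigr => i _; rewrite tsum_tens.
Qed.

End TrilinearExt.

Section DgBialgebras.
Variable k : fieldType.

(** Strong bicovariance without antipode and generation, but with the counit vanishing in positive
    degrees. This class is stable under super opposites, super tensor products and degree zero
    cocycle twists, so the exterior double is constructed inside it. *)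
Record is_dgbi (X : dgbialg k) : Prop := IsDgbi {
  dgbi_dga : is_dga X;
  dgbi_coalg : is_coalg X;
  dgbi_cop_degree :
    degree_preserving (@gpr k X) (tensor_grading (@gpr k X) (@gpr k X)) (@cop k X);
  dgbi_cou_degree : forall n x, homog (@gpr k X) n.+1 x -> cou x = 0;
  dgbi_cop_mul : forall x y : X, cop (x ∙ y) = super_tensor_mul (cop x) (cop y);
  dgbi_cop_one : cop (aone X) = aone X ⊗ aone X;
  dgbi_cou_mul : forall x y : X, cou (x ∙ y) = cou x * cou y;
  dgbi_cou_one : cou (aone X) = 1;
  dgbi_cop_d : forall x : X, cop (gd x) = super_tensor_d (cop x) }.

Lemma mul_bil (A : alg k) : is_alg A -> is_bilinear (@amul k A).
Proof. by case. Qed.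

Lemma dgbi_alg (X : dgbialg k) : is_dgbi X -> is_alg X.
Proof. by case; case. Qed.

Lemma dgbi_balg (X : dgbialg k) : is_dgbi X -> is_alg (balg (dgb_bialg X)).
Proof. by case; case. Qed.

Lemma gr_gpr_lin (X : dga k) n : is_grading (@gpr k X) -> is_linear (@gpr k X n).
Proof. by move=> gr; exact: pr_lin. Qed.

End DgBialgebras.

#[global] Hint Resolve mul_bil dgbi_alg dgbi_balg dgbi_dga dgbi_coalg is_dga_alg is_coalg_cop_linear
  is_coalg_cou_linear is_dga_d_linear gr_gpr_lin is_dga_grading : multilinear.

Section Coalgebras.
Variables (k : fieldType).

(** Coassociativity composed with the linear map induced by a trilinear F, so that legs can be
    regrouped under any summand. *)
Lemma coassoc (C : bialg k) (U : lmodType k) (F : C -> C -> C -> U) x : is_coalg C ->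
  (forall b c, is_linear (fun a => F a b c)) ->
  (forall a c, is_linear (fun b => F a b c)) ->
  (forall a b, is_linear (fun c => F a b c)) ->
  \tsum_(x12, x3 <- cop x) \tsum_(x1, x2 <- cop x12) F x1 x2 x3 =
  \tsum_(x1, x23 <- cop x) \tsum_(x2, x3 <- cop x23) F x1 x2 x3.
Proof.
move=> hC F1 F2 F3; have := congr1 (tsum (fun a => tsum (F a))) (is_coalg_coassoc hC x).
have B a : is_bilinear (F a) by apply: is_bilinearP => ?; [exact: F2|exact: F3].
have B' : is_bilinear (fun a => tsum (F a)) by mlin.
rewrite !tsum_tsum // => E.
transitivity (\tsum_(x12, x3 <- cop x) tsum (fun a => tsum (F a))
  (\tsum_(x1, x2 <- cop x12) x1 ⊗ (x2 ⊗ x3))).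
  apply: eq_tsum => x12 x3; rewrite tsum_tsum //; apply: eq_tsum => x1 x2.
  by rewrite !tsum_tens.
by rewrite E; apply: eq_tsum => x1 x23; rewrite tsum_tens.
Qed.

Lemma counitl (C : bialg k) (U : lmodType k) (F : C -> U) x : is_coalg C ->
  is_linear F -> \tsum_(x1, x2 <- cop x) cou x1 *: F x2 = F x.
Proof.
move=> hC Fl; rewrite -{2}(is_coalg_left_counit hC x) lin_tsumE //.
by apply: eq_tsum => a b; rewrite linZ.
Qed.

Lemma counitr (C : bialg k) (U : lmodType k) (F : C -> U) x : is_coalg C ->
  is_linear F -> \tsum_(x1, x2 <- cop x) cou x2 *: F x1 = F x.
Proof.
move=> hC Fl; rewrite -{2}(is_coalg_right_counit hC x) lin_tsumE //.
by apply: eq_tsum => a b; rewrite linZ.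
Qed.

End Coalgebras.

Section DgBialgebraTheory.
Variables (k : fieldType) (X : dgbialg k).
Hypothesis hX : is_dgbi X.
Implicit Type U : lmodType k.
Local Notation hg := (homog (@gpr k X)).

Let gr : is_grading (@gpr k X). Proof. by case: hX => -[]. Qed.

Lemma homog_cop n x : hg n x -> homog (tensor_grading (@gpr k X) (@gpr k X)) n (cop x).
Proof. exact: (dgbi_cop_degree hX). Qed.

Lemma homog_mul m n x y : hg m x -> hg n y -> hg (m + n) (x ∙ y).
Proof. exact: (is_dga_mul (dgbi_dga hX)). Qed.

Lemma homog_d n x : hg n x -> hg n.+1 (gd x).
Proof. exact: (is_dga_d_degree (dgbi_dga hX)). Qed.

Lemma homog_one : hg 0 (aone X).
Proof. exact: (is_dga_one (dgbi_dga hX)). Qed.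

Lemma cop_hext U (f g : X -> X -> U) N x : hg N x -> is_bilinear f -> is_bilinear g ->
  (forall m n a b, (m + n)%N = N -> hg m a -> hg n b -> f a b = g a b) ->
  tsum f (cop x) = tsum g (cop x).
Proof. by move=> hx; apply: tsum_hextN => //; exact: homog_cop. Qed.

Lemma cop_expand N x : hg N x ->
  exists (I : finType) (d e : I -> nat) (v w : I -> X),
    [/\ forall i, hg (d i) (v i), forall i, hg (e i) (w i),
        forall i, N = (d i + e i)%N
      & forall U (F : X -> X -> U), is_bilinear F ->
          tsum F (cop x) = \sum_i F (v i) (w i)].
Proof. by move=> hx; exact: (tens_expand gr gr (homog_cop hx)). Qed.

Lemma tsum_cop_mul U (F : X -> X -> U) x y : is_bilinear F ->
  tsum F (cop (x ∙ y)) = \tsum_(x1, x2 <- cop x) \tsum_(y1, y2 <- cop y)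
    \hsum_(x2' @ m <- x2) \hsum_(y1' @ n <- y1) (-1) ^+ (m * n) *: F (x1 ∙ y1') (x2' ∙ y2).
Proof.
move=> FB; rewrite (dgbi_cop_mul hX) /super_tensor_mul tsum_tsum //.
apply: eq_tsum => a b; rewrite tsum_tsum //; apply: eq_tsum => c d.
rewrite (lin_hsumE gr _ (tsum_linear FB)); [|mlin..].
apply: (eq_hsum gr); [mlin..|] => m b' hb.
rewrite (lin_hsumE gr _ (tsum_linear FB)); [|mlin..].
apply: (eq_hsum gr); [mlin..|] => n c' hc.
by rewrite (linZ _ _ (tsum_linear FB)) tsum_tens.
Qed.

Lemma tsum_cop_d U (F : X -> X -> U) x : is_bilinear F ->
  tsum F (cop (gd x)) =
  \tsum_(x1, x2 <- cop x) (F (gd x1) x2 + \hsum_(x1' @ n <- x1) (-1) ^+ n *: F x1' (gd x2)).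
Proof.
move=> FB; rewrite (dgbi_cop_d hX) /super_tensor_d tsum_tsum //.
apply: eq_tsum => a b; rewrite (linD _ _ (tsum_linear FB)) tsum_tens //.
rewrite (lin_hsumE gr _ (tsum_linear FB)); [|mlin..].
congr (_ + _); apply: (eq_hsum gr); [mlin..|] => m b' hb.
by rewrite (linZ _ _ (tsum_linear FB)) tsum_tens.
Qed.

Lemma tsum_cop_one U (F : X -> X -> U) : is_bilinear F ->
  tsum F (cop (aone X)) = F (aone X) (aone X).
Proof. by move=> FB; rewrite (dgbi_cop_one hX) tsum_tens. Qed.

Lemma mulZl c (x y : X) : (c *: x) ∙ y = c *: (x ∙ y).
Proof. by apply: (linZ (f := fun x => x ∙ y)); mlin. Qed.

Lemma mulZr c (x y : X) : x ∙ (c *: y) = c *: (x ∙ y).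
Proof. by apply: (linZ (f := fun y => x ∙ y)); mlin. Qed.

Lemma mulDl (x y z : X) : (x + y) ∙ z = x ∙ z + y ∙ z.
Proof. by apply: (linD (f := fun x => x ∙ z)); mlin. Qed.

Lemma mulDr (x y z : X) : x ∙ (y + z) = x ∙ y + x ∙ z.
Proof. by apply: (linD (f := fun y => x ∙ y)); mlin. Qed.

Lemma dg_mulA : associative (@amul k X).
Proof. exact: is_alg_assoc (dgbi_alg hX). Qed.

Lemma dg_mul1 : left_id (aone X) (@amul k X).
Proof. exact: is_alg_left_id (dgbi_alg hX). Qed.

Lemma dg_mulr1 : right_id (aone X) (@amul k X).
Proof. exact: is_alg_right_id (dgbi_alg hX). Qed.

Lemma dgbi_grading : is_grading (@gpr k X).
Proof. exact: gr. Qed.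

End DgBialgebraTheory.

#[global] Hint Resolve dgbi_grading : multilinear.

(** * The super-opposite algebra *)

Section SuperOpposite.
Variables (k : fieldType) (X : dgbialg k).
Hypothesis hX : is_dgbi X.
Local Notation hg := (homog (@gpr k X)).

Definition sop_mul (x y : X) : X :=
  \hsum_(x' @ m <- x) \hsum_(y' @ n <- y) (-1) ^+ (m * n) *: (y' ∙ x').

Definition sop : dgbialg k :=
  @DgBialg k (@Dga k (@Alg k X sop_mul (aone X)) (@gpr k X) (@gd k X))
    (@cop k X) (@cou k X).

Let gr := dgbi_grading hX.

Lemma sop_mulE m n x y : hg m x -> hg n y ->
  @amul k sop x y = (-1) ^+ (m * n) *: @amul k X y x.
Proof.
move=> hx hy; rewrite -[LHS]/(sop_mul x y) /sop_mul (hsum_homog gr hx); [|mlin..].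
by hsum_at gr hy.
Qed.

Lemma sop_mul_bil : is_bilinear sop_mul.
Proof. by rewrite /sop_mul; mlin. Qed.

Hint Resolve sop_mul_bil : multilinear.

Lemma sop_mulA : associative sop_mul.
Proof.
have hs m n x y : hg m x -> hg n y -> sop_mul x y = (-1) ^+ (m * n) *: (y ∙ x).
  exact: sop_mulE.
apply: (homog_ext3 (f := fun x y z => sop_mul x (sop_mul y z)) gr gr gr); [mlin..|].
move=> l m n x y z hx hy hz.
rewrite (hs _ _ _ _ hx hy) (hs _ _ _ _ hy hz).
rewrite (linZ (f := fun x => sop_mul x z)); [|mlin..].
rewrite (linZ (f := sop_mul x)); [|mlin..].
rewrite (hs _ _ _ _ hx (homog_mul hX hz hy)) (hs _ _ _ _ (homog_mul hX hy hx) hz).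
by rewrite (dg_mulA hX); signs.
Qed.

(** The Koszul sign of the reversed product exchanges the two terms of the Leibniz rule. For Δ, the
    sign of reversing the whole product agrees modulo 2 with the signs of reversing the two legs and
    of passing them across each other. *)
Lemma sop_dgbi : is_dgbi sop.
Proof.
have hs m n x y : hg m x -> hg n y -> sop_mul x y = (-1) ^+ (m * n) *: (y ∙ x).
  exact: sop_mulE.
have homog_sop m n x y : hg m x -> hg n y -> hg (m + n) (sop_mul x y).
  move=> hx hy; rewrite (hs _ _ _ _ hx hy) addnC.
  by apply: homogZ => //; exact: homog_mul.
have h1 := homog_one hX.
have algS : is_alg sop.
  split=> [||x|x] /=; [exact: sop_mul_bil|exact: sop_mulA| |]; move: x.
  + apply: (homog_ext gr); [mlin..|] => n x hx.
    by rewrite (hs _ _ _ _ h1 hx) scale1r (dg_mulr1 hX).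
  + apply: (homog_ext gr); [mlin..|] => n x hx.
    by rewrite (hs _ _ _ _ hx h1) muln0 scale1r (dg_mul1 hX).
have dgaS : is_dga sop.
  case: (dgbi_dga hX) => _ _ _ _ dl dd ddd leib; split=> //= n x y hx.
  move: y; apply: (homog_ext gr); [mlin..|] => m y hy.
  rewrite (hs _ _ _ _ hx hy) (linZ _ _ dl) (leib _ _ _ hy).
  rewrite (hs _ _ _ _ (homog_d hX hx) hy) (hs _ _ _ _ hx (homog_d hX hy)).
  rewrite scalerDr addrC; congr (_ + _); first by signs.
  by signs.
have cop_sop x y : cop (sop_mul x y) = @super_tensor_mul k sop sop (cop x) (cop y).
  move: x y; apply: (homog_ext2 (f := fun x y : X => cop (sop_mul x y)) gr gr).
  - mlin.
  - rewrite /super_tensor_mul; mlin.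
  move=> m n x y hx hy.
  rewrite (hs _ _ _ _ hx hy) (linZ _ _ (is_coalg_cop_linear (dgbi_coalg hX))).
  rewrite -[X in _ *: X]tsum_eta (tsum_cop_mul hX); last exact: tens_bilinear.
  have [I [d [e [u [v [hu hv Dx Ex]]]]]] := cop_expand hX hx.
  have [J [d' [e' [u' [v' [hu' hv' Dy Ey]]]]]] := cop_expand hX hy.
  rewrite exchange_tsum Ex; [|mlin..].
  rewrite /super_tensor_mul Ex; [|mlin..].
  rewrite scaler_sumr; apply: eq_bigr => i _.
  rewrite Ey; [|mlin..].
  rewrite Ey; [|mlin..].
  rewrite scaler_sumr; apply: eq_bigr => j _.
  rewrite !(hsum_homog gr (hv' j)); [|mlin..].
  rewrite !(hsum_homog gr (hu i)); [|mlin..].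
  have grS : is_grading (@gpr k sop) := gr.
  rewrite (hsum_homog (X := sop) grS (hv i)); [|mlin..].
  rewrite (hsum_homog (X := sop) grS (hu' j)); [|mlin..].
  rewrite (sop_mulE (hu i) (hu' j)) (sop_mulE (hv i) (hv' j)) tensZl tensZr.
  by rewrite (Dx i) (Dy j); signs.
have cou_sop x y : cou (sop_mul x y) = cou x * cou y.
  case: (hX) => _ hC cd cud _ c1 cum cu1 cd'.
  move: x y; apply: (homog_ext2 (f := fun x y : X => (cou (sop_mul x y) : k^o)) gr gr);
    [mlin..|] => -[|m] n x y hx hy.
    by rewrite (hs _ _ _ _ hx hy) scale1r cum mulrC.
  rewrite (hs _ _ _ _ hx hy) (linZ _ _ (is_coalg_cou_linear (dgbi_coalg hX))).
  by rewrite cum (cud _ _ hx) mulr0 mul0r scaler0.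
case: (hX) => _ hC cd cud _ c1 cum cu1 cd'.
by split=> //=; case: hC.
Qed.

End SuperOpposite.

(** * The super tensor product of two differential graded bialgebras *)

Section SuperTensor.
Variables (k : fieldType) (X Y : dgbialg k).
Hypotheses (hX : is_dgbi X) (hY : is_dgbi Y).
Local Notation hgX := (homog (@gpr k X)).
Local Notation hgY := (homog (@gpr k Y)).

Definition stens : dgbialg k :=
  @DgBialg k
    (@Dga k (@Alg k (tensor X Y) (@super_tensor_mul k X Y) (aone X ⊗ aone Y))
      (tensor_grading (@gpr k X) (@gpr k Y)) (@super_tensor_d k X Y))
    (@ext_double_cop k X Y) (@ext_double_cou k X Y).

Local Notation hg := (homog (@gpr k stens)).

Let gX := dgbi_grading hX.
Let gY := dgbi_grading hY.

Lemma stens_mul_bil : is_bilinear (@super_tensor_mul k X Y).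
Proof. by rewrite /super_tensor_mul; mlin. Qed.
Hint Resolve stens_mul_bil : multilinear.

Lemma stens_d_lin : is_linear (@super_tensor_d k X Y).
Proof. by rewrite /super_tensor_d; mlin. Qed.
Hint Resolve stens_d_lin : multilinear.

Lemma stens_cop_lin : is_linear (@ext_double_cop k X Y).
Proof. by rewrite /ext_double_cop; mlin. Qed.
Hint Resolve stens_cop_lin : multilinear.

Lemma stens_cou_lin : is_linear (@ext_double_cou k X Y : X ⊗ Y -> k^o).
Proof. by rewrite /ext_double_cou; mlin. Qed.
Hint Resolve stens_cou_lin : multilinear.

Lemma stens_grading : is_grading (@gpr k stens).
Proof. exact: tensor_is_grading. Qed.
Hint Resolve stens_grading : multilinear.

Lemma stens_mulE m n (a : X) (b : Y) (c : X) (d : Y) : hgY m b -> hgX n c ->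
  super_tensor_mul (a ⊗ b) (c ⊗ d) = (-1) ^+ (m * n) *: ((a ∙ c) ⊗ (b ∙ d)).
Proof.
move=> hb hc; rewrite /super_tensor_mul tsum_tens; [|mlin..].
rewrite tsum_tens; [|mlin..].
by rewrite (hsum_homog gY hb) ?(hsum_homog gX hc) //; mlin.
Qed.

Lemma stens_dE n (a : X) (b : Y) : hgX n a ->
  super_tensor_d (a ⊗ b) = gd a ⊗ b + (-1) ^+ n *: (a ⊗ gd b).
Proof.
move=> ha; rewrite /super_tensor_d tsum_tens; [|mlin..].
by rewrite (hsum_homog gX ha) //; mlin.
Qed.

Lemma tsum_stens_cop (U : lmodType k) (F : X ⊗ Y -> X ⊗ Y -> U) (w : X) (y : Y) : is_bilinear F ->
  tsum F (ext_double_cop (w ⊗ y)) = \tsum_(w1, w2 <- cop w) \tsum_(y1, y2 <- cop y)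
    \hsum_(w2' @ m <- w2) \hsum_(y1' @ n <- y1) (-1) ^+ (m * n) *: F (w1 ⊗ y1') (w2' ⊗ y2).
Proof.
move=> FB; rewrite /ext_double_cop tsum_tens; [|mlin..].
rewrite tsum_tsum //; apply: eq_tsum => a b; rewrite tsum_tsum //; apply: eq_tsum => c d.
rewrite (lin_hsumE gX _ (tsum_linear FB)); [|mlin..].
apply: (eq_hsum gX); [mlin..|] => m b' hb.
rewrite (lin_hsumE gY _ (tsum_linear FB)); [|mlin..].
apply: (eq_hsum gY); [mlin..|] => n c' hc.
by rewrite (linZ _ _ (tsum_linear FB)) tsum_tens.
Qed.

Lemma stens_couE (w : X) (y : Y) : ext_double_cou (w ⊗ y) = cou w * cou y.
Proof. by rewrite /ext_double_cou tsum_tens //; mlin. Qed.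

Lemma stens_expand n (t : X ⊗ Y) : hg n t ->
  exists (I : finType) (d e : I -> nat) (v : I -> X) (w : I -> Y),
    [/\ forall i, hgX (d i) (v i), forall i, hgY (e i) (w i),
        forall i, n = (d i + e i)%N & t = \sum_i v i ⊗ w i].
Proof.
move=> ht; have [I [d [e [v [w [hv hw D E]]]]]] := tens_expand gX gY ht.
exists I, d, e, v, w; split=> //; rewrite -[t]tsum_eta E //; exact: tens_bilinear.
Qed.

Lemma homog_stens m n (x : X) (y : Y) : hgX m x -> hgY n y -> hg (m + n) (x ⊗ y).
Proof. exact: homog_tens. Qed.

Lemma stens_mulA : associative (@super_tensor_mul k X Y).
Proof.
move=> s t u; move: u; apply: (tens_hext gX gY); [mlin..|] => m3 n3 a3 b3 ha3 hb3.
move: s t; apply: (tens_hext2 gX gY gX gY); [mlin..|].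
move=> m1 n1 m2 n2 a1 b1 a2 b2 ha1 hb1 ha2 hb2.
rewrite (stens_mulE a1 b2 hb1 ha2) (stens_mulE a2 b3 hb2 ha3).
rewrite (linZ (f := fun t => super_tensor_mul t (a3 ⊗ b3))); [|mlin..].
rewrite (linZ (f := super_tensor_mul (a1 ⊗ b1))); [|mlin..].
rewrite (stens_mulE _ _ hb1 (homog_mul hX ha2 ha3)).
rewrite (stens_mulE _ _ (homog_mul hY hb1 hb2) ha3).
by rewrite (dg_mulA hX) (dg_mulA hY); signs.
Qed.

Lemma stens_alg : is_alg stens.
Proof.
split=> [||x|x] /=; [exact: stens_mul_bil|exact: stens_mulA| |]; move: x.
- apply: (tens_hext gX gY); [mlin..|] => m n v w hv hw.
  by rewrite (stens_mulE _ _ (homog_one hY) hv) scale1r (dg_mul1 hX) (dg_mul1 hY).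
- apply: (tens_hext gX gY); [mlin..|] => m n v w hv hw.
  by rewrite (stens_mulE _ _ hw (homog_one hX)) muln0 scale1r (dg_mulr1 hX) (dg_mulr1 hY).
Qed.

Lemma stens_mul_homog m n s t : hg m s -> hg n t -> hg (m + n) (super_tensor_mul s t).
Proof.
move=> /stens_expand[I [d [e [v [w [hv hw D ->]]]]]].
move=> /stens_expand[J [d' [e' [v' [w' [hv' hw' D' ->]]]]]].
rewrite lin_sumE; [|mlin..].
apply: (homog_sum stens_grading) => j _.
rewrite (lin_sumE (f := fun s => super_tensor_mul s _)); [|mlin..].
apply: (homog_sum stens_grading) => i _.
rewrite (stens_mulE _ _ (hw i) (hv' j)); apply: (homogZ stens_grading).
rewrite (D i) (D' j) addnACA.
by apply: homog_stens; [exact: (homog_mul hX)|exact: (homog_mul hY)].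
Qed.

Lemma stens_d_homog n t : hg n t -> hg n.+1 (super_tensor_d t).
Proof.
move=> /stens_expand[I [d [e [v [w [hv hw D ->]]]]]].
rewrite lin_sumE; [|mlin..].
apply: (homog_sum stens_grading) => i _.
rewrite (stens_dE _ (hv i)) (D i); apply: (homogD stens_grading).
  by rewrite -addSn; apply: homog_stens => //; exact: (homog_d hX).
apply: (homogZ stens_grading).
by rewrite -addnS; apply: homog_stens => //; exact: (homog_d hY).
Qed.

Lemma stens_dd t : super_tensor_d (super_tensor_d t) = 0 :> X ⊗ Y.
Proof.
move: t; apply: (tens_hext gX gY); [mlin|exact: lin_zero|] => m n v w hv hw.
rewrite (stens_dE _ hv) (linD _ _ stens_d_lin) (linZ _ _ stens_d_lin).
rewrite (stens_dE _ hv) (stens_dE _ (homog_d hX hv)).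
rewrite (is_dga_dd (dgbi_dga hX)) (is_dga_dd (dgbi_dga hY)) tens0l tens0r.
by rewrite scaler0 addr0 add0r exprS mulN1r scaleNr addNr.
Qed.

Lemma stens_leibniz n s t : hg n s ->
  super_tensor_d (super_tensor_mul s t) =
  super_tensor_mul (super_tensor_d s) t + (-1) ^+ n *: super_tensor_mul s (super_tensor_d t).
Proof.
move=> /stens_expand[I [d [e [v [w [hv hw D ->]]]]]]; move: t.
apply: (tens_hext gX gY); [mlin..|] => m1 m2 a b ha hb.
rewrite (lin_sumE (f := fun s => super_tensor_mul s (a ⊗ b))); [|mlin..].
rewrite (lin_sumE (f := fun s => super_tensor_mul s (super_tensor_d _))); [|mlin..].
rewrite !(lin_sumE _ _ _ stens_d_lin).
rewrite (lin_sumE (f := fun s => super_tensor_mul s (a ⊗ b))); [|mlin..].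
rewrite scaler_sumr -big_split; apply: eq_bigr => i _ /=.
rewrite (stens_mulE _ _ (hw i) ha) (linZ _ _ stens_d_lin).
rewrite (stens_dE _ (homog_mul hX (hv i) ha)) (stens_dE _ (hv i)) (stens_dE _ ha).
rewrite (linD (f := fun s => super_tensor_mul s (a ⊗ b))); [|mlin..].
rewrite (linZ (f := fun s => super_tensor_mul s (a ⊗ b))); [|mlin..].
rewrite (linD (f := super_tensor_mul _)); [|mlin..].
rewrite (linZ (f := super_tensor_mul _)); [|mlin..].
rewrite (stens_mulE _ _ (hw i) ha) (stens_mulE _ _ (homog_d hY (hw i)) ha).
rewrite (stens_mulE _ _ (hw i) ha) (stens_mulE _ _ (hw i) (homog_d hX ha)).
rewrite (is_dga_leibniz (dgbi_dga hX) _ (hv i)) (is_dga_leibniz (dgbi_dga hY) _ (hw i)).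
rewrite (linD (f := fun x => x ⊗ _)); [|mlin..].
rewrite (linD (f := fun x => _ ⊗ x)); [|mlin..].
rewrite tensZl tensZr !scalerDr -!addrA; congr (_ + _).
by rewrite [RHS]addrCA (D i); congr (_ + (_ + _)); signs.
Qed.

Lemma stens_coassoc (t : stens) :
  \tsum_(x1, x2 <- ext_double_cop t) \tsum_(x11, x12 <- ext_double_cop x1) x11 ⊗ (x12 ⊗ x2) =
  \tsum_(x1, x2 <- ext_double_cop t) x1 ⊗ ext_double_cop x2.
Proof.
move: t; apply: (tens_hext gX gY); [mlin..|] => l l' w y hw hy.
(* The common value of both sides before summation. Its sign is that of rearranging w1 w2 w3 y1 y2
   y3 into w1 y1 w2 y2 w3 y3. *)
pose T (w1 w2 w3 : X) (y1 y2 y3 : Y) : (X ⊗ Y) ⊗ ((X ⊗ Y) ⊗ (X ⊗ Y)) :=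
  \hsum_(w2' @ a <- w2) \hsum_(w3' @ b <- w3) \hsum_(y1' @ c <- y1) \hsum_(y2' @ d <- y2)
  (-1) ^+ (b * (c + d) + a * c) *: ((w1 ⊗ y1') ⊗ ((w2' ⊗ y2') ⊗ (w3' ⊗ y3))).
have TE a b c d (w1 w2 w3 : X) (y1 y2 y3 : Y) : hgX a w2 -> hgX b w3 -> hgY c y1 -> hgY d y2 ->
  T w1 w2 w3 y1 y2 y3 =
  (-1) ^+ (b * (c + d) + a * c) *: ((w1 ⊗ y1) ⊗ ((w2 ⊗ y2) ⊗ (w3 ⊗ y3))).
  move=> h2 h3 h1 h2'; rewrite /T (hsum_homog gX h2); [|mlin..].
  hsum_at gX h3.
  hsum_at gY h1.
  by rewrite (hsum_homog gY h2'); [|mlin..].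
have T1 w2 w3 y1 y2 y3 : is_linear (fun w1 => T w1 w2 w3 y1 y2 y3) by rewrite /T; mlin.
have T2 w1 w3 y1 y2 y3 : is_linear (fun w2 => T w1 w2 w3 y1 y2 y3) by rewrite /T; mlin.
have T3 w1 w2 y1 y2 y3 : is_linear (fun w3 => T w1 w2 w3 y1 y2 y3) by rewrite /T; mlin.
have T4 w1 w2 w3 y2 y3 : is_linear (fun y1 => T w1 w2 w3 y1 y2 y3) by rewrite /T; mlin.
have T5 w1 w2 w3 y1 y3 : is_linear (fun y2 => T w1 w2 w3 y1 y2 y3) by rewrite /T; mlin.
have T6 w1 w2 w3 y1 y2 : is_linear (fun y3 => T w1 w2 w3 y1 y2 y3) by rewrite /T; mlin.
clearbody T.
have [I [d [e [u [v [hu hv Dw Ew]]]]]] := cop_expand hX hw.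
have [J [d' [e' [u' [v' [hu' hv' Dy Ey]]]]]] := cop_expand hY hy.
transitivity (\tsum_(w12, w3 <- cop w) \tsum_(y12, y3 <- cop y)
   \tsum_(w1, w2 <- cop w12) \tsum_(y1, y2 <- cop y12) T w1 w2 w3 y1 y2 y3).
  rewrite tsum_stens_cop; [|mlin..].
  rewrite !Ew; [|mlin..]; apply: eq_bigr => i _.
  rewrite !Ey; [|mlin..]; apply: eq_bigr => j _.
  hsum_at gX (hv i).
  hsum_at gY (hu' j).
  rewrite tsum_stens_cop; [|mlin..].
  have [I2 [d2 [e2 [u2 [v2 [hu2 hv2 Dw2 Ew2]]]]]] := cop_expand hX (hu i).
  have [J2 [d2' [e2' [u2' [v2' [hu2' hv2' Dy2 Ey2]]]]]] := cop_expand hY (hu' j).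
  rewrite !Ew2; [|mlin..]; rewrite scaler_sumr; apply: eq_bigr => i2 _.
  rewrite !Ey2; [|mlin..]; rewrite scaler_sumr; apply: eq_bigr => j2 _.
  hsum_at gX (hv2 i2).
  hsum_at gY (hu2' j2).
  rewrite (TE _ _ _ _ _ _ _ _ _ _ (hv2 i2) (hv i) (hu2' j2) (hv2' j2)) (Dy2 j2); signs.
transitivity (\tsum_(w12, w3 <- cop w) \tsum_(w1, w2 <- cop w12)
   \tsum_(y12, y3 <- cop y) \tsum_(y1, y2 <- cop y12) T w1 w2 w3 y1 y2 y3).
  by apply: eq_tsum => w12 w3; exact: exchange_tsum.
rewrite (coassoc _ (dgbi_coalg hX)); [|mlin..].
transitivity (\tsum_(w1, w23 <- cop w) \tsum_(w2, w3 <- cop w23)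
   \tsum_(y1, y23 <- cop y) \tsum_(y2, y3 <- cop y23) T w1 w2 w3 y1 y2 y3).
  apply: eq_tsum => w1 w23; apply: eq_tsum => w2 w3.
  by rewrite (coassoc _ (dgbi_coalg hY)); [|mlin..].
transitivity (\tsum_(w1, w23 <- cop w) \tsum_(y1, y23 <- cop y)
   \tsum_(w2, w3 <- cop w23) \tsum_(y2, y3 <- cop y23) T w1 w2 w3 y1 y2 y3).
  by apply: eq_tsum => w1 w23; exact: exchange_tsum.
rewrite tsum_stens_cop; [|mlin..].
rewrite !Ew; [|mlin..]; apply: eq_bigr => i _.
rewrite !Ey; [|mlin..]; apply: eq_bigr => j _.
hsum_at gX (hv i).
hsum_at gY (hu' j).
rewrite -[ext_double_cop _ in RHS]tsum_eta tsum_stens_cop; [|mlin..].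
have [I2 [d2 [e2 [u2 [v2 [hu2 hv2 Dw2 Ew2]]]]]] := cop_expand hX (hv i).
have [J2 [d2' [e2' [u2' [v2' [hu2' hv2' Dy2 Ey2]]]]]] := cop_expand hY (hv' j).
rewrite !Ew2; [|mlin..].
rewrite (lin_sumE (f := tens _)) ?scaler_sumr; [|mlin..].
apply: eq_bigr => i2 _.
rewrite !Ey2; [|mlin..].
rewrite (lin_sumE (f := tens _)) ?scaler_sumr; [|mlin..].
apply: eq_bigr => j2 _.
hsum_at gX (hv2 i2).
hsum_at gY (hu2' j2).
rewrite (TE _ _ _ _ _ _ _ _ _ _ (hu2 i2) (hv2 i2) (hu' j) (hu2' j2)) tensZr (Dw2 i2); signs.
Qed.

End SuperTensor.

#[global] Hint Resolve stens_mul_bil stens_d_lin stens_cop_lin stens_cou_lin stens_grading : multilinear.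

(** * Bialgebra axioms of the super tensor product *)

Section SuperTensorBialgebra.
Variables (k : fieldType) (X Y : dgbialg k).
Hypotheses (hX : is_dgbi X) (hY : is_dgbi Y).
Local Notation hgX := (homog (@gpr k X)).
Local Notation hgY := (homog (@gpr k Y)).
Local Notation hg := (homog (@gpr k (stens X Y))).

Let gX := dgbi_grading hX.
Let gY := dgbi_grading hY.
Let gXY := stens_grading hX hY.

Lemma stens_counitl (t : stens X Y) :
  \tsum_(x1, x2 <- ext_double_cop t) ext_double_cou x1 *: x2 = t.
Proof.
move: t; apply: (tens_hext gX gY); [mlin..|] => l l' w y hw hy.
have [I [d [e [u [v [hu hv Dw Ew]]]]]] := cop_expand hX hw.
have [J [d' [e' [u' [v' [hu' hv' Dy Ey]]]]]] := cop_expand hY hy.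
transitivity (\tsum_(w1, w2 <- cop w) cou w1 *: \tsum_(y1, y2 <- cop y) cou y1 *: (w2 ⊗ y2)).
  rewrite tsum_stens_cop; [|mlin..].
  rewrite !Ew; [|mlin..]; apply: eq_bigr => i _.
  rewrite !Ey; [|mlin..]; rewrite scaler_sumr; apply: eq_bigr => j _.
  hsum_at gX (hv i).
  hsum_at gY (hu' j).
  (* The sign (-1)^(|w2||y1|) is harmless because the counit kills y1 unless its degree is 0. *)
  rewrite stens_couE; [|mlin..]; case: (d' j) (hu' j) => [|n] h.
    by rewrite muln0 scale1r scalerA.
  by rewrite (dgbi_cou_degree hY h) mulr0 !scale0r !scaler0.
apply: etrans (counitl (F := fun x => x ⊗ y) w (dgbi_coalg hX) _); [|mlin..].
apply: eq_tsum => w1 w2; congr (_ *: _).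
apply: etrans (counitl (F := fun y => w2 ⊗ y) y (dgbi_coalg hY) _); [|mlin..].
by [].
Qed.

Lemma stens_counitr (t : stens X Y) :
  \tsum_(x1, x2 <- ext_double_cop t) ext_double_cou x2 *: x1 = t.
Proof.
move: t; apply: (tens_hext gX gY); [mlin..|] => l l' w y hw hy.
have [I [d [e [u [v [hu hv Dw Ew]]]]]] := cop_expand hX hw.
have [J [d' [e' [u' [v' [hu' hv' Dy Ey]]]]]] := cop_expand hY hy.
transitivity (\tsum_(w1, w2 <- cop w) cou w2 *: \tsum_(y1, y2 <- cop y) cou y2 *: (w1 ⊗ y1)).
  rewrite tsum_stens_cop; [|mlin..].
  rewrite !Ew; [|mlin..]; apply: eq_bigr => i _.
  rewrite !Ey; [|mlin..]; rewrite scaler_sumr; apply: eq_bigr => j _.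
  hsum_at gX (hv i).
  hsum_at gY (hu' j).
  rewrite stens_couE; [|mlin..]; case: (e i) (hv i) => [|n] h.
    by rewrite mul0n scale1r scalerA.
  by rewrite (dgbi_cou_degree hX h) mul0r !scale0r !scaler0.
apply: etrans (counitr (F := fun x => x ⊗ y) w (dgbi_coalg hX) _); [|mlin..].
apply: eq_tsum => w1 w2; congr (_ *: _).
apply: etrans (counitr (F := fun y => w1 ⊗ y) y (dgbi_coalg hY) _); [|mlin..].
by [].
Qed.

Lemma stens_coalg : is_coalg (stens X Y).
Proof.
split=> /=; [mlin|mlin|exact: stens_coassoc|exact: stens_counitl|exact: stens_counitr].
Qed.

Lemma stens_cop_homog n (t : stens X Y) : hg n t ->
  homog (tensor_grading (@gpr k (stens X Y)) (@gpr k (stens X Y))) n (ext_double_cop t).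
Proof.
have g2 := tensor_is_grading gXY gXY.
move=> /(stens_expand hX hY)[I [d [e [v [w [hv hw D ->]]]]]].
rewrite lin_sumE; [|mlin..].
apply: (homog_sum g2) => i _; rewrite -[ext_double_cop _]tsum_eta.
rewrite tsum_stens_cop; [|mlin..].
have [I1 [d1 [e1 [u1 [v1 [hu1 hv1 Dw1 Ew]]]]]] := cop_expand hX (hv i).
have [J [d' [e' [u' [v' [hu' hv' Dy Ey]]]]]] := cop_expand hY (hw i).
rewrite Ew; [|mlin..].
apply: (homog_sum g2) => i1 _; rewrite Ey; [|mlin..].
apply: (homog_sum g2) => j _.
hsum_at gX (hv1 i1).
hsum_at gY (hu' j).
apply: (homogZ g2); rewrite (D i) (Dw1 i1) (Dy j) addnACA.
by apply: (homog_tens gXY gXY); apply: homog_stens.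
Qed.

Lemma stens_cou_degree n (t : stens X Y) : hg n.+1 t -> ext_double_cou t = 0.
Proof.
move=> /(stens_expand hX hY)[I [d [e [v [w [hv hw D ->]]]]]].
rewrite (lin_sumE _ _ _ (stens_cou_lin hX hY)) big1 // => i _.
rewrite stens_couE; [|mlin..]; case: (d i) (hv i) (D i) => [|m] hm.
  by rewrite add0n => E; have := hw i; rewrite -E => /(dgbi_cou_degree hY) ->; rewrite mulr0.
by rewrite (dgbi_cou_degree hX hm) mul0r.
Qed.

Lemma stens_cop_mul (s t : stens X Y) :
  ext_double_cop (super_tensor_mul s t) =
  @super_tensor_mul k (stens X Y) (stens X Y) (ext_double_cop s) (ext_double_cop t).
Proof.
have mB : is_bilinear (@amul k (stens X Y)) by exact: stens_mul_bil.
have stB : is_bilinear (@super_tensor_mul k (stens X Y) (stens X Y)).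
  by rewrite /super_tensor_mul; mlin.
move: s t; apply: (tens_hext2 gX gY gX gY); [mlin..|].
move=> l1 l2 l3 l4 a b c d ha hb hc hd.
rewrite (stens_mulE hX hY _ _ hb hc) (linZ _ _ (stens_cop_lin hX hY)).
rewrite -[ext_double_cop (a ∙ c ⊗ _)]tsum_eta tsum_stens_cop; [|mlin..].
have [Ia [ma [na [a1 [a2 [ha1 ha2 Da Ea]]]]]] := cop_expand hX ha.
have [Ib [mb [nb [b1 [b2 [hb1 hb2 Db Eb]]]]]] := cop_expand hY hb.
have [Ic [mc [nc [c1 [c2 [hc1 hc2 Dc Ec]]]]]] := cop_expand hX hc.
have [Id [md [nd [d1 [d2 [hd1 hd2 Dd Ed]]]]]] := cop_expand hY hd.
rewrite [RHS]/super_tensor_mul [RHS]tsum_stens_cop; [|mlin..].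
rewrite (tsum_cop_mul hX); [|mlin..].
rewrite !Ea; [|mlin..]; rewrite scaler_sumr; apply: eq_bigr => i _.
rewrite Ec; [|mlin..].
rewrite Eb; [|mlin..].
(* With all four coproducts written as finite sums of homogeneous terms, the two sides have the same
   terms, and only the exponents remain to be compared modulo 2. *)
transitivity ((-1) ^+ (l2 * l3) *: \sum_ic \sum_ib \sum_id (-1) ^+ (na i * mc ic) *: (
   (-1) ^+ (nb ib * md id) *: ((-1) ^+ ((na i + nc ic) * (mb ib + md id)) *:
    ((a1 i ∙ c1 ic ⊗ (b1 ib ∙ d1 id)) ⊗ (a2 i ∙ c2 ic ⊗ (b2 ib ∙ d2 id)))))).
  congr (_ *: _); apply: eq_bigr => ic _.
  hsum_at gX (ha2 i).
  hsum_at gX (hc1 ic).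
  rewrite (tsum_cop_mul hY); [|mlin..].
  rewrite Eb ?scaler_sumr; [|mlin..].
  apply: eq_bigr => ib _; rewrite Ed ?scaler_sumr; [|mlin..].
  apply: eq_bigr => id _; congr (_ *: _).
  hsum_at gY (hb2 ib).
  hsum_at gY (hd1 id).
  hsum_at gX (homog_mul hX (ha2 i) (hc2 ic)).
  by hsum_at gY (homog_mul hY (hb1 ib) (hd1 id)).
rewrite exchange_big scaler_sumr; apply: eq_bigr => ib _.
hsum_at gX (ha2 i).
hsum_at gY (hb1 ib).
rewrite tsum_stens_cop; [|mlin..].
rewrite Ec; [|mlin..].
rewrite !scaler_sumr; apply: eq_bigr => ic _.
rewrite Ed; [|mlin..].
rewrite !scaler_sumr; apply: eq_bigr => id _.
hsum_at gX (hc2 ic).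
hsum_at gY (hd1 id).
hsum_at gXY (homog_stens hX hY (ha2 i) (hb2 ib)).
hsum_at gXY (homog_stens hX hY (hc1 ic) (hd1 id)).
rewrite -[@amul k (stens X Y)]/(@super_tensor_mul k X Y).
rewrite (stens_mulE hX hY _ _ (hb1 ib) (hc1 ic)) (stens_mulE hX hY _ _ (hb2 ib) (hc2 ic)).
rewrite tensZl tensZr (Db ib) (Dc ic); signs.
Qed.

Lemma stens_cop_d (t : stens X Y) :
  ext_double_cop (super_tensor_d t) = @super_tensor_d k (stens X Y) (stens X Y) (ext_double_cop t).
Proof.
have dB : is_linear (@gd k (stens X Y)) by exact: stens_d_lin.
have stB : is_linear (@super_tensor_d k (stens X Y) (stens X Y)).
  by rewrite /super_tensor_d; mlin.
move: t; apply: (tens_hext gX gY); [mlin..|] => l1 l2 a b ha hb.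
rewrite (stens_dE hX hY _ ha) (linD _ _ (stens_cop_lin hX hY)) (linZ _ _ (stens_cop_lin hX hY)).
rewrite -[ext_double_cop (gd a ⊗ _)]tsum_eta -[ext_double_cop (_ ⊗ gd b)]tsum_eta.
rewrite !tsum_stens_cop; [|mlin..].
rewrite /super_tensor_d tsum_stens_cop; [|mlin..].
have [Ia [ma [na [a1 [a2 [ha1 ha2 Da Ea]]]]]] := cop_expand hX ha.
have [Ib [mb [nb [b1 [b2 [hb1 hb2 Db Eb]]]]]] := cop_expand hY hb.
rewrite (tsum_cop_d hX); [|mlin..].
rewrite !Ea; [|mlin..]; rewrite scaler_sumr -big_split; apply: eq_bigr => i _ /=.
hsum_at gX (ha1 i).
rewrite (tsum_cop_d hY); [|mlin..].
rewrite !Eb; [|mlin..]; rewrite !scaler_sumr -!big_split; apply: eq_bigr => j _ /=.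
hsum_at gY (hb1 j).
rewrite !(hsum_homog gX (ha2 i)); [|mlin..].
rewrite !(hsum_homog gX (homog_d hX (ha2 i))); [|mlin..].
rewrite !(hsum_homog gY (hb1 j)); [|mlin..].
rewrite !(hsum_homog gY (homog_d hY (hb1 j))); [|mlin..].
hsum_at gXY (homog_stens hX hY (ha1 i) (hb1 j)).
rewrite !(stens_dE hX hY _ (ha1 i)) !(stens_dE hX hY _ (ha2 i)).
rewrite (linD (f := fun x => x ⊗ _)); [|mlin..].
rewrite (linD (f := fun x => _ ⊗ x)); [|mlin..].
rewrite !(tensZl, tensZr) !scalerDr -!addrA; congr (_ + _).
by rewrite [RHS]addrCA (Da i); congr (_ + (_ + _)); signs.
Qed.

Lemma stens_dgbi : is_dgbi (stens X Y).
Proof.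
split.
- split; [exact: stens_alg|exact: gXY| | |exact: stens_d_lin| | |].
  + exact: (homog_stens hX hY (homog_one hX) (homog_one hY)).
  + by move=> m n v w; exact: stens_mul_homog.
  + by move=> n v; exact: stens_d_homog.
  + exact: stens_dd.
  + by move=> n v w; exact: stens_leibniz.
- exact: stens_coalg.
- exact: stens_cop_homog.
- exact: stens_cou_degree.
- exact: stens_cop_mul.
- rewrite -[LHS]tsum_eta tsum_stens_cop; [|mlin..].
  rewrite (tsum_cop_one hX); [|mlin..].
  rewrite (tsum_cop_one hY); [|mlin..].
  hsum_at gX (homog_one hX).
  by rewrite (hsum_homog gY (homog_one hY)) ?scale1r; [|mlin..].
- suff H (s t : X ⊗ Y) : ext_double_cou (super_tensor_mul s t) = ext_double_cou s * ext_double_cou t by exact: H.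
  move: s t; apply: (tens_hext2 (f := fun s t : X ⊗ Y => (ext_double_cou (super_tensor_mul s t) : k^o))
    (g := fun s t : X ⊗ Y => (ext_double_cou s * ext_double_cou t : k^o)) gX gY gX gY); [mlin..|].
  move=> m1 n1 m2 n2 a b c d ha hb hc hd.
  rewrite (stens_mulE hX hY _ _ hb hc) (linZ _ _ (stens_cou_lin hX hY)) !stens_couE; [|mlin..].
  rewrite (dgbi_cou_mul hX) (dgbi_cou_mul hY) mulrACA.
  case: n1 hb => [|n1] hb; first by rewrite scale1r.
  by rewrite (dgbi_cou_degree hY hb) !(mulr0, mul0r) scaler0.
- by rewrite /= stens_couE ?(dgbi_cou_one hX) ?(dgbi_cou_one hY) ?mulr1.
- exact: stens_cop_d.
Qed.

End SuperTensorBialgebra.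

(** * Twisting by a cocycle of degree zero *)

#[global] Hint Resolve stens_dgbi : multilinear.

Section DegreeZero.
Variable k : fieldType.

(** Such a form is the source of all simplifications: wherever it is applied its argument may be
    taken of degree 0, so every sign involving that degree disappears. *)
Definition deg0_form (X : dga k) (f : X -> k) : Prop :=
  is_linear (f : X -> k^o) /\ forall n x, homog (@gpr k X) n.+1 x -> f x = 0.

Lemma deg0_form_lin (X : dga k) (f : X -> k) : deg0_form f -> is_linear (f : X -> k^o).
Proof. by case. Qed.

Lemma deg0_form_van (X : dga k) (f : X -> k) n x : deg0_form f ->
  homog (@gpr k X) n.+1 x -> f x = 0.
Proof. by case=> _; apply. Qed.

End DegreeZero.

#[global] Hint Resolve deg0_form_lin : multilinear.

(** * Forms of degree zero applied to one leg of a coproduct *)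

Section DegreeZeroCoproduct.
Variables (k : fieldType) (X Y : dgbialg k) (U : lmodType k).
Hypotheses (hX : is_dgbi X) (hY : is_dgbi Y).

Let gX := dgbi_grading hX.
Let gY := dgbi_grading hY.

Lemma deg0_form_d f x : deg0_form f -> f (gd x : X) = 0.
Proof.
move=> hf; apply: (homog_ext (f := fun x : X => (f (gd x) : k^o)) (g := fun=> 0) gX).
- mlin.
- exact: lin_zero.
- by move=> n v hv; case: hf => _ /(_ n); apply; exact: homog_d.
Qed.

(** In Δ(dx) the terms with d on the first leg are killed by f, and those with d on the second leg
    carry the sign of a first leg of degree 0. *)
Lemma deg0_cop_dl f (F : X -> U) x : deg0_form f -> is_linear F ->
  \tsum_(x1, x2 <- cop (gd x)) f x1 *: F x2 = \tsum_(x1, x2 <- cop x) f x1 *: F (gd x2).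
Proof.
move=> hf Fl; rewrite (tsum_cop_d hX); [|mlin..].
apply: (tsum_hext _ gX gX); [mlin..|] => m n a b ha hb.
rewrite (deg0_form_d _ hf) scale0r add0r (hsum_homog gX ha); [|mlin..].
by case: m ha => [|m] ha; rewrite ?scale1r // (deg0_form_van hf ha) !scale0r scaler0.
Qed.

Lemma deg0_cop_dr f (F : X -> U) x : deg0_form f -> is_linear F ->
  \tsum_(x1, x2 <- cop (gd x)) f x2 *: F x1 = \tsum_(x1, x2 <- cop x) f x2 *: F (gd x1).
Proof.
move=> hf Fl; rewrite (tsum_cop_d hX); [|mlin..].
apply: (tsum_hext _ gX gX); [mlin..|] => m n a b ha hb.
hsum_at gX ha.
by rewrite (deg0_form_d _ hf) scale0r scaler0 addr0.
Qed.

(** The Koszul sign is (-1)^(|x2||y1|), and f only sees terms in which y1 has degree 0. *)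
Lemma deg0_stens_copl f (F : X ⊗ Y -> U) (x : X) (y : Y) :
  deg0_form (f : stens X Y -> k) -> is_linear F ->
  \tsum_(c1, c2 <- ext_double_cop (x ⊗ y)) f c1 *: F c2 =
  \tsum_(x1, x2 <- cop x) \tsum_(y1, y2 <- cop y) f (x1 ⊗ y1) *: F (x2 ⊗ y2).
Proof.
move=> hf Fl; have fl : is_linear (f : X ⊗ Y -> k^o) := deg0_form_lin hf.
rewrite tsum_stens_cop; [|mlin..].
apply: (tsum_hext _ gX gX); [mlin..|] => m n a b ha hb.
apply: (tsum_hext _ gY gY); [mlin..|] => m' n' a' b' ha' hb'.
hsum_at gX hb.
rewrite (hsum_homog gY ha'); [|mlin..].
case: m' ha' => [|m'] ha'; first by rewrite muln0 scale1r.
have := homog_stens hX hY ha ha'; rewrite addnS => /(deg0_form_van hf) ->.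
by rewrite scale0r scaler0.
Qed.

Lemma deg0_stens_copr f (F : X ⊗ Y -> U) (x : X) (y : Y) :
  deg0_form (f : stens X Y -> k) -> is_linear F ->
  \tsum_(c1, c2 <- ext_double_cop (x ⊗ y)) f c2 *: F c1 =
  \tsum_(x1, x2 <- cop x) \tsum_(y1, y2 <- cop y) f (x2 ⊗ y2) *: F (x1 ⊗ y1).
Proof.
move=> hf Fl; have fl : is_linear (f : X ⊗ Y -> k^o) := deg0_form_lin hf.
rewrite tsum_stens_cop; [|mlin..].
apply: (tsum_hext _ gX gX); [mlin..|] => m n a b ha hb.
apply: (tsum_hext _ gY gY); [mlin..|] => m' n' a' b' ha' hb'.
hsum_at gX hb.
rewrite (hsum_homog gY ha'); [|mlin..].
case: n hb => [|n] hb; first by rewrite mul0n scale1r.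
have := homog_stens hX hY hb hb'; rewrite addSn => /(deg0_form_van hf) ->.
by rewrite scale0r scaler0.
Qed.

End DegreeZeroCoproduct.

(** * The Doi-Takeuchi twist *)

Section Twist.
Variables (k : fieldType) (P : dgbialg k) (g gb : stens P P -> k).
Local Notation C := (stens P P).

(** Viewing the product as a linear map m on the coalgebra P ⊗ P makes the twisted product the
    convolution g * m * gb, so that it can be handled by convolution calculus. *)
Definition mulC (c : C) : P := \tsum_(x, y <- c) x ∙ y.

Definition twist_mulC (c : C) : P :=
  \tsum_(c1, c23 <- cop c) \tsum_(c2, c3 <- cop c23) (g c1 * gb c3) *: mulC c2.

Definition twist_mul (x y : P) : P := twist_mulC (x ⊗ y).

Definition twist : dgbialg k :=
  @DgBialg k (@Dga k (@Alg k P twist_mul (aone P)) (@gpr k P) (@gd k P))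
    (@cop k P) (@cou k P).

Record is_cocycle : Prop := IsCocycle {
  cocycle_form : deg0_form (g : C -> k);
  cocycle_inv_form : deg0_form (gb : C -> k);
  cocycle_invr : forall c : C, \tsum_(c1, c2 <- cop c) ((g c1 * gb c2 : k) : k^o) = cou c;
  cocycle_invl : forall c : C, \tsum_(c1, c2 <- cop c) ((gb c1 * g c2 : k) : k^o) = cou c;
  cocycle_assoc : forall x y z : P,
    \tsum_(x1, x2 <- cop x) \tsum_(y1, y2 <- cop y)
      ((g (x1 ⊗ y1) * g ((x2 ∙ y2) ⊗ z) : k) : k^o) =
    \tsum_(y1, y2 <- cop y) \tsum_(z1, z2 <- cop z)
      ((g (y1 ⊗ z1) * g (x ⊗ (y2 ∙ z2)) : k) : k^o);
  cocycle_inv_assoc : forall x y z : P,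
    \tsum_(x1, x2 <- cop x) \tsum_(y1, y2 <- cop y)
      ((gb (x2 ⊗ y2) * gb ((x1 ∙ y1) ⊗ z) : k) : k^o) =
    \tsum_(y1, y2 <- cop y) \tsum_(z1, z2 <- cop z)
      ((gb (y2 ⊗ z2) * gb (x ⊗ (y1 ∙ z1)) : k) : k^o);
  cocycle_onel : forall x, g (aone P ⊗ x) = cou x;
  cocycle_oner : forall x, g (x ⊗ aone P) = cou x;
  cocycle_inv_onel : forall x, gb (aone P ⊗ x) = cou x;
  cocycle_inv_oner : forall x, gb (x ⊗ aone P) = cou x }.

Hypotheses (hP : is_dgbi P) (hg : is_cocycle).
Local Notation hgP := (homog (@gpr k P)).
Local Notation hgC := (homog (@gpr k C)).

Let gP := dgbi_grading hP.
Let hC : is_dgbi C := stens_dgbi hP hP.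
Let g0 := cocycle_form hg.
Let gb0 := cocycle_inv_form hg.
Let gl : is_linear (g : C -> k^o) := deg0_form_lin g0.
Let gbl : is_linear (gb : C -> k^o) := deg0_form_lin gb0.

Lemma mulC_lin : is_linear mulC.
Proof. by rewrite /mulC; mlin. Qed.
Hint Resolve mulC_lin : multilinear.

Lemma twist_mulC_lin : is_linear twist_mulC.
Proof. by rewrite /twist_mulC; mlin. Qed.
Hint Resolve twist_mulC_lin : multilinear.

Lemma twist_mul_bil : is_bilinear twist_mul.
Proof. by rewrite /twist_mul; mlin. Qed.
Hint Resolve twist_mul_bil : multilinear.

Lemma mulC_tens (x y : P) : mulC (x ⊗ y) = x ∙ y.
Proof. by rewrite /mulC tsum_tens //; mlin. Qed.

Lemma mulC_homog n c : hgC n c -> hgP n (mulC c).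
Proof.
move=> /(stens_expand hP hP)[I [d [e [v [w [hv hw D ->]]]]]].
rewrite (lin_sumE _ _ _ mulC_lin); apply: (homog_sum gP) => i _.
by rewrite mulC_tens (D i); exact: homog_mul.
Qed.

Lemma mulC_d c : mulC (gd c) = gd (mulC c).
Proof.
have dl : is_linear (@gd k C) by mlin.
move: c; apply: (tens_hext gP gP); [mlin..|] => m n v w hv hw.
rewrite mulC_tens (is_dga_leibniz (dgbi_dga hP) _ hv).
rewrite -[@gd k C (v ⊗ w)]/(super_tensor_d (v ⊗ w)) (stens_dE hP hP _ hv).
by rewrite (linD _ _ mulC_lin) (linZ _ _ mulC_lin) !mulC_tens.
Qed.

(** Multiplicativity of Δ, read as the statement that m is a map of coalgebras: the signs are those
    of the coproduct of P ⊗ P. *)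
Lemma tsum_cop_mulC (U : lmodType k) (F : P -> P -> U) c : is_bilinear F ->
  tsum F (cop (mulC c)) = \tsum_(c1, c2 <- cop c) F (mulC c1) (mulC c2).
Proof.
move=> FB; move: c; apply: tens_ext; [mlin..|] => x y.
rewrite mulC_tens (tsum_cop_mul hP) //.
rewrite -[@cop k C (x ⊗ y)]/(ext_double_cop (x ⊗ y)) tsum_stens_cop; [|mlin..].
apply: (tsum_hext _ gP gP); [mlin..|] => m n a b ha hb.
apply: (tsum_hext _ gP gP); [mlin..|] => m' n' a' b' ha' hb'.
rewrite !(hsum_homog gP hb); [|mlin..].
rewrite !(hsum_homog gP ha'); [|mlin..].
by rewrite !mulC_tens.
Qed.

Lemma cou_mulC c : cou (mulC c) = cou c.
Proof.
move: c; apply: (tens_ext (f := fun c : P ⊗ P => (cou (mulC c) : k^o))); [mlin..|] => x y.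
by rewrite mulC_tens (dgbi_cou_mul hP) -stens_couE.
Qed.

(** The half twist m * gb. It is itself an associative product, and attaching g on its left gives
    the full twist. *)
Definition twist_rmulC (c : C) : P := \tsum_(c1, c2 <- cop c) gb c2 *: mulC c1.

Lemma twist_rmulC_lin : is_linear twist_rmulC.
Proof. by rewrite /twist_rmulC; mlin. Qed.
Hint Resolve twist_rmulC_lin : multilinear.

Lemma twist_mulCE c : twist_mulC c = \tsum_(c1, c2 <- cop c) g c1 *: twist_rmulC c2.
Proof.
apply: eq_tsum => c1 c23; rewrite /twist_rmulC tsumZ; apply: eq_tsum => c2 c3.
by rewrite scalerA.
Qed.

Lemma twist_mulC_homog n c : hgC n c -> hgP n (twist_mulC c).
Proof.
move=> hc; have [I [d [e [u [v [hu hv D Ec]]]]]] := cop_expand hC hc.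
rewrite twist_mulCE Ec; [|mlin..].
(* The outer legs survive only in degree 0, so the middle leg keeps the full degree n. *)
apply: (homog_sum gP) => i _; case: (d i) (hu i) (D i) => [|m] hm; last first.
  by rewrite (deg0_form_van g0 hm) scale0r => _; exact: homog0.
rewrite add0n => ->; apply: (homogZ gP).
have [J [d' [e' [u' [v' [hu' hv' D' Ev]]]]]] := cop_expand hC (hv i).
rewrite /twist_rmulC Ev; [|mlin..].
apply: (homog_sum gP) => j _; case: (e' j) (hv' j) (D' j) => [|m'] hm'; last first.
  by rewrite (deg0_form_van gb0 hm') scale0r => _; exact: homog0.
by rewrite addn0 => ->; apply: (homogZ gP); exact: mulC_homog.
Qed.

(** Neither g nor gb sees exact elements, so d reaches the middle leg without sign, and there
    [mulC_d] applies. *)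
Lemma twist_mulC_d c : twist_mulC (gd c) = gd (twist_mulC c).
Proof.
have dl : is_linear (@gd k C) by mlin.
have rd b : twist_rmulC (gd b) = gd (twist_rmulC b).
  rewrite /twist_rmulC (deg0_cop_dr hC _ gb0); [|mlin..].
  rewrite (lin_tsumE (g := @gd k P)); [|mlin..].
  by apply: eq_tsum => b1 b2; rewrite (linZ (f := @gd k P)) ?mulC_d; [|mlin..].
rewrite !twist_mulCE (deg0_cop_dl hC _ g0); [|mlin..].
rewrite (lin_tsumE (g := @gd k P)); [|mlin..].
by apply: eq_tsum => b1 b2; rewrite (linZ (f := @gd k P)) ?rd; [|mlin..].
Qed.

Lemma tsum_cop_rmulC (U : lmodType k) (F : P -> P -> U) c : is_bilinear F ->
  tsum F (cop (twist_rmulC c)) = \tsum_(c1, c2 <- cop c) F (mulC c1) (twist_rmulC c2).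
Proof.
move=> FB; rewrite {1}/twist_rmulC.
rewrite (lin_tsumE (g := fun x => tsum F (cop x))); [|mlin..].
transitivity (\tsum_(c12, c3 <- cop c) \tsum_(c1, c2 <- cop c12)
    gb c3 *: F (mulC c1) (mulC c2)).
  apply: eq_tsum => c12 c3.
  rewrite (linZ (f := fun x => tsum F (cop x))); [|mlin..].
  by rewrite tsum_cop_mulC // tsumZ.
rewrite (coassoc _ (dgbi_coalg hC)); [|mlin..].
apply: eq_tsum => c1 c23; rewrite /twist_rmulC.
rewrite (lin_tsumE (g := F _)); [|mlin..].
by apply: eq_tsum => c2 c3; rewrite (linZ (f := F _)) //; mlin.
Qed.

(** On consecutive legs the left side reads m, gb, g, m, gb. The adjacent gb and g convolve to the
    counit. *)
Lemma tsum_twist_cancel (U : lmodType k) (F : P -> P -> U) c : is_bilinear F ->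
  \tsum_(c1, c2 <- cop c) F (twist_rmulC c1) (twist_mulC c2) =
  \tsum_(c1, c2 <- cop c) F (mulC c1) (twist_rmulC c2).
Proof.
move=> FB; transitivity (\tsum_(c12, c3 <- cop c) \tsum_(c1, c2 <- cop c12)
    gb c2 *: F (mulC c1) (twist_mulC c3)).
  apply: eq_tsum => c12 c3; rewrite /twist_rmulC.
  rewrite (lin_tsumE (g := fun x => F x _)); [|mlin..].
  by apply: eq_tsum => c1 c2; rewrite (linZ (f := fun x => F x _)) //; mlin.
rewrite (coassoc _ (dgbi_coalg hC)); [|mlin..].
apply: eq_tsum => c1 e.
transitivity (\tsum_(c2, c34 <- cop e) \tsum_(c3, c4 <- cop c34)
    (gb c2 * g c3) *: F (mulC c1) (twist_rmulC c4)).
  apply: eq_tsum => c2 c34; rewrite twist_mulCE.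
  rewrite (lin_tsumE (g := F _)); [|mlin..].
  rewrite tsumZ; apply: eq_tsum => c3 c4.
  by rewrite (linZ (f := F _)) ?scalerA //; mlin.
rewrite -(coassoc (C := C) (F := fun c2 c3 c4 : C => (gb c2 * g c3) *: F (mulC c1) (twist_rmulC c4)));
  [|mlin..].
apply: etrans (counitl (F := fun x : C => F (mulC c1) (twist_rmulC x)) e (dgbi_coalg hC) _);
  last by mlin.
apply: eq_tsum => c23 c4; rewrite -(cocycle_invl hg).
by rewrite (lin_tsumE (g := fun a : k^o => a *: F (mulC c1) (twist_rmulC c4))); [|mlin..].
Qed.

(** Δ of g * m * gb has legs g * m and m * gb. Inserting gb * g = ε between them, by the
    cancellation lemma read backwards, completes both legs to the full twisted product. *)
Lemma tsum_cop_twist_mulC (U : lmodType k) (F : P -> P -> U) c : is_bilinear F ->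
  tsum F (cop (twist_mulC c)) = \tsum_(c1, c2 <- cop c) F (twist_mulC c1) (twist_mulC c2).
Proof.
move=> FB; rewrite [in LHS]twist_mulCE.
rewrite (lin_tsumE (g := fun x => tsum F (cop x))); [|mlin..].
transitivity (\tsum_(c1, c23 <- cop c) \tsum_(c2, c3 <- cop c23)
    g c1 *: F (twist_rmulC c2) (twist_mulC c3)).
  apply: eq_tsum => c1 c23.
  rewrite (linZ (f := fun x => tsum F (cop x))); [|mlin..].
  by rewrite tsum_cop_rmulC // -tsum_twist_cancel // tsumZ.
rewrite -(coassoc (C := C) (F := fun c1 c2 c3 : C => g c1 *: F (twist_rmulC c2) (twist_mulC c3)));
  [|mlin..].
apply: eq_tsum => c12 c3; rewrite [in RHS]twist_mulCE.
rewrite (lin_tsumE (g := fun x => F x _)); [|mlin..].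
by apply: eq_tsum => c1 c2; rewrite (linZ (f := fun x => F x _)) //; mlin.
Qed.

Lemma twist_mulE (x y : P) : twist_mul x y =
  \tsum_(x1, x2 <- cop x) \tsum_(y1, y2 <- cop y) g (x1 ⊗ y1) *: twist_rmulC (x2 ⊗ y2).
Proof. by rewrite /twist_mul twist_mulCE (deg0_stens_copl hP hP _ _ g0) //; mlin. Qed.

Lemma twist_rmulE (x y : P) : twist_rmulC (x ⊗ y) =
  \tsum_(x1, x2 <- cop x) \tsum_(y1, y2 <- cop y) gb (x2 ⊗ y2) *: (x1 ∙ y1).
Proof.
rewrite /twist_rmulC (deg0_stens_copr hP hP _ _ gb0); [|mlin..].
by apply: eq_tsum => x1 x2; apply: eq_tsum => y1 y2; rewrite mulC_tens.
Qed.

(** These forms are the two sides of the cocycle identity and of its inverse, with one outer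
    argument fixed. They again have degree zero, so they too pass through coproducts without
    signs. *)
Let assocl x (d : C) : k := \tsum_(d1, d2 <- cop d) ((g d1 * g (x ⊗ mulC d2) : k) : k^o).
Let assocl_inv x (d : C) : k := \tsum_(d1, d2 <- cop d) ((gb d2 * gb (x ⊗ mulC d1) : k) : k^o).
Let assocr (c : C) z : k := \tsum_(c1, c2 <- cop c) ((g c1 * g (mulC c2 ⊗ z) : k) : k^o).
Let assocr_inv (c : C) z : k := \tsum_(c1, c2 <- cop c) ((gb c2 * gb (mulC c1 ⊗ z) : k) : k^o).

Let assocl_inv_bil : is_bilinear (assocl_inv : P -> C -> k^o).
Proof. by rewrite /assocl_inv; mlin. Qed.
Let assocr_inv_bil : is_bilinear (assocr_inv : C -> P -> k^o).
Proof. by rewrite /assocr_inv; mlin. Qed.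

Let vanish_mulC f x y (d : C) : deg0_form (f : C -> k) -> forall n, hgC n.+1 d ->
  f (x ⊗ mulC d) = 0 /\ f (mulC d ⊗ y) = 0.
Proof.
move=> hf n hd; have hd' := mulC_homog hd.
have fl : is_linear (f : P ⊗ P -> k^o) := deg0_form_lin hf.
split.
  move: x; apply: (homog_ext (f := fun x : P => (f (x ⊗ mulC d) : k^o)) (g := fun=> 0) gP);
    [mlin|exact: lin_zero|] => m x hx.
  by have := homog_stens hP hP hx hd'; rewrite addnS => /(deg0_form_van hf).
move: y; apply: (homog_ext (f := fun x : P => (f (mulC d ⊗ x) : k^o)) (g := fun=> 0) gP);
  [mlin|exact: lin_zero|] => m z hz.
by have := homog_stens hP hP hd' hz; rewrite addSn => /(deg0_form_van hf).
Qed.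

Let deg0_conv (f f' : C -> k) : deg0_form f -> is_linear (f' : C -> k^o) ->
  (forall n c, hgC n.+1 c -> f' c = 0) ->
  deg0_form ((fun d => \tsum_(d1, d2 <- cop d) ((f d1 * f' d2 : k) : k^o)) : C -> k) /\
  deg0_form ((fun d => \tsum_(d1, d2 <- cop d) ((f d2 * f' d1 : k) : k^o)) : C -> k).
Proof.
move=> hf fl fv; split; split; try by mlin.
  move=> n d hd; have [I [a [b [u [v [hu hv D Ed]]]]]] := cop_expand hC hd.
  rewrite Ed ?big1 //; [|mlin..].
  move=> i _; case: (a i) (hu i) (D i) => [|m] hm; last by rewrite (deg0_form_van hf hm) mul0r.
  by rewrite add0n => E; have := hv i; rewrite -E => /fv ->; rewrite mulr0.
move=> n d hd; have [I [a [b [u [v [hu hv D Ed]]]]]] := cop_expand hC hd.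
rewrite Ed ?big1 //; [|mlin..].
move=> i _; case: (b i) (hv i) (D i) => [|m] hm; last by rewrite (deg0_form_van hf hm) mul0r.
by rewrite addn0 => E; have := hu i; rewrite -E => /fv ->; rewrite mulr0.
Qed.

Let assocl_deg0 x : deg0_form (assocl x).
Proof.
have [|n c hc|h _] // := deg0_conv (f' := fun d => g (x ⊗ mulC d)) g0; first by mlin.
by have [] := vanish_mulC x x g0 hc.
Qed.

Let assocl_inv_deg0 x : deg0_form (assocl_inv x).
Proof.
have [|n c hc|_ h] // := deg0_conv (f' := fun d => gb (x ⊗ mulC d)) gb0; first by mlin.
by have [] := vanish_mulC x x gb0 hc.
Qed.

Let assocr_deg0 z : deg0_form (assocr^~ z).
Proof.
have [|n c hc|h _] // := deg0_conv (f' := fun d => g (mulC d ⊗ z)) g0; first by mlin.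
by have [] := vanish_mulC z z g0 hc.
Qed.

Let assocr_inv_deg0 z : deg0_form (assocr_inv^~ z).
Proof.
have [|n c hc|_ h] // := deg0_conv (f' := fun d => gb (mulC d ⊗ z)) gb0; first by mlin.
by have [] := vanish_mulC z z gb0 hc.
Qed.

Let assocE x y z : assocl x (y ⊗ z) = assocr (x ⊗ y) z.
Proof.
transitivity (\tsum_(y1, y2 <- cop y) \tsum_(z1, z2 <- cop z)
      ((g (y1 ⊗ z1) * g (x ⊗ (y2 ∙ z2)) : k) : k^o)).
  apply: etrans (deg0_stens_copl hP hP (F := fun d => (g (x ⊗ mulC d) : k^o)) _ _ g0 _) _; first by mlin.
  by apply: eq_tsum => y1 y2; apply: eq_tsum => z1 z2; rewrite mulC_tens.
rewrite -(cocycle_assoc hg).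
symmetry; apply: etrans (deg0_stens_copl hP hP (F := fun d => (g (mulC d ⊗ z) : k^o)) _ _ g0 _) _; first by mlin.
by apply: eq_tsum => y1 y2; apply: eq_tsum => z1 z2; rewrite mulC_tens.
Qed.

Let assoc_invE x y z : assocl_inv x (y ⊗ z) = assocr_inv (x ⊗ y) z.
Proof.
transitivity (\tsum_(y1, y2 <- cop y) \tsum_(z1, z2 <- cop z)
      ((gb (y2 ⊗ z2) * gb (x ⊗ (y1 ∙ z1)) : k) : k^o)).
  apply: etrans (deg0_stens_copr hP hP (F := fun d => (gb (x ⊗ mulC d) : k^o)) _ _ gb0 _) _; first by mlin.
  by apply: eq_tsum => y1 y2; apply: eq_tsum => z1 z2; rewrite mulC_tens.
rewrite -(cocycle_inv_assoc hg).
symmetry; apply: etrans (deg0_stens_copr hP hP (F := fun d => (gb (mulC d ⊗ z) : k^o)) _ _ gb0 _) _; first by mlin.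
by apply: eq_tsum => y1 y2; apply: eq_tsum => z1 z2; rewrite mulC_tens.
Qed.

Let rmul_rmulr x d : twist_rmulC (x ⊗ twist_rmulC d) =
  \tsum_(x1, x2 <- cop x) \tsum_(d1, d2 <- cop d) assocl_inv x2 d2 *: (x1 ∙ mulC d1).
Proof.
rewrite twist_rmulE; apply: eq_tsum => x1 x2; rewrite tsum_cop_rmulC; [|mlin..].
apply: eq_tsum => d1 d2; congr (_ *: _); rewrite /assocl_inv {1}/twist_rmulC.
rewrite (lin_tsumE (g := fun u => (gb (x2 ⊗ u) : k^o))); [|mlin..].
by apply: eq_tsumk => e1 e2; rewrite (linZ (f := fun u => (gb (x2 ⊗ u) : k^o))) //; mlin.
Qed.

Let rmul_rmull c z : twist_rmulC (twist_rmulC c ⊗ z) =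
  \tsum_(z1, z2 <- cop z) \tsum_(c1, c2 <- cop c) assocr_inv c2 z2 *: (mulC c1 ∙ z1).
Proof.
rewrite twist_rmulE exchange_tsum; apply: eq_tsum => z1 z2.
rewrite tsum_cop_rmulC; [|mlin..].
apply: eq_tsum => c1 c2; congr (_ *: _); rewrite /assocr_inv {1}/twist_rmulC.
rewrite (lin_tsumE (g := fun u => (gb (u ⊗ z2) : k^o))); [|mlin..].
by apply: eq_tsumk => e1 e2; rewrite (linZ (f := fun u => (gb (u ⊗ z2) : k^o))) //; mlin.
Qed.

(** Each bracketing is the product x1 y1 z1 weighted by one side of the inverse cocycle identity at
    x2, y2, z2. *)
Let rmulA x y z : twist_rmulC (x ⊗ twist_rmulC (y ⊗ z)) = twist_rmulC (twist_rmulC (x ⊗ y) ⊗ z).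
Proof.
transitivity (\tsum_(x1, x2 <- cop x) \tsum_(y1, y2 <- cop y) \tsum_(z1, z2 <- cop z)
  assocl_inv x2 (y2 ⊗ z2) *: (x1 ∙ (y1 ∙ z1))).
  rewrite rmul_rmulr; apply: eq_tsum => x1 x2.
  apply: etrans (deg0_stens_copr hP hP (F := fun d => x1 ∙ mulC d) _ _ (assocl_inv_deg0 _) _) _;
    first by mlin.
  by apply: eq_tsum => y1 y2; apply: eq_tsum => z1 z2; rewrite mulC_tens.
rewrite rmul_rmull.
transitivity (\tsum_(z1, z2 <- cop z) \tsum_(x1, x2 <- cop x) \tsum_(y1, y2 <- cop y)
  assocr_inv (x2 ⊗ y2) z2 *: ((x1 ∙ y1) ∙ z1)).
  rewrite [RHS]exchange_tsum; apply: eq_tsum => x1 x2; rewrite exchange_tsum.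
  apply: eq_tsum => z1 z2; apply: eq_tsum => y1 y2.
  by rewrite assoc_invE (dg_mulA hP).
apply: eq_tsum => z1 z2; symmetry.
apply: etrans (deg0_stens_copr hP hP (F := fun d => mulC d ∙ z1) _ _ (assocr_inv_deg0 _) _) _;
  first by mlin.
by apply: eq_tsum => x1 x2; apply: eq_tsum => y1 y2; rewrite mulC_tens.
Qed.

(** Since Δ of the half twist is m ⊗ (m * gb), the two copies of g collect on the left into one side
    of the cocycle identity, leaving half twisted products on the right. *)
Let mul_mulr x d : twist_mul x (twist_mulC d) =
  \tsum_(x1, x2 <- cop x) \tsum_(d1, d2 <- cop d) assocl x1 d1 *: twist_rmulC (x2 ⊗ twist_rmulC d2).
Proof.
rewrite twist_mulE; apply: eq_tsum => x1 x2; rewrite [in LHS]twist_mulCE.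
rewrite (lin_tsumE (g := fun u => tsum (fun u1 u2 => g (x1 ⊗ u1) *: twist_rmulC (x2 ⊗ u2)) (cop u)));
  last by mlin.
transitivity (\tsum_(d1, d23 <- cop d) \tsum_(d2, d3 <- cop d23)
   (g d1 * g (x1 ⊗ mulC d2)) *: twist_rmulC (x2 ⊗ twist_rmulC d3)).
  apply: eq_tsum => d1 d23.
  rewrite (linZ (f := fun u => tsum (fun u1 u2 => g (x1 ⊗ u1) *: twist_rmulC (x2 ⊗ u2)) (cop u)));
    [|mlin..].
  rewrite tsum_cop_rmulC ?tsumZ; [|mlin..].
  by apply: eq_tsum => d2 d3; rewrite scalerA.
rewrite -(coassoc (C := C)
  (F := fun d1 d2 d3 : C => (g d1 * g (x1 ⊗ mulC d2)) *: twist_rmulC (x2 ⊗ twist_rmulC d3))); [|mlin..].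
apply: eq_tsum => d12 d3; rewrite /assocl.
by rewrite (lin_tsumE (g := fun a : k^o => a *: twist_rmulC (x2 ⊗ twist_rmulC d3))); [|mlin..].
Qed.

Let mul_mull c z : twist_mul (twist_mulC c) z =
  \tsum_(z1, z2 <- cop z) \tsum_(c1, c2 <- cop c) assocr c1 z1 *: twist_rmulC (twist_rmulC c2 ⊗ z2).
Proof.
rewrite twist_mulE exchange_tsum; apply: eq_tsum => z1 z2; rewrite [in LHS]twist_mulCE.
rewrite (lin_tsumE (g := fun u => tsum (fun u1 u2 => g (u1 ⊗ z1) *: twist_rmulC (u2 ⊗ z2)) (cop u)));
  last by mlin.
transitivity (\tsum_(c1, c23 <- cop c) \tsum_(c2, c3 <- cop c23)
   (g c1 * g (mulC c2 ⊗ z1)) *: twist_rmulC (twist_rmulC c3 ⊗ z2)).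
  apply: eq_tsum => c1 c23.
  rewrite (linZ (f := fun u => tsum (fun u1 u2 => g (u1 ⊗ z1) *: twist_rmulC (u2 ⊗ z2)) (cop u)));
    [|mlin..].
  rewrite tsum_cop_rmulC ?tsumZ; [|mlin..].
  by apply: eq_tsum => c2 c3; rewrite scalerA.
rewrite -(coassoc (C := C)
  (F := fun c1 c2 c3 : C => (g c1 * g (mulC c2 ⊗ z1)) *: twist_rmulC (twist_rmulC c3 ⊗ z2))); [|mlin..].
apply: eq_tsum => c12 c3; rewrite /assocr.
by rewrite (lin_tsumE (g := fun a : k^o => a *: twist_rmulC (twist_rmulC c3 ⊗ z2))); [|mlin..].
Qed.

(** The weights on the left agree by the cocycle identity, and the remaining half twisted products
    by their own associativity. *)
Lemma twist_mulA : associative twist_mul.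
Proof.
move=> x y z; transitivity (\tsum_(x1, x2 <- cop x) \tsum_(y1, y2 <- cop y) \tsum_(z1, z2 <- cop z)
  assocl x1 (y1 ⊗ z1) *: twist_rmulC (x2 ⊗ twist_rmulC (y2 ⊗ z2))).
  rewrite -[twist_mul y z]/(twist_mulC _) mul_mulr; apply: eq_tsum => x1 x2.
  by apply: (deg0_stens_copl hP hP (F := fun d => twist_rmulC (x2 ⊗ twist_rmulC d)) _ _ (assocl_deg0 _));
    mlin.
rewrite -[twist_mul x y]/(twist_mulC _) mul_mull.
transitivity (\tsum_(z1, z2 <- cop z) \tsum_(x1, x2 <- cop x) \tsum_(y1, y2 <- cop y)
  assocr (x1 ⊗ y1) z1 *: twist_rmulC (twist_rmulC (x2 ⊗ y2) ⊗ z2)).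
  rewrite [RHS]exchange_tsum; apply: eq_tsum => x1 x2; rewrite exchange_tsum.
  apply: eq_tsum => z1 z2; apply: eq_tsum => y1 y2.
  by rewrite assocE rmulA.
apply: eq_tsum => z1 z2; symmetry.
by apply: (deg0_stens_copl hP hP (F := fun d => twist_rmulC (twist_rmulC d ⊗ z2)) _ _ (assocr_deg0 _));
  mlin.
Qed.

Lemma twist_mul1 : left_id (aone P) twist_mul.
Proof.
move=> y; rewrite twist_mulE (tsum_cop_one hP); [|mlin..].
transitivity (\tsum_(y1, y2 <- cop y) cou y1 *: twist_rmulC (aone P ⊗ y2)).
  by apply: eq_tsum => a b; rewrite (cocycle_onel hg).
rewrite (counitl (F := fun y => twist_rmulC (aone P ⊗ y))); [|mlin..].
rewrite twist_rmulE (tsum_cop_one hP); [|mlin..].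
apply: etrans (_ : _ = \tsum_(y1, y2 <- cop y) cou y2 *: (aone P ∙ y1)) _.
  by apply: eq_tsum => a b; rewrite (cocycle_inv_onel hg).
by rewrite (counitr (F := fun y => aone P ∙ y)) ?(dg_mul1 hP); [|mlin..].
Qed.

Lemma twist_mulr1 : right_id (aone P) twist_mul.
Proof.
move=> y; rewrite twist_mulE exchange_tsum (tsum_cop_one hP); [|mlin..].
transitivity (\tsum_(y1, y2 <- cop y) cou y1 *: twist_rmulC (y2 ⊗ aone P)).
  by apply: eq_tsum => a b; rewrite (cocycle_oner hg).
rewrite (counitl (F := fun y => twist_rmulC (y ⊗ aone P))); [|mlin..].
rewrite twist_rmulE exchange_tsum (tsum_cop_one hP); [|mlin..].
apply: etrans (_ : _ = \tsum_(y1, y2 <- cop y) cou y2 *: (y1 ∙ aone P)) _.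
  by apply: eq_tsum => a b; rewrite (cocycle_inv_oner hg).
by rewrite (counitr (F := fun y => y ∙ aone P)) ?(dg_mulr1 hP); [|mlin..].
Qed.

(** The counit turns m into the counit of P ⊗ P, and g * gb = ε remains. *)
Lemma cou_twist_mulC c : cou (twist_mulC c) = cou c.
Proof.
have cl : is_linear (@cou k P : P -> k^o) by mlin.
rewrite twist_mulCE (lin_tsumE _ _ cl).
rewrite -[RHS](cocycle_invr hg); apply: eq_tsumk => c1 c2; rewrite (linZ _ _ cl); congr (_ * _).
rewrite /twist_rmulC (lin_tsumE _ _ cl).
apply: etrans (counitl (F := fun c => (gb c : k^o)) c2 (dgbi_coalg hC) _); [|mlin..].
by apply: eq_tsum => e1 e2; rewrite (linZ _ _ cl) cou_mulC; exact: mulrC.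
Qed.

Lemma twist_alg : is_alg twist.
Proof.
by split; [exact: twist_mul_bil|exact: twist_mulA|exact: twist_mul1|exact: twist_mulr1].
Qed.

Lemma twist_dgbi : is_dgbi twist.
Proof.
have h1 := homog_one hP.
have dl : is_linear (@gd k P) by mlin.
have muld x y n : hgP n x ->
    gd (twist_mul x y) = twist_mul (gd x) y + (-1) ^+ n *: twist_mul x (gd y).
  move=> hx; rewrite -twist_mulC_d -[@gd k C _]/(super_tensor_d (x ⊗ y)) (stens_dE hP hP _ hx).
  by rewrite (linD _ _ twist_mulC_lin) (linZ _ _ twist_mulC_lin).
case: (hP) => -[_ grd _ _ _ dd ddd _] hC' cd cud _ c1 _ cu1 cdd.
split=> //=.
- split=> //=; first exact: twist_alg.
  + by move=> m n v w hv hw; apply: twist_mulC_homog; exact: (homog_stens hP hP hv hw).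
  + by move=> n v w hv; exact: muld.
- by case: hC'.
- move=> x y; rewrite -[LHS]tsum_eta tsum_cop_twist_mulC; last exact: tens_bilinear.
  rewrite -[@cop k C _]/(ext_double_cop (x ⊗ y)) tsum_stens_cop; [|mlin..].
  by [].
- by move=> x y; rewrite -[twist_mul x y]/(twist_mulC _) cou_twist_mulC -stens_couE.
Qed.

End Twist.

(** * Super antipodes *)

#[global] Hint Resolve mulC_lin : multilinear.

(** The usual f = f * (e * h) = (f * e) * h = h. Several identities for antipodes below exhibit a
    left and a right convolution inverse of the same map. *)
Lemma conv_unique (k : fieldType) (C : bialg k) (B : alg k) (f e h : C -> B) :
  is_coalg C -> is_alg B -> is_linear f -> is_linear e -> is_linear h ->
  (forall c, \tsum_(c1, c2 <- cop c) f c1 ∙ e c2 = cou c *: aone B) ->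
  (forall c, \tsum_(c1, c2 <- cop c) e c1 ∙ h c2 = cou c *: aone B) ->
  forall c, f c = h c.
Proof.
move=> hC hB fl el hl fe eh c.
transitivity (\tsum_(c12, c3 <- cop c) \tsum_(c1, c2 <- cop c12) (f c1 ∙ e c2) ∙ h c3).
  rewrite (coassoc c hC); [|mlin..].
  rewrite -[LHS](is_alg_right_id hB).
  transitivity (\tsum_(c1, c2 <- cop c) cou c2 *: (f c1 ∙ aone B)).
    by rewrite (counitr (F := fun c => f c ∙ aone B)) //; mlin.
  apply: eq_tsum => c1 c23.
  rewrite -(linZ (f := fun x => f c1 ∙ x)); [|mlin..].
  rewrite -eh (lin_tsumE (g := fun x => f c1 ∙ x)); [|mlin..].
  by apply: eq_tsum => c2 c3; rewrite (is_alg_assoc hB).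
transitivity (\tsum_(c1, c2 <- cop c) cou c1 *: (aone B ∙ h c2)).
  apply: eq_tsum => c12 c3; rewrite -(linZ (f := fun x => x ∙ h c3)); [|mlin..].
  by rewrite -fe (lin_tsumE (g := fun x => x ∙ h c3)); [|mlin..].
rewrite (counitl (F := fun c => aone B ∙ h c)) //; [|mlin..].
exact: (is_alg_left_id hB).
Qed.

Section GprMul.
Variables (k : fieldType) (X : dga k).
Hypothesis hX : is_dga X.

Let gr := is_dga_grading hX.

Lemma gpr_mulr n e (a v : X) : homog (@gpr k X) e v ->
  gpr (n + e) (a ∙ v) = gpr n a ∙ v.
Proof.
move=> hv; move: a; apply: (homog_ext gr); [mlin..|] => m a ha.
rewrite (pr_homog gr _ ha) (pr_homog gr _ (is_dga_mul hX ha hv)) eqn_add2r.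
by case: eqP => // _; rewrite (lin0 (_ : is_linear (fun x => x ∙ v))); [|mlin..].
Qed.

End GprMul.

Lemma strongly_bicovariant_dgbi (k : fieldType) (A : bialg k) (X : dgbialg k) (i : A -> X)
  (S : X -> X) : is_strongly_bicovariant i S -> is_dgbi X.
Proof.
move=> [[hd _ _ _ _ _ _ _] [_ hC _ _ _ cm c1 cum cu1 _] cd _ cdd].
split=> // n x hx; have gr := is_dga_grading hd.
have gl m : is_linear (@gpr k X m) by exact: pr_lin.
(* The counit is only assumed to be even. It vanishes in positive degrees      *)
(* since cou (gpr 0 x) is a left counit as well.                               *)
have ex m y : homog (@gpr k X) m y -> \tsum_(y1, y2 <- cop y) cou (gpr 0 y1) *: y2 = y.
  move=> hy; have [I [d [e [u [v [hu hv D E]]]]]] := tens_expand gr gr (cd _ _ hy).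
  rewrite E; [|mlin..].
  have -> : y = \sum_i cou (u i) *: gpr m (v i).
    rewrite -{1}hy -{1}(is_coalg_left_counit hC y) E; [|mlin..].
    by rewrite lin_sumE //; apply: eq_bigr => i0 _; rewrite linZ.
  apply: eq_bigr => i0 _; rewrite (pr_homog gr _ (hu i0)) (pr_homog gr _ (hv i0)) (D i0).
  case: (d i0) => [|d0]; first by rewrite /= add0n eqxx.
  rewrite /= -[X in _ == X]add0n eqn_add2r /= scaler0.
  by rewrite (lin0 (is_coalg_cou_linear hC)) scale0r.
have ex' (y : X) : \tsum_(y1, y2 <- cop y) cou (gpr 0 y1) *: y2 = y.
  by move: y; apply: (homog_ext gr); [mlin|mlin|exact: ex].
have -> : cou x = cou (gpr 0 x).
  transitivity (\tsum_(x1, x2 <- cop x) ((cou (gpr 0 x1) * cou x2 : k) : k^o)).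
    rewrite -{1}(ex' x) (lin_tsumE _ _ (is_coalg_cou_linear hC)).
    by apply: eq_tsumk => a b; rewrite (linZ _ _ (is_coalg_cou_linear hC)).
  have /= <- := counitr (F := fun x : X => (cou (gpr 0 x) : k^o)) x hC
    (lin_comp (is_coalg_cou_linear hC) (gl 0%N)).
  by apply: eq_tsumk => a b; exact: mulrC.
by rewrite (pr_homog gr _ hx) (lin0 (is_coalg_cou_linear hC)).
Qed.

Section SuperAntipode.
Variables (k : fieldType) (X : dgbialg k) (S : X -> X).
Hypotheses (hX : is_dgbi X) (hS : is_antipode S).
Local Notation hg := (homog (@gpr k X)).

Let gr := dgbi_grading hX.
Let hC := dgbi_coalg hX.
Let Sl : is_linear S := is_antipode_linear hS.

(* The degree preserving part of S is a left inverse of id as well.            *)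
Lemma antipode_homog n x : hg n x -> hg n (S x).
Proof.
pose S' (x : X) := \hsum_(x' @ m <- x) gpr m (S x').
have S'l : is_linear S' by rewrite /S'; mlin.
suff E : forall x, S' x = S x.
  by move=> hx; rewrite -E /S' (hsum_homog gr hx); [exact: homog_pr|mlin].
apply: (conv_unique (e := fun x => x) hC (dgbi_alg hX)) => //; last exact: is_antipode_right.
apply: (homog_ext gr); [mlin..|] => m y hy.
have [I [d [e [u [v [hu hv D E]]]]]] := cop_expand hX hy.
rewrite E; [|mlin..].
transitivity (gpr m (cou y *: aone X)); last first.
  case: m hy {D} => [|m] hy; last first.
    by rewrite (dgbi_cou_degree hX hy) scale0r (lin0 (pr_lin gr _)).
  by rewrite (linZ _ _ (pr_lin gr _)) (homog_one hX).
rewrite -(is_antipode_left hS) E; [|mlin..].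
rewrite (lin_sumE _ _ _ (pr_lin gr _)); apply: eq_bigr => i _.
rewrite (D i) (gpr_mulr (dgbi_dga hX) _ _ (hv i)) /S' (hsum_homog gr (hu i)) //; mlin.
Qed.

Lemma antipode_one : S (aone X) = aone X.
Proof.
have := is_antipode_left hS (aone X); rewrite (tsum_cop_one hX); [|mlin..].
by rewrite (dgbi_cou_one hX) scale1r (dg_mulr1 hX).
Qed.

Lemma cou_antipode x : cou (S x) = cou x.
Proof.
have cl := is_coalg_cou_linear hC.
transitivity (\tsum_(x1, x2 <- cop x) ((cou (S x1) * cou x2 : k) : k^o)).
  have /= <- := counitr (F := fun x : X => (cou (S x) : k^o)) x hC (lin_comp cl Sl).
  by apply: eq_tsumk => a b; exact: mulrC.
have := congr1 (fun x => cou x) (is_antipode_left hS x).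
rewrite (lin_tsumE _ _ cl) (linZ _ _ cl) (dgbi_cou_one hX) => E.
transitivity (cou x *: (1 : k^o)); last exact: mulr1.
by rewrite -E; apply: eq_tsumk => a b; rewrite (dgbi_cou_mul hX).
Qed.

(** Both sides are convolution inverse to the multiplication in Hom(X ⊗ X, X): the left side from
    the left since m is a map of coalgebras, the right side from the right. *)
Lemma antipode_mul m n x y : hg m x -> hg n y ->
  S (x ∙ y) = (-1) ^+ (m * n) *: (S y ∙ S x).
Proof.
move=> hx hy; have hC2 := stens_dgbi hX hX; have g2 := dgbi_grading hC2.
pose h (c : stens X X) : X := \tsum_(x, y <- c) \hsum_(x' @ m <- x) \hsum_(y' @ n <- y)
  (-1) ^+ (m * n) *: (S y' ∙ S x').
have hl : is_linear h by rewrite /h; mlin.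
have hE i j a b : hg i a -> hg j b -> h (a ⊗ b) = (-1) ^+ (i * j) *: (S b ∙ S a).
  move=> ha hb; rewrite /h tsum_tens; [|mlin..].
  by rewrite (hsum_homog gr ha) ?(hsum_homog gr hb) //; mlin.
rewrite -(hE _ _ _ _ hx hy) -(mulC_tens hX).
move: (x ⊗ y); have ml := mulC_lin hX.
apply: (conv_unique (e := @mulC k X) (dgbi_coalg hC2) (dgbi_alg hX)); [mlin..| |].
  by move=> c; rewrite -(tsum_cop_mulC hX (F := fun a b => S a ∙ b)) ?(is_antipode_left hS)
    ?(cou_mulC hX) //; mlin.
have cl : is_linear (@cop k (stens X X)) by mlin.
have c2 : is_linear (@cou k (stens X X) : X ⊗ X -> k^o) by mlin.
apply: (tens_hext gr gr); [mlin..|] => i j a b ha hb.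
have [I [da [ea [ua [va [hua hva Da Ea]]]]]] := cop_expand hX ha.
have [J [db [eb [ub [vb [hub hvb Db Eb]]]]]] := cop_expand hX hb.
rewrite -[@cop k (stens X X) _]/(ext_double_cop (a ⊗ b)) tsum_stens_cop; [|mlin..].
rewrite -[@cou k (stens X X) _]/(ext_double_cou (a ⊗ b)) stens_couE; [|mlin..].
transitivity (\tsum_(a1, a2 <- cop a) cou b *: (a1 ∙ S a2)); last first.
  by rewrite -tsumZ (is_antipode_right hS) scalerA mulrC.
rewrite !Ea; [|mlin..]; apply: eq_bigr => i1 _.
(* In a1 b1 S(b2) S(a2) the inner pair collapses first and forces b to have degree 0; then the outer
   pair collapses. *)
transitivity ((-1) ^+ (ea i1 * j) *: (ua i1 ∙ (\tsum_(b1, b2 <- cop b) b1 ∙ S b2) ∙ S (va i1))).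
  rewrite !Eb; [|mlin..].
  rewrite (lin_sumE (f := fun x => ua i1 ∙ x ∙ S (va i1))); [|mlin..].
  rewrite scaler_sumr; apply: eq_bigr => j1 _.
  hsum_at gr (hva i1).
  hsum_at gr (hub j1).
  rewrite (mulC_tens hX) (hE _ _ _ _ (hva i1) (hvb j1)) (mulZr hX) !(dg_mulA hX) (Db j1).
  signs.
rewrite (is_antipode_right hS) (mulZr hX) (mulZl hX) (dg_mulr1 hX).
case: j hb {Db} => [|j] hb; first by rewrite muln0 scale1r.
by rewrite (dgbi_cou_degree hX hb) !scale0r scaler0.
Qed.

(** The defect D = dS - Sd satisfies D * id = 0: subtract the antipode identity at dx from the
    differential of the one at x. Convolving with S on the right gives D = 0. *)
Lemma antipode_d x : S (gd x) = gd (S x).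
Proof.
have dl : is_linear (@gd k X) by mlin.
pose D x := gd (S x) - S (gd x).
have Dl : is_linear D by rewrite /D; mlin.
have D0 : forall x, \tsum_(x1, x2 <- cop x) D x1 ∙ x2 = 0.
  apply: (homog_ext gr); [mlin|exact: lin_zero|] => n y hy.
  have E1 := congr1 (fun z => gd z) (is_antipode_left hS y).
  have E2 := is_antipode_left hS (gd y).
  rewrite /= (linZ _ _ dl) (_ : gd (aone X) = 0) ?scaler0 in E1; last first.
    have := is_dga_leibniz (dgbi_dga hX) (aone X) (homog_one hX).
    rewrite (dg_mulr1 hX) expr0 scale1r (dg_mul1 hX) (dg_mulr1 hX) -[X in X = _]addr0.
    by move/addrI.
  rewrite (_ : cou (gd y) = 0) ?scale0r in E2; last exact: (dgbi_cou_degree hX (homog_d hX hy)).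
  rewrite (tsum_cop_d hX) in E2; [|mlin..].
  rewrite -[RHS](subr0 0) -{1}E1 -E2 (lin_tsumE _ _ dl).
  have [I [d [e [u [v [hu hv _ E]]]]]] := cop_expand hX hy.
  rewrite !E; [|mlin..]; rewrite -sumrB; apply: eq_bigr => i _.
  hsum_at gr (hu i).
  rewrite (is_dga_leibniz (dgbi_dga hX) _ (antipode_homog (hu i))) /D.
  rewrite (linD (f := fun x => x ∙ v i)); [|mlin..].
  rewrite opprD addrACA subrr addr0; congr (_ + _).
  by rewrite -scaleN1r (mulZl hX) scaleN1r.
suff : D x = 0 by move/subr0_eq.
transitivity (\tsum_(x1, x23 <- cop x) \tsum_(x2, x3 <- cop x23) D x1 ∙ (x2 ∙ S x3)).
  transitivity (\tsum_(x1, x2 <- cop x) cou x2 *: D x1); first by rewrite (counitr (F := D)).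
  apply: eq_tsum => x1 x23; rewrite -(lin_tsumE (g := fun y => D x1 ∙ y)); [|mlin..].
  by rewrite (is_antipode_right hS) (mulZr hX) (dg_mulr1 hX).
rewrite -(coassoc (C := X) (F := fun x1 x2 x3 => D x1 ∙ (x2 ∙ S x3))); [|mlin..].
apply: tsum0 => x12 x3.
transitivity ((\tsum_(x1, x2 <- cop x12) D x1 ∙ x2) ∙ S x3).
  rewrite (lin_tsumE (g := fun y => y ∙ S x3)); [|mlin..].
  by apply: eq_tsum => x1 x2; rewrite (dg_mulA hX).
by rewrite D0 (lin0 (_ : is_linear (fun x => x ∙ S x3))); [|mlin..].
Qed.

(** Both sides are convolution inverse to Δ in Hom(X, X ⊗ X), one on each side. *)
Lemma cop_antipode x : cop (S x) = \tsum_(x1, x2 <- cop x) \hsum_(x1' @ m <- x1)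
  \hsum_(x2' @ n <- x2) (-1) ^+ (m * n) *: (S x2' ⊗ S x1').
Proof.
have hC2 := stens_dgbi hX hX.
have mB : is_bilinear (@amul k (stens X X)) by exact: mul_bil (dgbi_alg hC2).
pose h (x : X) : stens X X := \tsum_(x1, x2 <- cop x) \hsum_(x1' @ m <- x1)
  \hsum_(x2' @ n <- x2) (-1) ^+ (m * n) *: (S x2' ⊗ S x1').
have hl : is_linear h by rewrite /h; mlin.
rewrite -[RHS]/(h x).
have cl : is_linear (@cop k X : X -> stens X X) by mlin.
apply: (conv_unique (B := stens X X) (f := fun x => cop (S x)) (e := @cop k X) (h := h)
  hC (dgbi_alg hC2)); [mlin..| |].
  move=> c; transitivity (cop (\tsum_(c1, c2 <- cop c) S c1 ∙ c2) : stens X X).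
    rewrite (lin_tsumE _ _ cl); apply: eq_tsum => c1 c2.
    by rewrite (dgbi_cop_mul hX).
  by rewrite (is_antipode_left hS) (linZ _ _ cl) (dgbi_cop_one hX).
(* The convolution of Δ with [h], as a multilinear expression in four legs. First x2 S(x3) collapses
   to the counit, then x1 S(x4). *)
pose T (x1 x2 x3 x4 : X) : stens X X :=
  \hsum_(x2' @ b <- x2) \hsum_(x3' @ c <- x3) \hsum_(x4' @ d <- x4)
  (-1) ^+ (c * d + b * d) *: ((x1 ∙ S x4') ⊗ (x2' ∙ S x3')).
have TE b c d (x1 x2 x3 x4 : X) : hg b x2 -> hg c x3 -> hg d x4 ->
  T x1 x2 x3 x4 = (-1) ^+ (c * d + b * d) *: ((x1 ∙ S x4) ⊗ (x2 ∙ S x3)).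
  move=> h2 h3 h4; rewrite /T (hsum_homog gr h2); [|mlin..].
  hsum_at gr h3.
  by hsum_at gr h4.
have T1 x2 x3 x4 : is_linear (fun x1 => T x1 x2 x3 x4) by rewrite /T; mlin.
have T2 x1 x3 x4 : is_linear (fun x2 => T x1 x2 x3 x4) by rewrite /T; mlin.
have T3 x1 x2 x4 : is_linear (fun x3 => T x1 x2 x3 x4) by rewrite /T; mlin.
have T4 x1 x2 x3 : is_linear (fun x4 => T x1 x2 x3 x4) by rewrite /T; mlin.
clearbody T; move=> y.
transitivity (\tsum_(x12, x34 <- cop y) \tsum_(x1, x2 <- cop x12)
  \tsum_(x3, x4 <- cop x34) T x1 x2 x3 x4).
  apply: (tsum_hext _ gr gr); [mlin..|] => m n a b ha hb.
  have [I [da [ea [ua [va [hua hva Da Ea]]]]]] := cop_expand hX ha.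
  have [J [db [eb [ub [vb [hub hvb Db Eb]]]]]] := cop_expand hX hb.
  rewrite -[@amul k (stens X X) _ _]/(super_tensor_mul (cop a) (h b)) /super_tensor_mul.
  rewrite !Ea; [|mlin..]; apply: eq_bigr => i _.
  rewrite /h tsum_tsum ?Eb; [|mlin..]; apply: eq_bigr => j _.
  hsum_at gr (hub j).
  hsum_at gr (hvb j).
  rewrite (linZ _ _ (tsum_linear _)) ?tsum_tens; [|mlin..].
  hsum_at gr (hva i).
  hsum_at gr (antipode_homog (hvb j)).
  by rewrite (TE _ _ _ _ _ _ _ (hva i) (hub j) (hvb j)); signs.
rewrite (coassoc y hC (F := fun x1 x2 x34 => \tsum_(x3, x4 <- cop x34) T x1 x2 x3 x4)); [|mlin..].
transitivity (\tsum_(x1, x2 <- cop y) ((x1 ∙ S x2) ⊗ aone X)).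
  apply: eq_tsum => x1 x24; rewrite -(coassoc x24 hC (F := T x1)); [|mlin..].
  transitivity (\tsum_(x23, x4 <- cop x24) cou x23 *: ((x1 ∙ S x4) ⊗ aone X)).
    apply: (tsum_hext _ gr gr); [mlin..|] => m n a b ha hb.
    have [I [da [ea [ua [va [hua hva Da Ea]]]]]] := cop_expand hX ha.
    transitivity ((-1) ^+ (m * n) *: ((x1 ∙ S b) ⊗ \tsum_(a1, a2 <- cop a) a1 ∙ S a2)).
      rewrite !Ea; [|mlin..].
      rewrite (lin_sumE (f := tens _)) ?scaler_sumr; [|mlin..].
      apply: eq_bigr => i _; rewrite (TE _ _ _ _ _ _ _ (hua i) (hva i) hb) (Da i); signs.
    rewrite (is_antipode_right hS) tensZr; case: m ha {Da} => [|m] ha; first by rewrite scale1r.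
    by rewrite (dgbi_cou_degree hX ha) !scale0r scaler0.
  by rewrite (counitl (F := fun z => (x1 ∙ S z) ⊗ aone X)); [|mlin..].
rewrite -(lin_tsumE (g := fun z => z ⊗ aone X)); [|mlin..].
by rewrite (is_antipode_right hS) tensZl.
Qed.

Lemma deg0_antipode f : deg0_form f -> deg0_form (fun x => f (S x)).
Proof.
move=> hf; split=> [|n x hx]; first by mlin.
by apply: (deg0_form_van hf); exact: (antipode_homog hx).
Qed.

(** S reverses the legs, and the sign of the exchange vanishes because f restricts x1 to degree
    0. *)
Lemma deg0_cop_antipode (U : lmodType k) (f : X -> k) (F : X -> U) x :
  deg0_form f -> is_linear F ->
  \tsum_(x1, x2 <- cop (S x)) f x2 *: F x1 = \tsum_(x1, x2 <- cop x) f (S x1) *: F (S x2).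
Proof.
move=> hf Fl; have hfS := deg0_antipode hf.
have fB : is_bilinear (fun a b : X => f b *: F a) by mlin.
rewrite cop_antipode tsum_tsum //; apply: (tsum_hext _ gr gr); [mlin..|] => m n a b ha hb.
hsum_at gr ha.
hsum_at gr hb.
rewrite (linZ _ _ (tsum_linear fB)) tsum_tens //.
case: m ha => [|m] ha; first by rewrite mul0n scale1r.
by rewrite (deg0_form_van hfS ha) !scale0r scaler0.
Qed.

End SuperAntipode.

(** * The cocycle of a pairing *)

#[global] Hint Resolve sop_dgbi sop_mul_bil is_antipode_linear : multilinear.

Record deg0_bilinear (k : fieldType) (X Y : dga k) (q : Y -> X -> k) : Prop := Deg0Bilinear {
  deg0_bil : is_bilinear (q : Y -> X -> k^o);
  deg0_bil_l : forall n y x, homog (@gpr k Y) n.+1 y -> q y x = 0;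
  deg0_bil_r : forall n y x, homog (@gpr k X) n.+1 x -> q y x = 0 }.

#[global] Hint Resolve deg0_bil : multilinear.

Lemma deg0_form_l (k : fieldType) (X Y : dga k) (q : Y -> X -> k) x :
  deg0_bilinear q -> deg0_form (q^~ x).
Proof. by move=> hq; split; [mlin|move=> n y; exact: deg0_bil_l]. Qed.

Lemma deg0_form_r (k : fieldType) (X Y : dga k) (q : Y -> X -> k) y :
  deg0_bilinear q -> deg0_form (q y).
Proof. by move=> hq; split; [mlin|move=> n x; exact: deg0_bil_r]. Qed.

(** * The form induced by a pairing on Ω(A)^op ⊗ Ω(H) *)

Section DoubleForm.
Variables (k : fieldType) (X Y : dgbialg k).
Hypotheses (hX : is_dgbi X) (hY : is_dgbi Y).
Local Notation P := (stens (sop X) Y).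
Local Notation C := (stens P P).
Variables (q : Y -> X -> k).
Hypothesis hq : deg0_bilinear q.

Let hP : is_dgbi P := stens_dgbi (sop_dgbi hX) hY.
Let gX := dgbi_grading hX.
Let gY := dgbi_grading hY.

Definition double_form2 (s t : P) : k :=
  \tsum_(w, y <- s) \tsum_(x, z <- t) ((cou w * q y x * cou z : k) : k^o).

Definition double_form (c : C) : k := \tsum_(s, t <- c) (double_form2 s t : k^o).

Lemma double_form2_bil : is_bilinear (double_form2 : P -> P -> k^o).
Proof. by rewrite /double_form2; mlin. Qed.
Hint Resolve double_form2_bil : multilinear.

Lemma double_form2E (w x : X) (y z : Y) :
  double_form2 (w ⊗ y) (x ⊗ z) = cou w * q y x * cou z.
Proof. by rewrite /double_form2 tsum_tens ?tsum_tens //; mlin. Qed.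

Lemma double_formE s t : double_form (s ⊗ t) = double_form2 s t.
Proof. by rewrite /double_form tsum_tens //; mlin. Qed.

Lemma double_form2_deg0 : deg0_bilinear double_form2.
Proof.
split; first exact: double_form2_bil.
  move=> n s t /(stens_expand (sop_dgbi hX) hY)[I [d [e [v [w [hv hw D ->]]]]]].
  rewrite (lin_sumE (f := fun s => (double_form2 s t : k^o))); [|mlin..].
  rewrite big1 // => i _.
  move: t; apply: (tens_ext (f := fun t => (double_form2 (v i ⊗ w i) t : k^o)) (g := fun=> 0));
    [mlin|exact: lin_zero|] => a b.
  rewrite double_form2E; case: (d i) (hv i) (D i) => [|m] hm.
    by rewrite add0n => E; have := hw i; rewrite -E => /(deg0_bil_l hq) ->; rewrite mulr0 mul0r.
  by rewrite (dgbi_cou_degree hX hm) !mul0r.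
move=> n s t /(stens_expand (sop_dgbi hX) hY)[I [d [e [v [w [hv hw D ->]]]]]].
rewrite (lin_sumE (f := fun t => (double_form2 s t : k^o))); [|mlin..].
rewrite big1 // => i _.
move: s; apply: (tens_ext (f := fun s => (double_form2 s (v i ⊗ w i) : k^o)) (g := fun=> 0));
  [mlin|exact: lin_zero|] => a b.
rewrite double_form2E; case: (d i) (hv i) (D i) => [|m] hm.
  by rewrite add0n => E; have := hw i; rewrite -E => /(dgbi_cou_degree hY) ->; rewrite mulr0.
by rewrite (deg0_bil_r hq _ hm) mulr0 mul0r.
Qed.
Let f2 := double_form2_deg0.

Lemma double_form_deg0 : deg0_form double_form.
Proof.
split; first by rewrite /double_form; mlin.
move=> n c /(stens_expand hP hP)[I [d [e [v [w [hv hw D ->]]]]]].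
rewrite (lin_sumE (f := double_form : C -> k^o)); last by rewrite /double_form; mlin.
rewrite big1 // => i _; rewrite double_formE; case: (d i) (hv i) (D i) => [|m] hm.
  by rewrite add0n => E; have := hw i; rewrite -E => /(deg0_bil_r f2) ->.
by rewrite (deg0_bil_l f2 _ hm).
Qed.

(** Of the four factors the form pairs only the inner two, y and x. The counits on the outer two
    absorb the coproducts of w and z. *)
Lemma tsum_double_forml (U : lmodType k) (F : P -> P -> U) (w x : X) (y z : Y) :
  is_bilinear F ->
  \tsum_(s1, s2 <- @cop k P (w ⊗ y)) \tsum_(t1, t2 <- @cop k P (x ⊗ z))
    double_form2 s1 t1 *: F s2 t2 =
  \tsum_(y1, y2 <- cop y) \tsum_(x1, x2 <- cop x) q y1 x1 *: F (w ⊗ y2) (x2 ⊗ z).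
Proof.
move=> FB; have hsX := sop_dgbi hX.
have F1 t : is_linear (fun s : X ⊗ Y => F s t) by mlin.
have F2 s : is_linear (fun t : X ⊗ Y => F s t) by mlin.
have c1 := dgbi_cou_one hX.
have GE a b t : double_form2 (a ⊗ b) t = cou a * double_form2 (aone X ⊗ b) t.
  move: t; apply: (tens_ext (f := fun t => (double_form2 (a ⊗ b) t : k^o))
    (g := fun t => (cou a * double_form2 (aone X ⊗ b) t : k^o))); [mlin..|] => c d.
  by rewrite !double_form2E c1 mul1r !mulrA.
rewrite exchange_tsum.
transitivity (\tsum_(t1, t2 <- @cop k P (x ⊗ z)) \tsum_(y1, y2 <- cop y)
    double_form2 (aone X ⊗ y1) t1 *: F (w ⊗ y2) t2).
  apply: eq_tsum => t1 t2.
  apply: etrans (deg0_stens_copl hsX hY (F := fun s => F s t2) w y (deg0_form_l t1 f2) _) _; first by mlin.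
  transitivity (\tsum_(w1, w2 <- cop w) cou w1 *: \tsum_(y1, y2 <- cop y)
    double_form2 (aone X ⊗ y1) t1 *: F (w2 ⊗ y2) t2).
    apply: eq_tsum => w1 w2; rewrite tsumZ; apply: eq_tsum => y1 y2.
    by rewrite GE scalerA.
  by rewrite (counitl (F := fun w => \tsum_(y1, y2 <- cop y)
    double_form2 (aone X ⊗ y1) t1 *: F (w ⊗ y2) t2)); [|mlin..].
rewrite exchange_tsum; apply: eq_tsum => y1 y2.
apply: etrans (deg0_stens_copl hsX hY (F := F (w ⊗ y2)) x z (deg0_form_r (Y := P) (aone X ⊗ y1) f2) _) _;
  first by mlin.
apply: eq_tsum => x1 x2.
transitivity (\tsum_(z1, z2 <- cop z) cou z1 *: (q y1 x1 *: F (w ⊗ y2) (x2 ⊗ z2))).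
  by apply: eq_tsum => z1 z2; rewrite double_form2E c1 mul1r scalerA mulrC.
by rewrite (counitl (F := fun z => q y1 x1 *: F (w ⊗ y2) (x2 ⊗ z))); [|mlin..].
Qed.

Lemma tsum_double_formr (U : lmodType k) (F : P -> P -> U) (w x : X) (y z : Y) :
  is_bilinear F ->
  \tsum_(s1, s2 <- @cop k P (w ⊗ y)) \tsum_(t1, t2 <- @cop k P (x ⊗ z))
    double_form2 s2 t2 *: F s1 t1 =
  \tsum_(y1, y2 <- cop y) \tsum_(x1, x2 <- cop x) q y2 x2 *: F (w ⊗ y1) (x1 ⊗ z).
Proof.
move=> FB; have hsX := sop_dgbi hX.
have F1 t : is_linear (fun s : X ⊗ Y => F s t) by mlin.
have F2 s : is_linear (fun t : X ⊗ Y => F s t) by mlin.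
have c1 := dgbi_cou_one hX.
have GE a b t : double_form2 (a ⊗ b) t = cou a * double_form2 (aone X ⊗ b) t.
  move: t; apply: (tens_ext (f := fun t => (double_form2 (a ⊗ b) t : k^o))
    (g := fun t => (cou a * double_form2 (aone X ⊗ b) t : k^o))); [mlin..|] => c d.
  by rewrite !double_form2E c1 mul1r !mulrA.
rewrite exchange_tsum.
transitivity (\tsum_(t1, t2 <- @cop k P (x ⊗ z)) \tsum_(y1, y2 <- cop y)
    double_form2 (aone X ⊗ y2) t2 *: F (w ⊗ y1) t1).
  apply: eq_tsum => t1 t2.
  apply: etrans (deg0_stens_copr hsX hY (F := fun s => F s t1) w y (deg0_form_l t2 f2) _) _; first by mlin.
  transitivity (\tsum_(w1, w2 <- cop w) cou w2 *: \tsum_(y1, y2 <- cop y)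
    double_form2 (aone X ⊗ y2) t2 *: F (w1 ⊗ y1) t1).
    apply: eq_tsum => w1 w2; rewrite tsumZ; apply: eq_tsum => y1 y2.
    by rewrite GE scalerA.
  by rewrite (counitr (F := fun w => \tsum_(y1, y2 <- cop y)
    double_form2 (aone X ⊗ y2) t2 *: F (w ⊗ y1) t1)); [|mlin..].
rewrite exchange_tsum; apply: eq_tsum => y1 y2.
apply: etrans (deg0_stens_copr hsX hY (F := F (w ⊗ y1)) x z (deg0_form_r (Y := P) (aone X ⊗ y2) f2) _) _;
  first by mlin.
apply: eq_tsum => x1 x2.
transitivity (\tsum_(z1, z2 <- cop z) cou z2 *: (q y2 x2 *: F (w ⊗ y1) (x1 ⊗ z1))).
  by apply: eq_tsum => z1 z2; rewrite double_form2E c1 mul1r scalerA mulrC.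
by rewrite (counitr (F := fun z => q y2 x2 *: F (w ⊗ y1) (x1 ⊗ z))); [|mlin..].
Qed.

(** The product of P contributes signs depending on |x|, but the form contains ε(x), which vanishes
    in positive degrees. *)
Lemma double_form2_mull (w x a : X) (y z v : Y) :
  double_form2 (@amul k P (w ⊗ y) (x ⊗ z)) (a ⊗ v) = cou w * cou x * q (y ∙ z) a * cou v.
Proof.
have hsX := sop_dgbi hX.
have mB : is_bilinear (@amul k P) by exact: mul_bil (dgbi_alg hP).
have mB' : is_bilinear (@amul k P : X ⊗ Y -> X ⊗ Y -> X ⊗ Y) by [].
move: y x; apply: (homog_ext2 (f := fun y x => (double_form2 (@amul k P (w ⊗ y) (x ⊗ z)) (a ⊗ v) : k^o))
 (g := fun y x => (cou w * cou x * q (y ∙ z) a * cou v : k^o)) gY gX); [mlin..|].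
move=> m n y x hy hx.
have -> : @amul k P (w ⊗ y) (x ⊗ z) = (-1) ^+ (m * n) *: (sop_mul w x ⊗ (y ∙ z)).
  exact: stens_mulE.
rewrite (linZ (f := fun s => (double_form2 s (a ⊗ v) : k^o))); [|mlin..].
rewrite double_form2E (dgbi_cou_mul hsX w x : cou (sop_mul w x) = cou w * cou x).
case: n hx => [|n] hx; first by rewrite muln0 scale1r.
by rewrite (dgbi_cou_degree hX hx) !(mulr0, mul0r) scaler0.
Qed.

(** The arguments a and x appear reversed because the first factor of P is the opposite algebra. All
    signs involve |a|, and the pairing vanishes unless that is 0. *)
Lemma double_form2_mulr (w x a : X) (y z v : Y) :
  double_form2 (w ⊗ y) (@amul k P (x ⊗ z) (a ⊗ v)) = cou w * q y (a ∙ x) * (cou z * cou v).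
Proof.
have hsX := sop_dgbi hX.
have mB : is_bilinear (@amul k P) by exact: mul_bil (dgbi_alg hP).
have mB' : is_bilinear (@amul k P : X ⊗ Y -> X ⊗ Y -> X ⊗ Y) by [].
move: x z a; apply: (homog_ext3
 (f := fun (x : X) (z : Y) (a : X) => (double_form2 (w ⊗ y) (@amul k P (x ⊗ z) (a ⊗ v)) : k^o))
 (g := fun (x : X) (z : Y) (a : X) => (cou w * q y (a ∙ x) * (cou z * cou v) : k^o)) gX gY gX); [mlin..|].
move=> l m n x z a hx hz ha.
have -> : @amul k P (x ⊗ z) (a ⊗ v) = (-1) ^+ (m * n) *: (sop_mul x a ⊗ (z ∙ v)).
  exact: stens_mulE.
rewrite (sop_mulE hX hx ha : sop_mul x a = _) tensZl scalerA.
rewrite (linZ (f := fun s => (double_form2 (w ⊗ y) s : k^o))); [|mlin..].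
rewrite double_form2E (dgbi_cou_mul hY) .
case: n ha => [|n] ha; first by rewrite !muln0 mulr1 scale1r.
have := homog_mul hX ha hx; rewrite addSn => /(deg0_bil_r hq) ->.
by rewrite mulr0 mul0r scaler0.
Qed.

End DoubleForm.

(** The axioms of a Hopf pairing on the level of Ω(A) and Ω(H), together with vanishing in positive
    degrees. They carry no signs for that reason. *)
Record deg0_pairing (k : fieldType) (X Y : dgbialg k) (SX : X -> X) (SY : Y -> Y)
    (q : Y -> X -> k) : Prop := Deg0Pairing {
  deg0_pairing_bil : deg0_bilinear q;
  deg0_pairing_mull : forall y z x,
    q (y ∙ z) x = \tsum_(x1, x2 <- cop x) ((q y x1 * q z x2 : k) : k^o);
  deg0_pairing_mulr : forall y x a,
    q y (x ∙ a) = \tsum_(y1, y2 <- cop y) ((q y1 x * q y2 a : k) : k^o);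
  deg0_pairing_onel : forall x, q (aone Y) x = cou x;
  deg0_pairing_oner : forall y, q y (aone X) = cou y;
  deg0_pairing_antipode : forall y x, q (SY y) x = q y (SX x) }.

(** * The cocycle identities from the axioms of a Hopf pairing *)

Section PairingCocycle.
Variables (k : fieldType) (X Y : dgbialg k) (SX : X -> X) (SY : Y -> Y).
Variable q : Y -> X -> k.
Hypotheses (hX : is_dgbi X) (hY : is_dgbi Y).
Hypotheses (hSX : is_antipode SX) (hSY : is_antipode SY).
Hypothesis hq : deg0_pairing SX SY q.
Local Notation P := (stens (sop X) Y).
Local Notation C := (stens P P).

Let hsX := sop_dgbi hX.
Let hP : is_dgbi P := stens_dgbi hsX hY.
Let gX := dgbi_grading hX.
Let gY := dgbi_grading hY.
Let q0 := deg0_pairing_bil hq.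

(** The convolution inverse of the pairing. It gives the cocycle g, while the pairing itself gives
    gb. *)
Definition inv_pairing (y : Y) (x : X) : k := q (SY y) x.
Local Notation qs := inv_pairing.

Lemma inv_pairing_deg0 : deg0_bilinear qs.
Proof.
split.
- by rewrite /qs; mlin.
- by move=> n y x /(antipode_homog hY hSY) hy; exact: (deg0_bil_l q0 _ hy).
- by move=> n y x hx; exact: (deg0_bil_r q0 _ hx).
Qed.
Let qs0 := inv_pairing_deg0.

(** The antipode reverses products; its sign is trivial where the pairing does not vanish. *)
Lemma inv_pairing_mull y z x :
  qs (y ∙ z) x = \tsum_(x1, x2 <- cop x) ((qs z x1 * qs y x2 : k) : k^o).
Proof.
move: y z; apply: (homog_ext2 (f := fun y z => (qs (y ∙ z) x : k^o)) gY gY); [mlin..|].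
move=> m n y z hy hz; rewrite {1}/qs (antipode_mul hY hSY hy hz).
rewrite (linZ (f := fun y => (q y x : k^o))); [|mlin..].
rewrite (deg0_pairing_mull hq).
case: m hy => [|m] hy; first by rewrite mul0n scale1r.
rewrite [tsum _ _]tsum0 ?scaler0 // => a b.
by rewrite -[q (SY y) b]/(qs y b) (deg0_bil_l qs0 _ hy) mulr0.
Qed.

Lemma inv_pairing_mulr y a x :
  qs y (a ∙ x) = \tsum_(y1, y2 <- cop y) ((qs y1 x * qs y2 a : k) : k^o).
Proof.
move: a x; apply: (homog_ext2 (f := fun a x => (qs y (a ∙ x) : k^o)) gX gX); [mlin..|].
move=> m n a x ha hx; rewrite {1}/qs (deg0_pairing_antipode hq) (antipode_mul hX hSX ha hx).
rewrite (linZ (f := fun x => (q y x : k^o))); [|mlin..].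
rewrite (deg0_pairing_mulr hq).
have qE u b : q u (SX b) = qs u b by rewrite /qs (deg0_pairing_antipode hq).
case: m ha => [|m] ha.
  by rewrite mul0n scale1r; apply: eq_tsum => u b; rewrite !qE.
rewrite [tsum _ _]tsum0 ?scaler0 => [|u b].
  by symmetry; apply: tsum0 => u b; rewrite (deg0_bil_r qs0 _ ha) mulr0.
by rewrite !qE (deg0_bil_r qs0 _ ha) mulr0.
Qed.

Lemma inv_pairing_onel x : qs (aone Y) x = cou x.
Proof. by rewrite /qs (antipode_one hY hSY) (deg0_pairing_onel hq). Qed.

Lemma inv_pairing_oner y : qs y (aone X) = cou y.
Proof. by rewrite /qs (deg0_pairing_oner hq) (cou_antipode hY hSY). Qed.

Lemma inv_pairingl y x : \tsum_(y1, y2 <- cop y) \tsum_(x1, x2 <- cop x)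
  ((qs y1 x1 * q y2 x2 : k) : k^o) = cou y * cou x.
Proof.
have ql : is_linear (fun y => q y x : k^o) by mlin.
transitivity (q (\tsum_(y1, y2 <- cop y) SY y1 ∙ y2) x).
  by rewrite (lin_tsumE _ _ ql); apply: eq_tsum => y1 y2; rewrite (deg0_pairing_mull hq).
by rewrite (is_antipode_left hSY) (linZ _ _ ql) (deg0_pairing_onel hq).
Qed.

Lemma inv_pairingr y x : \tsum_(y1, y2 <- cop y) \tsum_(x1, x2 <- cop x)
  ((q y1 x1 * qs y2 x2 : k) : k^o) = cou y * cou x.
Proof.
have ql : is_linear (fun y => q y x : k^o) by mlin.
transitivity (q (\tsum_(y1, y2 <- cop y) y1 ∙ SY y2) x).
  by rewrite (lin_tsumE _ _ ql); apply: eq_tsum => y1 y2; rewrite (deg0_pairing_mull hq).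
by rewrite (is_antipode_right hSY) (linZ _ _ ql) (deg0_pairing_onel hq).
Qed.

(** Once the counits have absorbed the outer factors, the convolution of two such forms on P ⊗ P is
    the convolution of the two pairings on y and x. *)
Let conv_form r r' : deg0_bilinear r -> deg0_bilinear r' ->
  (forall y x, \tsum_(y1, y2 <- cop y) \tsum_(x1, x2 <- cop x)
    ((r y1 x1 * r' y2 x2 : k) : k^o) = cou y * cou x) ->
  forall c : C, \tsum_(c1, c2 <- cop c)
    ((double_form r c1 * double_form r' c2 : k) : k^o) = cou c.
Proof.
move=> hr hr' rr'.
have fl := deg0_form_lin (double_form_deg0 hX hY hr).
have fl' := deg0_form_lin (double_form_deg0 hX hY hr').
have bl := deg0_bil (double_form2_deg0 hX hY hr).
have bl' := deg0_bil (double_form2_deg0 hX hY hr').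
have rB := deg0_bil hr. have rB' := deg0_bil hr'.
have cl : is_linear (@cou k C : C -> k^o) by mlin.
have lin c : is_linear (fun c : C => \tsum_(c1, c2 <- cop c)
    ((double_form r c1 * double_form r' c2 : k) : k^o)) by mlin.
move=> c; move: (c : P ⊗ P) => {}c; move: c.
apply: (tens_ext (f := fun c => \tsum_(c1, c2 <- @cop k C c)
    ((double_form r c1 * double_form r' c2 : k) : k^o)) (g := fun c => @cou k C c : k^o)); [mlin..|].
move=> s t.
apply: etrans (deg0_stens_copl hP hP (F := fun c => (double_form r' c : k^o)) s t
  (double_form_deg0 hX hY hr) _) _; first by mlin.
transitivity (\tsum_(s1, s2 <- @cop k P s) \tsum_(t1, t2 <- @cop k P t)
   double_form2 r s1 t1 *: (double_form2 r' s2 t2 : k^o)).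
  by apply: eq_tsum => s1 s2; apply: eq_tsum => t1 t2; rewrite !(double_formE hX hY).
rewrite -[RHS]/(ext_double_cou (s ⊗ t)) stens_couE; [|mlin..].
move: s t; apply: (tens_hext2
  (f := fun s t => \tsum_(s1, s2 <- @cop k P s) \tsum_(t1, t2 <- @cop k P t)
   double_form2 r s1 t1 *: (double_form2 r' s2 t2 : k^o))
  (g := fun s t => (@cou k P s * @cou k P t : k^o)) gX gY gX gY); [mlin..|].
move=> _ _ _ _ w y x z _ _ _ _.
rewrite (tsum_double_forml hX hY hr); [|mlin..].
rewrite -![@cou k P _]/(ext_double_cou _) !stens_couE; [|mlin..].
transitivity (cou w *: (cou z *: \tsum_(y1, y2 <- cop y) \tsum_(x1, x2 <- cop x)
    ((r y1 x1 * r' y2 x2 : k) : k^o))).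
  rewrite !tsumZ; apply: eq_tsum => y1 y2; rewrite !tsumZ; apply: eq_tsum => x1 x2.
  rewrite (double_form2E hX hY hr') -[LHS]/(_ * _) -[RHS]/(_ * (_ * (_ * _))).
  by ring.
by rewrite rr' -[LHS]/(_ * (_ * (_ * _))); ring.
Qed.

(** Both sides equal ε(w) ε(v) qs(y1, x) qs(z, a1) qs(y2, a2), by expanding qs(y2 z, a) on the left
    and qs(y, a2 x) on the right. *)
Let assoc_form (s t u : P) :
  \tsum_(s1, s2 <- cop s) \tsum_(t1, t2 <- cop t)
    double_form2 qs s1 t1 *: (double_form2 qs (s2 ∙ t2) u : k^o) =
  \tsum_(t1, t2 <- cop t) \tsum_(u1, u2 <- cop u)
    double_form2 qs t1 u1 *: (double_form2 qs s (t2 ∙ u2) : k^o).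
Proof.
have bl := double_form2_bil hX hY qs0.
have bl' : is_bilinear (double_form2 qs : X ⊗ Y -> X ⊗ Y -> k^o) := bl.
have clP : is_linear (@cop k P : X ⊗ Y -> _) by exact: (is_coalg_cop_linear (dgbi_coalg hP)).
move: u; apply: tens_ext; [mlin..|] => a v.
move: s t; apply: (tens_hext2 gX gY gX gY); [mlin..|].
move=> _ _ _ _ w y x z _ _ _ _.
rewrite (tsum_double_forml hX hY qs0); [|mlin..].
rewrite (tsum_double_forml hX hY qs0); [|mlin..].
transitivity (\tsum_(y1, y2 <- cop y) \tsum_(a1, a2 <- cop a)
  ((cou w * cou v * (qs y1 x * qs z a1 * qs y2 a2) : k) : k^o)).
  apply: eq_tsum => y1 y2.
  transitivity (\tsum_(x1, x2 <- cop x) cou x2 *: (qs y1 x1 * (cou w * qs (y2 ∙ z) a * cou v) : k^o)).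
    apply: eq_tsum => x1 x2; rewrite (double_form2_mull hX hY qs0) -[LHS]/(_ * _) -[RHS]/(_ * (_ * _)).
    by ring.
  rewrite (counitr (F := fun x => (qs y1 x * (cou w * qs (y2 ∙ z) a * cou v) : k^o))); [|mlin..].
  rewrite inv_pairing_mull.
  rewrite (lin_tsumE (g := fun b : k^o => (qs y1 x * (cou w * b * cou v) : k^o))); [|mlin..].
  by apply: eq_tsum => a1 a2; ring.
rewrite exchange_tsum [RHS]exchange_tsum; apply: eq_tsum => a1 a2.
transitivity (\tsum_(z1, z2 <- cop z) cou z2 *: (qs z1 a1 * (cou w * qs y (a2 ∙ x) * cou v) : k^o));
  last first.
  apply: eq_tsum => z1 z2; rewrite (double_form2_mulr hX hY qs0) -[RHS]/(_ * _) -[LHS]/(_ * (_ * _)).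
  by ring.
rewrite (counitr (F := fun z => (qs z a1 * (cou w * qs y (a2 ∙ x) * cou v) : k^o))); [|mlin..].
rewrite inv_pairing_mulr.
rewrite (lin_tsumE (g := fun b : k^o => (qs z a1 * (cou w * b * cou v) : k^o))); [|mlin..].
by apply: eq_tsum => y1 y2; ring.
Qed.

(** Here the common value is ε(w) ε(v) q(y2, x) q(z, a2) q(y1, a1). *)
Let inv_assoc_form (s t u : P) :
  \tsum_(s1, s2 <- cop s) \tsum_(t1, t2 <- cop t)
    double_form2 q s2 t2 *: (double_form2 q (s1 ∙ t1) u : k^o) =
  \tsum_(t1, t2 <- cop t) \tsum_(u1, u2 <- cop u)
    double_form2 q t2 u2 *: (double_form2 q s (t1 ∙ u1) : k^o).
Proof.
have bl := double_form2_bil hX hY q0.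
have bl' : is_bilinear (double_form2 q : X ⊗ Y -> X ⊗ Y -> k^o) := bl.
have clP : is_linear (@cop k P : X ⊗ Y -> _) by exact: (is_coalg_cop_linear (dgbi_coalg hP)).
move: u; apply: tens_ext; [mlin..|] => a v.
move: s t; apply: (tens_hext2 gX gY gX gY); [mlin..|].
move=> _ _ _ _ w y x z _ _ _ _.
rewrite (tsum_double_formr hX hY q0); [|mlin..].
rewrite (tsum_double_formr hX hY q0); [|mlin..].
transitivity (\tsum_(y1, y2 <- cop y) \tsum_(a1, a2 <- cop a)
  ((cou w * cou v * (q y2 x * q z a2 * q y1 a1) : k) : k^o)).
  apply: eq_tsum => y1 y2.
  transitivity (\tsum_(x1, x2 <- cop x) cou x1 *: (q y2 x2 * (cou w * q (y1 ∙ z) a * cou v) : k^o)).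
    apply: eq_tsum => x1 x2; rewrite (double_form2_mull hX hY q0) -[LHS]/(_ * _) -[RHS]/(_ * (_ * _)).
    by ring.
  rewrite (counitl (F := fun x => (q y2 x * (cou w * q (y1 ∙ z) a * cou v) : k^o))); [|mlin..].
  rewrite (deg0_pairing_mull hq).
  rewrite (lin_tsumE (g := fun b : k^o => (q y2 x * (cou w * b * cou v) : k^o))); [|mlin..].
  by apply: eq_tsum => a1 a2; ring.
rewrite exchange_tsum [RHS]exchange_tsum; apply: eq_tsum => a1 a2.
transitivity (\tsum_(z1, z2 <- cop z) cou z1 *: (q z2 a2 * (cou w * q y (a1 ∙ x) * cou v) : k^o));
  last first.
  apply: eq_tsum => z1 z2; rewrite (double_form2_mulr hX hY q0) -[RHS]/(_ * _) -[LHS]/(_ * (_ * _)).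
  by ring.
rewrite (counitl (F := fun z => (q z a2 * (cou w * q y (a1 ∙ x) * cou v) : k^o))); [|mlin..].
rewrite (deg0_pairing_mulr hq).
rewrite (lin_tsumE (g := fun b : k^o => (q z a2 * (cou w * b * cou v) : k^o))); [|mlin..].
by apply: eq_tsum => y1 y2; ring.
Qed.

Let form_one r : deg0_bilinear r -> (forall x, r (aone Y) x = cou x) ->
  (forall y, r y (aone X) = cou y) -> forall s : P,
  double_form r (aone P ⊗ s) = cou s /\ double_form r (s ⊗ aone P) = cou s.
Proof.
move=> hr r1 r1' s; have bl := double_form2_bil hX hY hr.
have bl' : is_bilinear (double_form2 r : X ⊗ Y -> X ⊗ Y -> k^o) := bl.
have cX := dgbi_cou_one hX; have cY := dgbi_cou_one hY.
have clP : is_linear (@cou k P : X ⊗ Y -> k^o) by exact: (is_coalg_cou_linear (dgbi_coalg hP)).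
rewrite !(double_formE hX hY hr); split.
  move: s; apply: (tens_ext (f := fun s : X ⊗ Y => (double_form2 r (aone X ⊗ aone Y) s : k^o))
    (g := fun s => @cou k P s : k^o)); [mlin..|] => a b.
  by rewrite (double_form2E hX hY hr) r1 cX mul1r -[RHS]/(ext_double_cou _) stens_couE; [|mlin..].
move: s; apply: (tens_ext (f := fun s : X ⊗ Y => (double_form2 r s (aone X ⊗ aone Y) : k^o))
  (g := fun s => @cou k P s : k^o)); [mlin..|] => a b.
by rewrite (double_form2E hX hY hr) r1' cY mulr1 -[RHS]/(ext_double_cou _) stens_couE; [|mlin..].
Qed.

Lemma double_cocycle : @is_cocycle k P (double_form qs) (double_form q).
Proof.
split.
- exact: double_form_deg0.
- exact: double_form_deg0.
- exact: conv_form inv_pairingl.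
- exact: conv_form inv_pairingr.
- move=> s t u; have := assoc_form s t u; rewrite -/(double_form2 _).
  under eq_tsum => s1 s2 do under eq_tsum => t1 t2 do rewrite -!(double_formE hX hY qs0).
  by under [in RHS]eq_tsum => t1 t2 do under eq_tsum => u1 u2 do rewrite -!(double_formE hX hY qs0).
- move=> s t u; have := inv_assoc_form s t u.
  under eq_tsum => s1 s2 do under eq_tsum => t1 t2 do rewrite -!(double_formE hX hY q0).
  by under [in RHS]eq_tsum => t1 t2 do under eq_tsum => u1 u2 do rewrite -!(double_formE hX hY q0).
- by move=> s; have [] := form_one qs0 inv_pairing_onel inv_pairing_oner s.
- by move=> s; have [] := form_one qs0 inv_pairing_onel inv_pairing_oner s.
- by move=> s; have [] := form_one q0 (deg0_pairing_onel hq) (deg0_pairing_oner hq) s.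
- by move=> s; have [] := form_one q0 (deg0_pairing_onel hq) (deg0_pairing_oner hq) s.
Qed.

End PairingCocycle.

(** * The exterior double as a twist *)

Section ExteriorDouble.
Variables (k : fieldType) (A H : bialg k) (OA OH : dgbialg k).
Variables (iA : A -> OA) (iH : H -> OH) (SOA : OA -> OA) (SOH : OH -> OH).
Variable p : H -> A -> k.
Local Notation q := (extend_pairing iA iH p).
Local Notation qs := (inv_pairing SOH q).
Local Notation P := (stens (sop OA) OH).
Hypotheses (hX : is_dgbi OA) (hY : is_dgbi OH).
Hypotheses (hSX : is_antipode SOA) (hSY : is_antipode SOH).
Hypothesis hq : deg0_pairing SOA SOH q.

Let gX := dgbi_grading hX.
Let gY := dgbi_grading hY.
Let q0 := deg0_pairing_bil hq.
Let qs0 := inv_pairing_deg0 hY hSY hq.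
Let qsB := deg0_bil qs0.
Let hP : is_dgbi P := stens_dgbi (sop_dgbi hX) hY.
Let hg := double_cocycle hX hY hSX hSY hq.

Lemma ext_double_mulE j i l (w t : OA) (y z : OH) :
  homog (@gpr k OA) i w -> homog (@gpr k OH) j y -> homog (@gpr k OA) l t ->
  ext_double_mul iA iH SOH p (w ⊗ y) (t ⊗ z) = (-1) ^+ ((j + i) * l) *:
    \tsum_(y1, y23 <- cop y) \tsum_(y2, y3 <- cop y23)
    \tsum_(t1, t23 <- cop t) \tsum_(t2, t3 <- cop t23)
      (qs y1 t1 * q y3 t3) *: ((t2 ∙ w) ⊗ (y2 ∙ z)).
Proof.
move=> hw hy ht; have qsB' : is_bilinear ((fun y x => q (SOH y) x) : OH -> OA -> k^o) := qsB.
rewrite /ext_double_mul tsum_tens; [|mlin..].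
rewrite tsum_tens; [|mlin..].
hsum_at gX hw.
hsum_at gY hy.
by hsum_at gX ht.
Qed.

Lemma ext_double_mul_bil : is_bilinear (ext_double_mul iA iH SOH p).
Proof.
have qsB' : is_bilinear ((fun y x => q (SOH y) x) : OH -> OA -> k^o) := qsB.
by rewrite /ext_double_mul; mlin.
Qed.

(** The pairings force the outer legs of y and t into degree 0, so |y2| = |y| and |t2| = |t|. The
    sign (-1)^((|y|+|w|)|t|) then splits into (-1)^(|y2||t2|) from the super tensor product and
    (-1)^(|w||t2|) from the opposite product. *)
Lemma ext_double_mul_twist :
  ext_double_mul iA iH SOH p = @twist_mul k P (double_form qs) (double_form q).
Proof.
have eB := ext_double_mul_bil.
have tB : is_bilinear (@twist_mul k P (double_form qs) (double_form q)) := twist_mul_bil hP hg.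
have mB : is_bilinear (@amul k P) := mul_bil (dgbi_alg hP).
have rl := twist_rmulC_lin hP hg.
apply/funext => s; apply/funext => s'; move: s s'.
apply: (tens_hext2 gX gY gX gY); [exact: eB|exact: tB|] => i j l n w y t z hw hy ht hz.
rewrite (ext_double_mulE _ hw hy ht).
transitivity (\tsum_(y1, y23 <- cop y) \tsum_(t1, t23 <- cop t) qs y1 t1 *:
  @twist_rmulC k P (double_form q) ((w ⊗ y23 : P) ⊗ (t23 ⊗ z : P))); last first.
  rewrite (twist_mulE hP hg).
  rewrite -(tsum_double_forml hX hY qs0
    (F := fun s t : P => @twist_rmulC k P (double_form q) (s ⊗ t))); [|mlin..].
  by apply: eq_tsum => s1 s2; apply: eq_tsum => t1 t2; rewrite (double_formE hX hY qs0).
transitivity (\tsum_(y1, y23 <- cop y) \tsum_(t1, t23 <- cop t) qs y1 t1 *: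
  \tsum_(y2, y3 <- cop y23) \tsum_(t2, t3 <- cop t23) q y3 t3 *:
     @amul k P (w ⊗ y2) (t2 ⊗ z)); last first.
  apply: eq_tsum => y1 y23; apply: eq_tsum => t1 t23; congr (_ *: _).
  rewrite (twist_rmulE hP hg) -(tsum_double_formr hX hY q0 (F := @amul k P)) //.
  by apply: eq_tsum => s1 s2; apply: eq_tsum => t2 t3; rewrite (double_formE hX hY q0).
have [I [d [e [u [v [hu hv D E]]]]]] := cop_expand hY hy.
have [I' [d' [e' [u' [v' [hu' hv' D' E']]]]]] := cop_expand hX ht.
have mB' : is_bilinear (@amul k P : OA ⊗ OH -> OA ⊗ OH -> OA ⊗ OH) := mB.
rewrite !E; [|mlin..]; rewrite scaler_sumr; apply: eq_bigr => a _.
rewrite exchange_tsum !E'; [|mlin..]; rewrite scaler_sumr; apply: eq_bigr => a' _.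
case: (d a) (hu a) (D a) => [|m] hm.
  rewrite add0n => Dj; case: (d' a') (hu' a') (D' a') => [|m'] hm'.
    rewrite add0n => Dl.
    have [J [b [c [r [s [hr hs B F]]]]]] := cop_expand hY (hv a).
    have [J' [b' [c' [r' [s' [hr' hs' B' F']]]]]] := cop_expand hX (hv' a').
    rewrite !F; [|mlin..]; rewrite !scaler_sumr; apply: eq_bigr => o _.
    rewrite !F'; [|mlin..]; rewrite !scaler_sumr; apply: eq_bigr => o' _.
    rewrite [RHS]scalerA.
    case: (c o) (hs o) (B o) => [|f] hf; last by rewrite (deg0_bil_l q0 _ hf) !mulr0 !scale0r scaler0.
    case: (c' o') (hs' o') (B' o') => [|f'] hf'; last by rewrite (deg0_bil_r q0 _ hf') !mulr0 !scale0r scaler0.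
    rewrite !addn0 => B2 B1.
    have -> : @amul k P (w ⊗ r o) (r' o' ⊗ z) =
      (-1) ^+ (b o * b' o') *: (@amul k (sop OA) w (r' o') ⊗ (r o ∙ z)).
      exact: (stens_mulE (sop_dgbi hX) hY _ _ (hr o) (hr' o')).
    rewrite (sop_mulE hX hw (hr' o')) tensZl !scalerA Dj Dl B1 B2.
    congr (_ *: _); rewrite -mulrA -exprD [RHS]mulrC; congr (_ * _).
    parity.
  by rewrite (deg0_bil_r qs0 _ hm') scale0r [tsum _ _]tsum0 ?scaler0 // => x1 x2;
    rewrite tsum0 // => ? ?; rewrite mul0r scale0r.
by rewrite (deg0_bil_l qs0 _ hm) scale0r [tsum _ _]tsum0 ?scaler0 // => x1 x2;
    rewrite tsum0 // => ? ?; rewrite mul0r scale0r.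
Qed.

Lemma ext_double_dgbi : is_dgbi (ext_double iA iH SOH p).
Proof.
(* Apart from the product, the two structures agree by definition, since the super opposite changes
   neither grading, differential nor coalgebra. *)
have -> : ext_double iA iH SOH p = @twist k P (double_form qs) (double_form q).
  by rewrite /ext_double ext_double_mul_twist.
exact: twist_dgbi hP hg.
Qed.

End ExteriorDouble.

(** * The component of degree zero *)

Lemma bialg_alg (k : fieldType) (A : bialg k) : is_bialg A -> is_alg A.
Proof. by case. Qed.

Lemma bialg_coalg (k : fieldType) (A : bialg k) : is_bialg A -> is_coalg A.
Proof. by case. Qed.

#[global] Hint Resolve bialg_alg bialg_coalg is_hopf_bialg is_hopf_antipode : multilinear.

Section DegreeZeroPart.
Variables (k : fieldType) (A : bialg k) (X : dgbialg k) (i : A -> X).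
Variables (SA : A -> A) (S : X -> X).
Hypotheses (hA : is_hopf SA) (hB : is_strongly_bicovariant i S).
Local Notation hg := (homog (@gpr k X)).

Let hX : is_dgbi X := strongly_bicovariant_dgbi hB.
Let hE : is_exterior_algebra i := bicovariant_exterior hB.
Let gr := dgbi_grading hX.
Let il : is_linear i := exterior_linear hE.
Let hAb : is_bialg A := is_hopf_bialg hA.
Let hSA : is_antipode SA := is_hopf_antipode hA.

Lemma bicovariant_antipode : is_antipode S.
Proof. exact: super_hopf_antipode (bicovariant_super_hopf hB). Qed.
Let hS := bicovariant_antipode.

Lemma homog_incl a : hg 0 (i a).
Proof. by apply/(exterior_degree0 hE); exists a. Qed.

Lemma incl_deg0 x : i (deg0 i x) = gpr 0 x.
Proof.
have [a aE] : exists a, i a = gpr 0 x.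
  by have /(exterior_degree0 hE)[a ->] := homog_pr gr 0 x; exists a.
by rewrite /deg0; apply: (@xgetPex _ 0 [set a | i a = gpr 0 x]%classic); exists a.
Qed.

Lemma deg0K a : deg0 i (i a) = a.
Proof. by apply: (exterior_injective hE); rewrite incl_deg0; exact: homog_incl. Qed.

Lemma deg0_lin : is_linear (deg0 i).
Proof.
move=> c x y; apply: (exterior_injective hE).
by rewrite il !incl_deg0 (pr_lin gr).
Qed.
Hint Resolve deg0_lin : multilinear.

Lemma deg0_pos n x : hg n.+1 x -> deg0 i x = 0.
Proof.
move=> hx; apply: (exterior_injective hE).
by rewrite incl_deg0 (lin0 il) (pr_homog gr _ hx).
Qed.

Lemma deg0_homog0 x : hg 0 x -> i (deg0 i x) = x.
Proof. by rewrite incl_deg0. Qed.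

Lemma deg0_mul x y : deg0 i (x ∙ y) = deg0 i x ∙ deg0 i y.
Proof.
move: x y; apply: (homog_ext2 gr gr); [mlin..|] => m n x y hx hy.
apply: (exterior_injective hE); rewrite (exterior_mul hE) !incl_deg0.
rewrite (pr_homog gr _ hx) (pr_homog gr _ hy) (pr_homog gr _ (homog_mul hX hx hy)).
case: m hx => [|m] hx; first by rewrite add0n; case: eqP => //= _;
  rewrite (lin0 (_ : is_linear (fun y => x ∙ y))) //; mlin.
by rewrite addSn /= (lin0 (_ : is_linear (fun x => x ∙ _))) //; mlin.
Qed.

Lemma deg0_one : deg0 i (aone X) = aone A.
Proof. by rewrite -(exterior_one hE) deg0K. Qed.

Lemma tsum_cop_incl (U : lmodType k) (F : X -> X -> U) a : is_bilinear F ->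
  tsum F (cop (i a)) = \tsum_(a1, a2 <- cop a) F (i a1) (i a2).
Proof.
move=> FB; rewrite (bicovariant_cop0 hB) /tmap tsum_tsum //.
by apply: eq_tsum => b c; rewrite tsum_tens.
Qed.

(** The projection onto degree 0 is a map of coalgebras: if x has positive degree, then so has one
    leg of each homogeneous term of Δx. *)
Lemma tsum_cop_deg0 (U : lmodType k) (F : A -> A -> U) x : is_bilinear F ->
  tsum F (cop (deg0 i x)) = \tsum_(x1, x2 <- cop x) F (deg0 i x1) (deg0 i x2).
Proof.
move=> FB; move: x; apply: (homog_ext gr); [mlin..|] => -[|n] x hx.
  rewrite -{2}(deg0_homog0 hx) tsum_cop_incl; [|mlin..].
  by apply: eq_tsum => a b; rewrite !deg0K.
rewrite (deg0_pos hx) (lin0 (_ : is_linear (fun a => tsum F (cop a)))); [|mlin..].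
have [I [d [e [u [v [hu hv D E]]]]]] := cop_expand hX hx.
rewrite E; [|mlin..].
rewrite big1 // => j _; case: (d j) (hu j) (D j) => [|m] hm.
  rewrite add0n => Ej; have := hv j; rewrite -Ej => /deg0_pos ->.
  by rewrite (lin0 (_ : is_linear (F _))) //; mlin.
by rewrite (deg0_pos hm) (lin0 (_ : is_linear (fun a => F a _))) //; mlin.
Qed.

(** The counit of X restricted along i is a left counit of A, and a left counit equals a right
    one. *)
Lemma cou_incl a : cou (i a) = cou a.
Proof.
have cX := is_coalg_cou_linear (dgbi_coalg hX).
have ciA b : \tsum_(b1, b2 <- cop b) cou (i b1) *: b2 = b.
  apply: (exterior_injective hE); rewrite (lin_tsumE _ _ il).
  rewrite -[RHS](is_coalg_left_counit (dgbi_coalg hX) (i b)) tsum_cop_incl; [|mlin..].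
  by apply: eq_tsum => b1 b2; rewrite linZ.
transitivity (\tsum_(a1, a2 <- cop a) ((cou (i a1) * cou a2 : k) : k^o)).
  have /= <- := counitr (F := fun a : A => (cou (i a) : k^o)) a (is_bialg_coalg hAb) (lin_comp cX il).
  by apply: eq_tsumk => b c; exact: mulrC.
have cA := is_coalg_cou_linear (is_bialg_coalg hAb).
rewrite -[in RHS](ciA a) (lin_tsumE _ _ cA); apply: eq_tsumk => b c.
by rewrite (linZ _ _ cA).
Qed.

Lemma cou_deg0 x : cou (deg0 i x) = cou x.
Proof.
move: x; apply: (homog_ext (f := fun x => (cou (deg0 i x) : k^o)) gr); [mlin..|] => -[|n] x hx.
  by rewrite -[in RHS](deg0_homog0 hx) cou_incl.
by rewrite (deg0_pos hx) (dgbi_cou_degree hX hx) (lin0 (is_coalg_cou_linear (is_bialg_coalg hAb))).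
Qed.

(** Both sides are convolution inverse to i in Hom(A, X). *)
Lemma antipode_incl a : S (i a) = i (SA a).
Proof.
apply: (conv_unique (f := fun a => S (i a)) (e := i) (h := fun a => i (SA a))
  (is_bialg_coalg hAb) (dgbi_alg hX)); [mlin|mlin|mlin| |].
- move=> c; rewrite -[RHS]/(_ *: _) -(tsum_cop_incl (F := fun x y => S x ∙ y)); [|mlin..].
  by rewrite (is_antipode_left hS) cou_incl.
- move=> c; transitivity (i (\tsum_(c1, c2 <- cop c) c1 ∙ SA c2)).
    by rewrite (lin_tsumE _ _ il); apply: eq_tsum => b d; rewrite (exterior_mul hE).
  by rewrite (is_antipode_right hSA) (linZ _ _ il) (exterior_one hE).
Qed.

Lemma deg0_antipode_incl x : deg0 i (S x) = SA (deg0 i x).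
Proof.
move: x; apply: (homog_ext gr); [mlin..|] => -[|n] x hx.
  by rewrite -{1}(deg0_homog0 hx) antipode_incl deg0K.
by rewrite (deg0_pos hx) (deg0_pos (antipode_homog hX hS hx)) (lin0 (is_antipode_linear hSA)).
Qed.

End DegreeZeroPart.

(** * Extension of the pairing by zero *)

Section ExtendPairing.
Variables (k : fieldType) (A H : bialg k) (SA : A -> A) (SH : H -> H) (p : H -> A -> k).
Variables (OA OH : dgbialg k) (iA : A -> OA) (iH : H -> OH) (SOA : OA -> OA) (SOH : OH -> OH).
Hypotheses (hA : is_hopf SA) (hH : is_hopf SH) (hp : dually_paired SA SH p).
Hypotheses (hOA : is_strongly_bicovariant iA SOA) (hOH : is_strongly_bicovariant iH SOH).

(** The extension is the pullback of p along the projections onto degree 0, which respect products,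
    coproducts, counits and antipodes. *)
Lemma extend_pairing_deg0 : deg0_pairing SOA SOH (extend_pairing iA iH p).
Proof.
have pB := pairing_bilinear hp.
have lA := deg0_lin hOA; have lH := deg0_lin hOH.
rewrite /extend_pairing; split.
- split; first by mlin.
  + move=> n y x hy; rewrite (deg0_pos hOH hy).
    by apply: (lin0 (f := fun y => (p y _ : k^o))); mlin.
  + move=> n y x hx; rewrite (deg0_pos hOA hx).
    by apply: (lin0 (f := fun x => (p _ x : k^o))); mlin.
- move=> y z x; rewrite (deg0_mul hH hOH) (pairing_mull hp).
  by rewrite (tsum_cop_deg0 hA hOA (F := fun a b => (p _ a * p _ b : k^o))) //; mlin.
- move=> y x a; rewrite (deg0_mul hA hOA) (pairing_mulr hp).
  by rewrite (tsum_cop_deg0 hH hOH (F := fun a b => (p a _ * p b _ : k^o))) //; mlin.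
- by move=> x; rewrite (deg0_one hOH) (pairing_onel hp) (cou_deg0 hA hOA).
- by move=> y; rewrite (deg0_one hOA) (pairing_oner hp) (cou_deg0 hH hOH).
- move=> y x; rewrite (deg0_antipode_incl hH hOH) (deg0_antipode_incl hA hOA).
  exact: (pairing_antipode hp).
Qed.

End ExtendPairing.

(** * Convolution inverses *)

Section ConvolutionInverse.
Variables (k : fieldType) (X : dgbialg k).
Hypothesis hX : is_dgbi X.
Local Notation hg := (homog (@gpr k X)).

Let gr := dgbi_grading hX.
Let hC := dgbi_coalg hX.

Definition conv (f g : X -> X) (x : X) : X := \tsum_(x1, x2 <- cop x) f x1 ∙ g x2.
Definition conv_one (x : X) : X := cou x *: aone X.

Lemma conv_lin f g : is_linear f -> is_linear g -> is_linear (conv f g).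
Proof. by move=> fl gl; rewrite /conv; mlin. Qed.

Lemma conv_one_lin : is_linear conv_one.
Proof. by rewrite /conv_one; mlin. Qed.

Lemma convA f g h x : is_linear f -> is_linear g -> is_linear h ->
  conv (conv f g) h x = conv f (conv g h) x.
Proof.
move=> fl gl hl; transitivity (\tsum_(x12, x3 <- cop x) \tsum_(x1, x2 <- cop x12)
    f x1 ∙ (g x2 ∙ h x3)).
  apply: eq_tsum => x12 x3; rewrite (lin_tsumE (g := fun y => y ∙ h x3)); [|mlin..].
  by apply: eq_tsum => x1 x2; rewrite (dg_mulA hX).
rewrite (coassoc x hC); [|mlin..].
apply: eq_tsum => x1 x23; rewrite (lin_tsumE (g := fun y => f x1 ∙ y)) //; mlin.
Qed.

Lemma convr1 f x : is_linear f -> conv f conv_one x = f x.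
Proof.
move=> fl; rewrite -[RHS](counitr x hC fl); apply: eq_tsum => x1 x2.
by rewrite /conv_one (mulZr hX) (dg_mulr1 hX).
Qed.

(* Takeuchi: f is inverted by the geometric series of N = 1 - j * f, which is  *)
(* finite on each element since N vanishes in degree 0.                        *)
Lemma conv_left_inverse (f j : X -> X) : is_linear f -> is_linear j ->
  (forall x, hg 0 x -> conv j f x = conv_one x) ->
  exists g : X -> X, [/\ is_linear g, forall x, conv g f x = conv_one x
    & forall x, hg 0 x -> g x = j x].
Proof.
move=> fl jl jf0; have o := conv_one_lin.
pose N x := conv_one x - conv j f x.
have Nl : is_linear N by rewrite /N; have := conv_lin jl fl; mlin.
have N0 x : hg 0 x -> N x = 0 by move=> /jf0; rewrite /N => ->; rewrite subrr.
(* E n is the convolution power N^n and K n is N^n * j. Since N vanishes in degree 0, both vanish in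
   degrees below n, and K n * f = N^n * (1 - N) telescopes. *)
pose K := fix K n := if n is n.+1 then conv N (K n) else j.
pose E := fix E n := if n is n.+1 then conv N (E n) else conv_one.
have Kl n : is_linear (K n) by elim: n => //= n IH; exact: conv_lin.
have El n : is_linear (E n) by elim: n => //= n IH; exact: conv_lin.
have van h n : is_linear h -> (forall m x, (m < n)%N -> hg m x -> h x = 0) ->
    forall m x, (m < n.+1)%N -> hg m x -> conv N h x = 0.
  move=> hl IH m x mn hx.
  have [I [d [e [u [v [hu hv D F]]]]]] := cop_expand hX hx.
  rewrite /conv F ?big1 //; [|mlin..].
  move=> i _; case: (d i) (hu i) (D i) => [|a] ha.
    by rewrite (N0 _ ha) (lin0 (_ : is_linear (fun y => y ∙ h (v i)))) //; mlin.
  move=> ma; rewrite (IH (e i) (v i)) //; last first.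
    by move: mn; rewrite ma addSn ltnS; apply: leq_trans; rewrite ltnS leq_addl.
  by rewrite (lin0 (_ : is_linear (fun y => N (u i) ∙ y))) //; mlin.
have K0 n : forall m x, (m < n)%N -> hg m x -> K n x = 0.
  elim: n => [m x|n IH]; first by rewrite ltn0.
  exact: (van (K n) n (Kl n) IH).
have E0 n : forall m x, (m < n)%N -> hg m x -> E n x = 0.
  elim: n => [m x|n IH]; first by rewrite ltn0.
  exact: (van (E n) n (El n) IH).
have KE n x : conv (K n) f x = E n x - E n.+1 x.
  elim: n x => [|n IH] x /=; first by rewrite (convr1 _ Nl) /N subKr.
  rewrite convA //; transitivity (conv N (fun x => E n x - E n.+1 x) x).
    by apply: eq_tsum => a b; rewrite IH.
  rewrite {1}/conv; transitivity (\tsum_(x1, x2 <- cop x) (N x1 ∙ E n x2 - N x1 ∙ E n.+1 x2)).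
    apply: eq_tsum => a b; rewrite (mulDr hX) -scaleN1r (mulZr hX) scaleN1r //.
  rewrite -[RHS]/(tsum _ _ - tsum _ _) -[in RHS]scaleN1r tsumZ tsumD.
  by apply: eq_tsum => a b; rewrite scaleN1r.
(* In degree m the series stops after the term with n = m. *)
pose g x := \hsum_(x' @ m <- x) \sum_(n < m.+1) K n x'.
have sl m : is_linear (fun x : X => \sum_(n < m.+1) K n x).
  by apply: lin_sum => i; exact: Kl.
have gl : is_linear g by rewrite /g; mlin.
have gE m x : hg m x -> g x = \sum_(n < m.+1) K n x.
  by move=> hx; rewrite /g (hsum_homog gr hx).
exists g; split=> //; last first.
  by move=> x hx; rewrite (gE _ _ hx) big_ord_recl big_ord0 addr0.
apply: (homog_ext gr) => [||M x hx]; [exact: conv_lin|exact: o|].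
have [I [d [e [u [v [hu hv D F]]]]]] := cop_expand hX hx.
transitivity (\sum_(n < M.+1) conv (K n) f x).
  rewrite /conv F; [|mlin..].
  transitivity (\sum_(n < M.+1) \sum_i K n (u i) ∙ f (v i)); last first.
    by apply: eq_bigr => n _; have Kn := Kl n; rewrite F //; mlin.
  rewrite exchange_big; apply: eq_bigr => i _.
  rewrite (gE _ _ (hu i)) -(lin_sumE (f := fun y => y ∙ f (v i))); [|mlin..].
  congr (_ ∙ _); rewrite (big_ord_widen M.+1 (fun n => K n (u i))) ?ltnS ?(D i) ?leq_addr //.
  rewrite big_mkcond; apply: eq_bigr => n _; case: ltnP => // dn.
  by rewrite (K0 _ _ _ _ (hu i)).
under eq_bigr => n _ do rewrite KE.
rewrite -(big_mkord xpredT (fun n => E n x - E n.+1 x)).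
rewrite (eq_bigr (fun n => - (E n.+1 x - E n x))) => [|n _]; last by rewrite opprB.
by rewrite sumrN telescope_sumr // (E0 M.+1 M) // sub0r opprK.
Qed.

Lemma graded_antipode (j : X -> X) : is_linear j ->
  (forall x, hg 0 x -> conv j id x = conv_one x) ->
  (forall x, hg 0 x -> conv id j x = conv_one x) ->
  exists S : X -> X, is_antipode S.
Proof.
move=> jl jid idj; have il : is_linear (id : X -> X) by exact: lin_id.
have [S [Sl Sid S0]] := conv_left_inverse il jl jid.
(* S agrees with j in degree 0, where id * j = 1, so S has a left inverse T in turn. From T * S = 1
   = S * id follows T = id, so S inverts id on both sides. *)
have [|T [Tl TS T0]] := conv_left_inverse Sl il.
  move=> x hx; rewrite -(idj _ hx).
  have [I [d [e [u [v [hu hv D F]]]]]] := cop_expand hX hx.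
  rewrite /conv !F; [|by mlin..]; apply: eq_bigr => i _.
  have [d0 e0] : d i = 0%N /\ e i = 0%N.
    by move: (D i) => /esym/eqP; rewrite addn_eq0 => /andP[/eqP-> /eqP->].
  by rewrite (S0 _) // -{1}e0; exact: hv.
exists S; split=> [//|x|x]; first exact: Sid.
have Tid y : T y = y.
  have H := conv_unique (f := T) (e := S) (h := id) hC (dgbi_alg hX) Tl Sl il TS Sid.
  exact: H.
by rewrite -[RHS]TS; apply: eq_tsum => a b; rewrite Tid.
Qed.

End ConvolutionInverse.

(** * Bialgebras embedded in degree zero *)

Section SubBialgebra.
Variables (k : fieldType) (B : bialg k) (X : dgbialg k) (i : B -> X) (r : X -> B).
Hypotheses (hX : is_dgbi X) (il : is_linear i) (rl : is_linear r) (ri : cancel i r).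
Hypothesis i0 : forall b, homog (@gpr k X) 0 (i b).
Hypothesis iM : forall a b, i (a ∙ b) = i a ∙ i b.
Hypothesis i1 : i (aone B) = aone X.
Hypothesis icop : forall b, cop (i b) = tmap i i (cop b).
Hypothesis icou : forall b, cou (i b) = cou b.
Hypotheses (mB : is_bilinear (@amul k B)) (copl : is_linear (@cop k B)).
Hypothesis coul : is_linear (@cou k B : B -> k^o).

Let gr := dgbi_grading hX.

Lemma tsum_cop_sub (U : lmodType k) (F : X -> X -> U) b : is_bilinear F ->
  tsum F (cop (i b)) = \tsum_(b1, b2 <- cop b) F (i b1) (i b2).
Proof.
move=> FB; rewrite icop /tmap tsum_tsum //.
by apply: eq_tsum => a c; rewrite tsum_tens.
Qed.

Lemma tmap_cancel (V W V' W' : lmodType k) (f : V -> V') (g : W -> W')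
  (f' : V' -> V) (g' : W' -> W) : is_linear f -> is_linear g -> is_linear f' -> is_linear g' ->
  cancel f f' -> cancel g g' -> cancel (tmap f g) (tmap f' g').
Proof.
move=> fl gl fl' gl' ff gg t; rewrite /tmap tsum_tsum; [|mlin..].
rewrite -[RHS]tsum_eta; apply: eq_tsum => a b; rewrite tsum_tens ?ff ?gg //; mlin.
Qed.

Lemma tmap_lin (V W V' W' : lmodType k) (f : V -> V') (g : W -> W') :
  is_linear f -> is_linear g -> is_linear (tmap f g).
Proof. by move=> fl gl; rewrite /tmap; mlin. Qed.

Lemma tmap_tens (V W V' W' : lmodType k) (f : V -> V') (g : W -> W') v w :
  is_linear f -> is_linear g -> tmap f g (v ⊗ w) = f v ⊗ g w.
Proof. by move=> fl gl; rewrite /tmap tsum_tens //; mlin. Qed.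

Lemma sub_alg : is_alg B.
Proof.
have inj := can_inj ri.
split=> // [a b c|a|a]; apply: inj; rewrite ?iM ?i1.
- exact: (dg_mulA hX).
- exact: (dg_mul1 hX).
- exact: (dg_mulr1 hX).
Qed.

Lemma sub_coalg : is_coalg B.
Proof.
have inj := can_inj ri; have tl := tmap_lin il il; have tl' := tmap_lin rl rl.
split=> // x.
(* Coassociativity is checked after embedding B ⊗ (B ⊗ B) in the threefold tensor power of X; the
   retraction r makes this map injective. *)
- pose J := tmap i (tmap i i).
  have Jl : is_linear J by exact: tmap_lin.
  have Jinj : injective J by apply: (can_inj (g := tmap r (tmap r r))); do !apply: tmap_cancel.
  apply: Jinj; rewrite !(lin_tsumE _ _ Jl).
  transitivity (\tsum_(x1, x2 <- cop (i x)) \tsum_(x11, x12 <- cop x1) x11 ⊗ (x12 ⊗ x2)).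
    rewrite tsum_cop_sub; [|mlin..].
    apply: eq_tsum => a b; rewrite (lin_tsumE _ _ Jl) tsum_cop_sub; [|mlin..].
    by apply: eq_tsum => c d; rewrite /J !tmap_tens.
  rewrite (is_coalg_coassoc (dgbi_coalg hX)) tsum_cop_sub; [|mlin..].
  by apply: eq_tsum => a b; rewrite /J !tmap_tens // icop.
- apply: inj; rewrite (lin_tsumE _ _ il).
  rewrite -[RHS](is_coalg_left_counit (dgbi_coalg hX)) tsum_cop_sub; [|mlin..].
  by apply: eq_tsum => a b; rewrite icou linZ.
- apply: inj; rewrite (lin_tsumE _ _ il).
  rewrite -[RHS](is_coalg_right_counit (dgbi_coalg hX)) tsum_cop_sub; [|mlin..].
  by apply: eq_tsum => a b; rewrite icou linZ.
Qed.

(** The image of i lies in degree 0, where the super product on X ⊗ X has no signs, so each axiom is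
    the one of X pulled back along an injection. *)
Lemma sub_bialg : is_bialg B.
Proof.
have inj2 : injective (tmap i i) by apply: (can_inj (g := tmap r r)); exact: tmap_cancel.
have tl := tmap_lin il il.
split; [exact: sub_alg|exact: sub_coalg|move=> x y|..].
- apply: inj2; rewrite -icop iM (dgbi_cop_mul hX) /super_tensor_mul tsum_cop_sub; [|mlin..].
  rewrite /tensor_mul (lin_tsumE _ _ tl); apply: eq_tsum => a b.
  rewrite tsum_cop_sub; [|mlin..].
  rewrite (lin_tsumE _ _ tl); apply: eq_tsum => c d.
  hsum_at gr (i0 b).
  hsum_at gr (i0 c).
  by rewrite scale1r tmap_tens // !iM.
- by apply: inj2; rewrite -icop tmap_tens // i1 (dgbi_cop_one hX).
- by move=> x y; rewrite -!icou iM (dgbi_cou_mul hX).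
- by rewrite -icou i1 (dgbi_cou_one hX).
Qed.

End SubBialgebra.

(** * The generalised quantum double *)

#[global] Hint Resolve deg0_lin : multilinear.

Section DoubleStructure.
Variables (k : fieldType) (A H : bialg k).
Variables (SA : A -> A) (SH : H -> H) (p : H -> A -> k).
Variables (OA OH : dgbialg k) (iA : A -> OA) (iH : H -> OH).
Variables (SOA : OA -> OA) (SOH : OH -> OH).
Hypotheses (hA : is_hopf SA) (hH : is_hopf SH) (hp : dually_paired SA SH p).
Hypotheses (hOA : is_strongly_bicovariant iA SOA) (hOH : is_strongly_bicovariant iH SOH).
Local Notation q := (extend_pairing iA iH p).
Local Notation qs := (inv_pairing SOH q).
Local Notation D := (quantum_double SH p).
Local Notation OD := (ext_double iA iH SOH p).
Local Notation hgA := (homog (@gpr k OA)).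
Local Notation hgH := (homog (@gpr k OH)).
Local Notation hg := (homog (@gpr k OD)).

Let hX := strongly_bicovariant_dgbi hOA.
Let hY := strongly_bicovariant_dgbi hOH.
Let hSX := bicovariant_antipode hOA.
Let hSY := bicovariant_antipode hOH.
Let hq := extend_pairing_deg0 hA hH hp hOA hOH.
Let hEA := bicovariant_exterior hOA.
Let hEH := bicovariant_exterior hOH.
Let iAl : is_linear iA := exterior_linear hEA.
Let iHl : is_linear iH := exterior_linear hEH.
Let gX := dgbi_grading hX.
Let gY := dgbi_grading hY.
Let q0 := deg0_pairing_bil hq.
Let qs0 := inv_pairing_deg0 hY hSY hq.
Let pB := pairing_bilinear hp.
Let SAl : is_linear SA := is_antipode_linear (is_hopf_antipode hA).

Lemma ext_double_is_dgbi : is_dgbi OD.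
Proof. exact: ext_double_dgbi hX hY hSX hSY hq. Qed.
Let hOD := ext_double_is_dgbi.
Let gOD : is_grading (@gpr k OD) := dgbi_grading hOD.

(** Pairing with 1 gives the counit, so the exchange in the middle is trivial and only the opposite
    product of Ω(A) remains. *)
Lemma ext_double_mull1 i l (w t : OA) (z : OH) : hgA i w -> hgA l t ->
  @amul k OD (w ⊗ aone OH) (t ⊗ z) = (-1) ^+ (i * l) *: ((t ∙ w) ⊗ z).
Proof.
move=> hw ht; rewrite -[LHS]/(ext_double_mul iA iH SOH p _ _).
rewrite (ext_double_mulE hX hY hSY hq _ hw (homog_one hY) ht) add0n; congr (_ *: _).
rewrite (tsum_cop_one hY); [|mlin..].
rewrite (tsum_cop_one hY); [|mlin..].
transitivity (\tsum_(t1, t2 <- cop t) cou t1 *: (t2 ∙ w ⊗ z)); last first.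
  by rewrite (counitl (F := fun t => t ∙ w ⊗ z)); [|mlin..].
apply: eq_tsum => t1 t23.
transitivity (\tsum_(t2, t3 <- cop t23) cou t3 *: (cou t1 *: (t2 ∙ w ⊗ z))); last first.
  by rewrite (counitr (F := fun t => cou t1 *: (t ∙ w ⊗ z))); [|mlin..].
apply: eq_tsum => t2 t3; rewrite (inv_pairing_onel hY hSY hq) (deg0_pairing_onel hq).
by rewrite (dg_mul1 hY) scalerA mulrC.
Qed.

Lemma ext_double_mulr1 (w : OA) (y z : OH) : @amul k OD (w ⊗ y) (aone OA ⊗ z) = w ⊗ (y ∙ z).
Proof.
rewrite -[LHS]/(ext_double_mul iA iH SOH p _ _).
have eB := ext_double_mul_bil hX hY hSY hq.
move: w y; apply: (homog_ext2 (f := fun (w : OA) (y : OH) =>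
  ext_double_mul iA iH SOH p (w ⊗ y) (aone OA ⊗ z)) gX gY); [mlin..|].
move=> i j w y hw hy.
rewrite (ext_double_mulE hX hY hSY hq _ hw hy (homog_one hX)) muln0 scale1r.
transitivity (\tsum_(y1, y2 <- cop y) cou y1 *: (w ⊗ (y2 ∙ z))); last first.
  by rewrite (counitl (F := fun y => w ⊗ (y ∙ z))); [|mlin..].
apply: eq_tsum => y1 y23.
transitivity (\tsum_(y2, y3 <- cop y23) cou y3 *: (cou y1 *: (w ⊗ (y2 ∙ z)))); last first.
  by rewrite (counitr (F := fun y => cou y1 *: (w ⊗ (y ∙ z)))); [|mlin..].
apply: eq_tsum => y2 y3.
rewrite (tsum_cop_one hX); [|mlin..].
rewrite (tsum_cop_one hX); [|mlin..].
rewrite (inv_pairing_oner hY hSY hq) (deg0_pairing_oner hq).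
by rewrite (dg_mul1 hX) scalerA mulrC.
Qed.

Local Notation iD := (tmap iA iH : D -> OD).
Local Notation rD := (tmap (deg0 iA) (deg0 iH) : OD -> D).

Lemma double_incl_lin : is_linear iD.
Proof. exact: tmap_lin. Qed.
Hint Resolve double_incl_lin : multilinear.

Lemma double_inclE a h : iD (a ⊗ h) = iA a ⊗ iH h.
Proof. exact: tmap_tens. Qed.

Lemma double_incl_cancel : cancel iD rD.
Proof.
by apply: tmap_cancel => //; [exact: (deg0_lin hOA)|exact: (deg0_lin hOH)|exact: (deg0K hOA)|exact: (deg0K hOH)].
Qed.

Lemma double_retract_lin : is_linear rD.
Proof. by apply: tmap_lin; [exact: (deg0_lin hOA)|exact: (deg0_lin hOH)]. Qed.

Lemma homog_double_incl x : hg 0 (iD x).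
Proof.
rewrite /= /tmap; apply: (homog_sum gOD) => -[a h] _ /=.
exact: (homog_tens gX gY (homog_incl hOA a) (homog_incl hOH h)).
Qed.

Lemma double_mul_bil : is_bilinear (@double_mul k A H SH p).
Proof.
have pB' : is_bilinear (p : H -> A -> k^o) := pB.
have hAb := is_hopf_bialg hA; have hHb := is_hopf_bialg hH.
by rewrite /double_mul; mlin.
Qed.
Hint Resolve double_mul_bil : multilinear.

Lemma double_incl_mul x y : iD (x ∙ y) = iD x ∙ iD y.
Proof.
have pB' : is_bilinear (p : H -> A -> k^o) := pB.
have hAb := is_hopf_bialg hA; have hHb := is_hopf_bialg hH.
have mB : is_bilinear (@amul k OD) := mul_bil (dgbi_alg hOD).
have mB' : is_bilinear (@amul k D : A ⊗ H -> A ⊗ H -> A ⊗ H) := double_mul_bil.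
have iDl := double_incl_lin; have iDl' : is_linear (tmap iA iH : A ⊗ H -> OA ⊗ OH) := iDl.
suff E (t : A ⊗ H) : forall s : A ⊗ H,
    iD (@amul k D s t) = @amul k OD (tmap iA iH s) (tmap iA iH t) by exact: E.
apply: tens_ext; [mlin..|] => a h; move: t; apply: tens_ext; [mlin..|] => b g.
rewrite !double_inclE -[RHS]/(ext_double_mul iA iH SOH p _ _).
rewrite (ext_double_mulE hX hY hSY hq _ (homog_incl hOA a) (homog_incl hOH h) (homog_incl hOA b)) scale1r.
rewrite -[LHS]/(iD (double_mul SH p (a ⊗ h) (b ⊗ g))) /double_mul.
rewrite tsum_tens; [|mlin..].
rewrite tsum_tens; [|mlin..].
rewrite (tsum_cop_incl hOH); [|mlin..].
rewrite (lin_tsumE _ _ iDl'); apply: eq_tsum => h1 h23.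
rewrite (tsum_cop_incl hOH); [|mlin..].
rewrite (lin_tsumE _ _ iDl'); apply: eq_tsum => h2 h3.
rewrite (tsum_cop_incl hOA); [|mlin..].
rewrite (lin_tsumE _ _ iDl'); apply: eq_tsum => b1 b23.
rewrite (tsum_cop_incl hOA); [|mlin..].
rewrite (lin_tsumE _ _ iDl'); apply: eq_tsum => b2 b3.
rewrite (linZ _ _ iDl') -[tmap _ _ _]/(iD _) double_inclE (exterior_mul hEA) (exterior_mul hEH).
rewrite /inv_pairing /extend_pairing (antipode_incl hH hOH).
by rewrite !(deg0K hOA) !(deg0K hOH).
Qed.

Lemma double_incl_one : iD (aone D) = aone OD.
Proof. by rewrite -[aone D]/(aone A ⊗ aone H) double_inclE (exterior_one hEA) (exterior_one hEH). Qed.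

Lemma double_incl_cop x : cop (iD x) = tmap iD iD (cop x).
Proof.
have hAb := is_hopf_bialg hA; have hHb := is_hopf_bialg hH.
have cl : is_linear (@cop k OD) := is_coalg_cop_linear (dgbi_coalg hOD).
have iDl := double_incl_lin; have iDl' : is_linear (tmap iA iH : A ⊗ H -> OA ⊗ OH) := iDl.
have tl := tmap_lin iDl iDl.
have dl : is_linear (@double_cop k A H) by rewrite /double_cop; mlin.
have el := stens_cop_lin hX hY.
suff E (t : A ⊗ H) : ext_double_cop (tmap iA iH t) = tmap iD iD (double_cop t) by exact: E.
move: t; apply: tens_ext; [mlin..|] => a h.
rewrite -[tmap iA iH _]/(iD _) double_inclE -[LHS]tsum_eta (tsum_stens_cop hX hY); [|mlin..].
rewrite (tsum_cop_incl hOA); [|mlin..].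
rewrite /double_cop tsum_tens; [|mlin..].
rewrite (lin_tsumE _ _ tl); apply: eq_tsum => a1 a2.
rewrite (tsum_cop_incl hOH); [|mlin..].
rewrite (lin_tsumE _ _ tl); apply: eq_tsum => h1 h2.
hsum_at gX (homog_incl hOA a2).
hsum_at gY (homog_incl hOH h1).
by rewrite scale1r (tmap_tens _ _ iDl iDl) !double_inclE.
Qed.

Lemma double_incl_cou x : cou (iD x) = cou x.
Proof.
have hAb := is_hopf_bialg hA; have hHb := is_hopf_bialg hH.
have iDl := double_incl_lin; have iDl' : is_linear (tmap iA iH : A ⊗ H -> OA ⊗ OH) := iDl.
have dl : is_linear (@double_cou k A H : A ⊗ H -> k^o) by rewrite /double_cou; mlin.
have el := stens_cou_lin hX hY.
suff E (t : A ⊗ H) : ext_double_cou (tmap iA iH t) = double_cou t by exact: E.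
move: t; apply: (tens_ext (f := fun x => (ext_double_cou (tmap iA iH x) : k^o))); [mlin..|] => a h.
rewrite -[tmap iA iH _]/(iD _) double_inclE stens_couE; [|mlin..].
by rewrite (cou_incl hA hOA) (cou_incl hH hOH) /double_cou tsum_tens //; mlin.
Qed.

Lemma double_bialg : is_bialg D.
Proof.
have hAb := is_hopf_bialg hA; have hHb := is_hopf_bialg hH.
apply: (sub_bialg hOD double_incl_lin double_retract_lin double_incl_cancel homog_double_incl
  double_incl_mul double_incl_one double_incl_cop double_incl_cou).
- exact: double_mul_bil.
- by rewrite /= /double_cop; mlin.
- by rewrite /= /double_cou; mlin.
Qed.

Let hDb := double_bialg.
Let injD : injective iD := can_inj double_incl_cancel.
Let mulDA : associative (@amul k D) := is_alg_assoc (is_bialg_alg hDb).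

Lemma double_mull1 (a b : A) (g : H) :
  @amul k D (a ⊗ aone H) (b ⊗ g) = (b ∙ a) ⊗ g.
Proof.
apply: injD; rewrite double_incl_mul !double_inclE (exterior_one hEH).
by rewrite (ext_double_mull1 _ (homog_incl hOA a) (homog_incl hOA b)) scale1r (exterior_mul hEA).
Qed.

Lemma double_mulr1 (a : A) (h g : H) :
  @amul k D (a ⊗ h) (aone A ⊗ g) = a ⊗ (h ∙ g).
Proof.
apply: injD; rewrite double_incl_mul !double_inclE (exterior_one hEA).
by rewrite ext_double_mulr1 (exterior_mul hEH).
Qed.

Lemma hopf_antipode_mul x y : SA (x ∙ y) = SA y ∙ SA x.
Proof.
apply: (exterior_injective hEA); rewrite -(antipode_incl hA hOA) !(exterior_mul hEA).
rewrite (antipode_mul hX hSX (homog_incl hOA x) (homog_incl hOA y)) scale1r.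
by rewrite !(antipode_incl hA hOA).
Qed.

Lemma hopf_antipode_one : SA (aone A) = aone A.
Proof.
apply: (exterior_injective hEA).
by rewrite -(antipode_incl hA hOA) (exterior_one hEA) (antipode_one hX hSX).
Qed.

Lemma tsum_double_cop (U : lmodType k) (F : D -> D -> U) (a : A) (h : H) : is_bilinear F ->
  tsum F (double_cop (a ⊗ h)) =
  \tsum_(a1, a2 <- cop a) \tsum_(h1, h2 <- cop h) F (a1 ⊗ h1) (a2 ⊗ h2).
Proof.
have hAb := is_hopf_bialg hA; have hHb := is_hopf_bialg hH.
have dl : is_linear (@double_cop k A H) by rewrite /double_cop; mlin.
move=> FB; rewrite /double_cop tsum_tens; [|mlin..].
rewrite tsum_tsum //; apply: eq_tsum => a1 a2; rewrite tsum_tsum //; apply: eq_tsum => h1 h2.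
by rewrite tsum_tens.
Qed.

(* The antipode of A^op is the inverse of that of A.                           *)
Lemma double_hopf : bijective SA -> exists SD : D -> D, is_hopf SD.
Proof.
move=> [T TS ST]; have hAb := is_hopf_bialg hA; have hHb := is_hopf_bialg hH.
have Tl : is_linear T by move=> c x y; apply: (can_inj TS); rewrite SAl !ST.
have S1 := hopf_antipode_one.
(* Applying the antipode of A, which reverses products, turns a2 T(a1) into a1 S(a2). *)
have Tr a : \tsum_(a1, a2 <- cop a) a2 ∙ T a1 = cou a *: aone A.
  apply: (can_inj TS); rewrite (lin_tsumE _ _ SAl) (linZ _ _ SAl) S1.
  rewrite -(is_antipode_right (is_hopf_antipode hA)).
  by apply: eq_tsum => a1 a2; rewrite hopf_antipode_mul ST.
have Tl' a : \tsum_(a1, a2 <- cop a) T a2 ∙ a1 = cou a *: aone A.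
  apply: (can_inj TS); rewrite (lin_tsumE _ _ SAl) (linZ _ _ SAl) S1.
  rewrite -(is_antipode_left (is_hopf_antipode hA)).
  by apply: eq_tsum => a1 a2; rewrite hopf_antipode_mul ST.
have cl : is_linear (@cop k D) := is_coalg_cop_linear (is_bialg_coalg hDb).
have cl' : is_linear (@cop k D : A ⊗ H -> _) := cl.
have ul : is_linear (@cou k D : A ⊗ H -> k^o) := is_coalg_cou_linear (is_bialg_coalg hDb).
(* As a ⊗ h = (a ⊗ 1)(1 ⊗ h), an antipode has to multiply the antipodes of the two factors in the
   opposite order. *)
pose SD (x : D) : D := \tsum_(a, h <- x) @amul k D (aone A ⊗ SH h) (T a ⊗ aone H).
have SDl : is_linear SD by rewrite /SD; mlin.
have SDl' : is_linear (SD : A ⊗ H -> A ⊗ H) := SDl.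
have SDE a h : SD (a ⊗ h) = @amul k D (aone A ⊗ SH h) (T a ⊗ aone H).
  by rewrite /SD tsum_tens //; mlin.
have split_tens (a : A) (h : H) : a ⊗ h = @amul k D (a ⊗ aone H) (aone A ⊗ h).
  by rewrite double_mulr1 (is_alg_left_id (is_bialg_alg hHb)).
have couE (a : A) (h : H) : @cou k D (a ⊗ h) = cou a * cou h.
  by rewrite -[LHS]/(double_cou (a ⊗ h)) /double_cou tsum_tens //; mlin.
exists SD; split; first exact: hDb.
split; first exact: SDl.
- suff E (t : A ⊗ H) : \tsum_(x1, x2 <- @cop k D t) SD x1 ∙ x2 = @cou k D t *: aone D by exact: E.
  move: t; apply: tens_ext; [mlin..|] => a h; rewrite -[@cop k D _]/(double_cop (a ⊗ h)).
  rewrite tsum_double_cop ?couE; [|mlin..].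
  transitivity (\tsum_(h1, h2 <- cop h)
    @amul k D (aone A ⊗ SH h1) (@amul k D ((\tsum_(a1, a2 <- cop a) a2 ∙ T a1) ⊗ aone H) (aone A ⊗ h2))).
    rewrite exchange_tsum; apply: eq_tsum => h1 h2.
    rewrite (lin_tsumE (g := fun b : A => @amul k D (aone A ⊗ SH h1)
      (@amul k D (b ⊗ aone H) (aone A ⊗ h2)))); [|mlin..].
    apply: eq_tsum => a1 a2; rewrite SDE (split_tens a2 h2) -!mulDA; congr (_ ∙ _).
    by rewrite mulDA double_mull1.
  rewrite Tr; transitivity (cou a *: (aone A ⊗ \tsum_(h1, h2 <- cop h) SH h1 ∙ h2)).
    rewrite (lin_tsumE (g := fun b => aone A ⊗ b)) ?tsumZ; [|mlin..].
    apply: eq_tsum => h1 h2; rewrite tensZl -double_mulr1.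
    rewrite (linZ (f := fun b : A ⊗ H => @amul k D (aone A ⊗ SH h1) (@amul k D b (aone A ⊗ h2))));
      last by mlin.
    by rewrite (is_alg_left_id (is_bialg_alg hDb)).
  by rewrite (is_antipode_left (is_hopf_antipode hH)) tensZr scalerA.
- suff E (t : A ⊗ H) : \tsum_(x1, x2 <- @cop k D t) x1 ∙ SD x2 = @cou k D t *: aone D by exact: E.
  move: t; apply: tens_ext; [mlin..|] => a h; rewrite -[@cop k D _]/(double_cop (a ⊗ h)).
  rewrite tsum_double_cop ?couE; [|mlin..].
  transitivity (\tsum_(a1, a2 <- cop a) @amul k D (a1 ⊗ aone H)
    (@amul k D (aone A ⊗ \tsum_(h1, h2 <- cop h) h1 ∙ SH h2) (T a2 ⊗ aone H))).
    apply: eq_tsum => a1 a2.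
    rewrite (lin_tsumE (g := fun b : H => @amul k D (a1 ⊗ aone H)
      (@amul k D (aone A ⊗ b) (T a2 ⊗ aone H)))); [|mlin..].
    apply: eq_tsum => h1 h2; rewrite SDE (split_tens a1 h1) -!mulDA; congr (_ ∙ _).
    by rewrite mulDA double_mulr1.
  rewrite (is_antipode_right (is_hopf_antipode hH)).
  transitivity (cou h *: ((\tsum_(a1, a2 <- cop a) T a2 ∙ a1) ⊗ aone H)).
    rewrite (lin_tsumE (g := fun b => b ⊗ aone H)) ?tsumZ; [|mlin..].
    apply: eq_tsum => a1 a2; rewrite tensZr -double_mull1.
    rewrite (linZ (f := fun b : A ⊗ H => @amul k D (a1 ⊗ aone H) (@amul k D b (T a2 ⊗ aone H))));
      last by mlin.
    by rewrite (is_alg_left_id (is_bialg_alg hDb)).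
  by rewrite Tl' tensZl scalerA mulrC.
Qed.

Lemma double_homog0 x : hg 0 x -> exists d : D, x = iD d.
Proof.
have iDl := double_incl_lin.
move=> /(stens_expand hX hY)[I [d [e [v [w [hv hw Dd ->]]]]]].
exists (\sum_i deg0 iA (v i) ⊗ deg0 iH (w i)); rewrite (lin_sumE _ _ _ iDl).
apply: eq_bigr => i _; rewrite double_inclE.
have [d0 e0] : d i = 0%N /\ e i = 0%N.
  by move: (Dd i) => /esym/eqP; rewrite addn_eq0 => /andP[/eqP-> /eqP->].
have := hv i; have := hw i; rewrite d0 e0 => h1 h0.
by rewrite (deg0_homog0 hOA h0) (deg0_homog0 hOH h1).
Qed.

(** The antipode of D, extended by zero to positive degrees, inverts the identity in degree 0. This
    is the map j from which the graded antipode is built. *)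
Lemma ext_double_antipode : bijective SA -> exists SOD : OD -> OD, is_antipode SOD.
Proof.
move=> /double_hopf[SD hSD]; have hS := is_hopf_antipode hSD.
have SDl := is_antipode_linear hS; have rl := double_retract_lin.
have iDl := double_incl_lin; have cl := is_coalg_cop_linear (is_bialg_coalg hDb).
have il : is_linear (id : OD -> OD) := @lin_id k OD.
pose j (x : OD) : OD := iD (SD (rD x)).
have jl : is_linear j by rewrite /j; mlin.
apply: (graded_antipode hOD jl) => _ /double_homog0[d ->].
  rewrite /conv /conv_one (tsum_cop_sub double_incl_cop); [|mlin..].
  rewrite double_incl_cou -double_incl_one -(linZ _ _ iDl) -(is_antipode_left hS).
  rewrite (lin_tsumE _ _ iDl); apply: eq_tsum => a b.
  by rewrite /j double_incl_cancel double_incl_mul.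
rewrite /conv /conv_one (tsum_cop_sub double_incl_cop); [|mlin..].
rewrite double_incl_cou -double_incl_one -(linZ _ _ iDl) -(is_antipode_right hS).
rewrite (lin_tsumE _ _ iDl); apply: eq_tsum => a b.
by rewrite /j double_incl_cancel double_incl_mul.
Qed.

Let mulODB' : is_bilinear (@amul k OD : OA ⊗ OH -> OA ⊗ OH -> OA ⊗ OH) :=
  mul_bil (dgbi_alg hOD).
Let dODl : is_linear (@gd k OD) := is_dga_d_linear (dgbi_dga hOD).

Lemma d_one (X : dgbialg k) : is_dgbi X -> gd (aone X) = 0.
Proof.
move=> hx; have := is_dga_leibniz (dgbi_dga hx) (aone X) (homog_one hx).
rewrite (dg_mulr1 hx) expr0 scale1r (dg_mul1 hx) (dg_mulr1 hx) -[X in X = _]addr0.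
by move/addrI.
Qed.

Lemma ext_double_dl (v : OA) : @gd k OD (v ⊗ aone OH) = gd v ⊗ aone OH.
Proof.
move: v; apply: (homog_ext (f := fun v => @gd k OD (v ⊗ aone OH)) gX); [|mlin|].
  by have dl : is_linear (@gd k OD : OA ⊗ OH -> OA ⊗ OH) := dODl; mlin.
move=> n v hv; rewrite -[LHS]/(super_tensor_d _) (stens_dE hX hY _ hv) (d_one hY).
by rewrite tens0r scaler0 addr0.
Qed.

Lemma ext_double_dr (w : OH) : @gd k OD (aone OA ⊗ w) = aone OA ⊗ gd w.
Proof.
rewrite -[LHS]/(super_tensor_d _) (stens_dE hX hY _ (homog_one hX)) (d_one hX).
by rewrite tens0l add0r scale1r.
Qed.

Lemma tens_mulE (v : OA) (w : OH) : v ⊗ w = @amul k OD (v ⊗ aone OH) (aone OA ⊗ w).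
Proof. by rewrite ext_double_mulr1 (dg_mul1 hY). Qed.

Definition one_form (x : OD) : Prop :=
  exists s : seq (D * D), x = \sum_(r <- s) iD r.1 ∙ gd (iD r.2).

Lemma one_form0 : one_form 0.
Proof. by exists [::]; rewrite big_nil. Qed.

Lemma one_formD x y : one_form x -> one_form y -> one_form (x + y).
Proof. by move=> [s ->] [t ->]; exists (s ++ t); rewrite big_cat. Qed.

Lemma one_form_sum (I : Type) (r : seq I) (F : I -> OD) :
  (forall i, one_form (F i)) -> one_form (\sum_(i <- r) F i).
Proof.
move=> hF; elim: r => [|i r IH]; first by rewrite big_nil; exact: one_form0.
by rewrite big_cons; exact: one_formD.
Qed.

Lemma one_form_d d : one_form (gd (iD d)).
Proof.
exists [:: (aone D, d)]; rewrite big_seq1 -[RHS]/(iD (aone D) ∙ gd (iD d)).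
by rewrite double_incl_one (dg_mul1 hOD).
Qed.

Lemma one_form_mull d x : one_form x -> one_form (iD d ∙ x).
Proof.
move=> [s ->]; rewrite (lin_sumE (f := @amul k OD (iD d))); [|mlin..].
apply: one_form_sum => r; exists [:: (d ∙ r.1, r.2)].
rewrite big_seq1 -[RHS]/(iD (d ∙ r.1) ∙ gd (iD r.2)).
by rewrite double_incl_mul (dg_mulA hOD).
Qed.

(** By the Leibniz rule (db)c = d(bc) - b dc. *)
Lemma one_form_mulr d x : one_form x -> one_form (x ∙ iD d).
Proof.
move=> [s ->]; rewrite (lin_sumE (f := fun x => x ∙ iD d)); [|mlin..].
apply: one_form_sum => r; rewrite -(dg_mulA hOD); apply: one_form_mull.
move: r.2 => b; have := is_dga_leibniz (dgbi_dga hOD) (iD d) (homog_double_incl b).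
rewrite expr0 scale1r -double_incl_mul => /(canLR (addrK _)) <-.
apply: one_formD; first exact: one_form_d.
have -> : - (iD b ∙ gd (iD d)) = iD (- b) ∙ gd (iD d).
  rewrite -!scaleN1r (linZ _ _ double_incl_lin); symmetry.
  exact: (mulZl hOD).
by apply: one_form_mull; exact: one_form_d.
Qed.

Lemma ext_double_degree1 x : hg 1 x -> one_form x.
Proof.
move=> /(stens_expand hX hY)[I [d [e [v [w [hv hw Dd ->]]]]]].
apply: one_form_sum => i; have := hv i; have := hw i; move: (Dd i).
case: (d i) => [|[|d']] /esym; case: (e i) => [|[|e']] // _ {}hw {}hv.
- have /(exterior_degree0 hEA)[a ->] := hv.
  have /(exterior_degree1 hEH)[s ->] := hw.
  rewrite (lin_sumE (f := tens (iA a))); [|mlin..].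
  apply: one_form_sum => -[h g] /=.
  (* Degree 1 consists of A ⊗ Ω^1(H) and Ω^1(A) ⊗ H. In the first, a ⊗ h dg = (a ⊗ h) d(1 ⊗ g). *)
  have -> : iA a ⊗ (iH h ∙ gd (iH g)) =
      @amul k OD (iD (a ⊗ h)) (gd (iD (aone A ⊗ g))).
    by rewrite !double_inclE (exterior_one hEA) ext_double_dr ext_double_mulr1.
  by apply: one_form_mull; exact: one_form_d.
- have /(exterior_degree1 hEA)[s ->] := hv.
  have /(exterior_degree0 hEH)[h ->] := hw.
  rewrite (lin_sumE (f := fun x => x ⊗ iH h)); [|mlin..].
  apply: one_form_sum => -[a b] /=.
  (* Because the product of A is reversed in the double, a ⊗ h has to multiply d(b ⊗ 1) from the
     right. *)
  have -> : (iA a ∙ gd (iA b)) ⊗ iH h =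
      @amul k OD (gd (iD (b ⊗ aone H))) (iD (a ⊗ h)).
    rewrite !double_inclE (exterior_one hEH) ext_double_dl.
    by rewrite (ext_double_mull1 _ (homog_d hX (homog_incl hOA b)) (homog_incl hOA a)) scale1r.
  by apply: one_form_mulr; exact: one_form_d.
Qed.

(** Every v ⊗ w is the product of v ⊗ 1 and 1 ⊗ w, so it is enough to generate each factor, using
    the generation of Ω(A) and of Ω(H). *)
Lemma ext_double_generated (Q : OD -> Prop) : is_subalgebra Q ->
  (forall x, hg 0 x \/ hg 1 x -> Q x) -> forall x, Q x.
Proof.
move=> [Q1 Ql Qm] Q01.
have Q0 : Q 0 by apply: Q01; left; exact: homog0.
have QD x y : Q x -> Q y -> Q (x + y) by rewrite -{2}[x]scale1r; exact: Ql.
have QZ c x : Q x -> Q (c *: x) by move=> qx; rewrite -[_ *: _]addr0; exact: Ql.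
have Qsum (I : Type) (r : seq I) (F : I -> OD) : (forall i, Q (F i)) -> Q (\sum_(i <- r) F i).
  move=> hF; elim: r => [|i r IH]; first by rewrite big_nil.
  by rewrite big_cons; exact: QD.
have QH : forall w, Q (aone OA ⊗ w).
  apply: (exterior_generated hEH) => [|w hw]; last first.
    apply: Q01; case: hw => hw; [left|right].
      exact: (homog_tens gX gY (homog_one hX) hw).
    exact: (homog_tens gX gY (homog_one hX) hw).
  split=> [|c x y qx qy|x y qx qy]; first exact: Q1.
    by rewrite (_ : is_linear (tens (aone OA))); [exact: Ql|mlin].
  by rewrite -ext_double_mulr1; exact: Qm.
(* The induction runs over all components of v, since v -> v ⊗ 1 reverses products only up to signs
   which depend on degrees. *)
have QA' : forall v n, Q (gpr n v ⊗ aone OH).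
  apply: (exterior_generated hEA) => [|v hv n]; last first.
    have Qv m : hgA m v -> Q (v ⊗ aone OH) -> Q (gpr n v ⊗ aone OH).
      by move=> /(pr_homog gX n) ->; case: eqP => // _; rewrite tens0l.
    case: hv => hv; apply: (Qv _ hv); apply: Q01; [left|right].
      exact: (homog_tens gX gY hv (homog_one hY)).
    exact: (homog_tens gX gY hv (homog_one hY)).
  split=> [n|c x y qx qy n|x y qx qy n].
  - by rewrite (pr_homog gX _ (homog_one hX)); case: eqP => // _; rewrite tens0l.
  - rewrite (pr_lin gX) (_ : is_linear (fun x => x ⊗ aone OH)); [exact: Ql|mlin].
  have [N xE] := grading_finite gX x; have [M yE] := grading_finite gX y.
  rewrite xE yE (lin_sumE (f := fun x => gpr n (x ∙ _) ⊗ aone OH)); [|mlin..].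
  apply: (Qsum) => i.
  rewrite (lin_sumE (f := fun y => gpr n (_ ∙ y) ⊗ aone OH)); [|mlin..].
  apply: (Qsum) => j; have hx := homog_pr gX i x; have hy := homog_pr gX j y.
  rewrite (pr_homog gX _ (homog_mul hX hx hy)); case: eqP => [_|_]; last by rewrite tens0l.
  (* The factors are taken in the reverse order, and the sign of the opposite product is cancelled
     by multiplying with it once more. *)
  have := Qm _ _ (qy j) (qx i); rewrite (ext_double_mull1 _ hy hx) => /(QZ ((-1) ^+ (j * i))).
  by rewrite scalerA -exprD -signr_odd oddD addbb scale1r.
have QA v : Q (v ⊗ aone OH).
  have [N vE] := grading_finite gX v.
  rewrite vE (lin_sumE (f := fun x => x ⊗ aone OH)); [|mlin..].
  by apply: (Qsum) => i; exact: QA'.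
move=> x; have -> : x = \sum_(r <- repr (x : OA ⊗ OH)) r.1 ⊗ r.2 := tensE x.
by apply: (Qsum) => -[v w] /=; rewrite tens_mulE; exact: Qm.
Qed.

Lemma ext_double_exterior : is_exterior_algebra iD.
Proof.
split.
- exact: dgbi_dga hOD.
- exact: double_incl_lin.
- exact: double_incl_mul.
- exact: double_incl_one.
- exact: injD.
- by move=> x; split=> [/double_homog0|[a ->]]; [|exact: homog_double_incl].
- move=> x; split=> [|[s ->]]; first exact: ext_double_degree1.
  apply: (homog_sum gOD) => -[a b] _ /=.
  exact: (homog_mul hOD (homog_double_incl a) (homog_d hOD (homog_double_incl b))).
- exact: ext_double_generated.
Qed.

Lemma homog_even_map (X : dgbialg k) (V : lmodType k) (pr : nat -> V -> V) (f : X -> V) :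
  is_grading pr -> (forall n x, homog (@gpr k X) n x -> homog pr n (f x)) ->
  even_map (@gpr k X) pr f.
Proof.
move=> gr hf m n x mn /hf hx; rewrite (pr_homog gr _ hx); case: eqP => // E.
by rewrite E eqxx in mn.
Qed.

Lemma ext_double_strongly_bicovariant : bijective SA ->
  exists (SD : D -> D) (SOD : OD -> OD), is_hopf SD /\ is_strongly_bicovariant iD SOD.
Proof.
move=> bS; have [SD hSD] := double_hopf bS; have [SOD hSOD] := ext_double_antipode bS.
exists SD, SOD; split=> //; split.
- exact: ext_double_exterior.
- split.
  + exact: dgbi_alg hOD.
  + exact: dgbi_coalg hOD.
  + apply: homog_even_map; first exact: tensor_is_grading.
    by move=> n x; exact: (dgbi_cop_degree hOD).
  + move=> m [|n] x mn hx; rewrite /trivial_grading.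
      by case: m mn => [|m] //= _; rewrite if_same.
    by rewrite (dgbi_cou_degree hOD hx) if_same.
  + apply: (homog_even_map gOD) => n x; exact: (antipode_homog hOD hSOD).
  + exact: (dgbi_cop_mul hOD).
  + exact: (dgbi_cop_one hOD).
  + exact: (dgbi_cou_mul hOD).
  + exact: (dgbi_cou_one hOD).
  + exact: hSOD.
- exact: (dgbi_cop_degree hOD).
- exact: double_incl_cop.
- exact: (dgbi_cop_d hOD).
Qed.

End DoubleStructure.

(** * The right action *)

(** The regrouping that brings the two inner legs together, so that they can cancel. *)
Lemma coassoc4 (k : fieldType) (C : bialg k) (U : lmodType k) (F : C -> C -> C -> C -> U) x :
  is_coalg C ->
  (forall b c d, is_linear (fun a => F a b c d)) ->
  (forall a c d, is_linear (fun b => F a b c d)) ->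
  (forall a b d, is_linear (fun c => F a b c d)) ->
  (forall a b c, is_linear (fun d => F a b c d)) ->
  \tsum_(x12, x34 <- cop x) \tsum_(x1, x2 <- cop x12) \tsum_(x3, x4 <- cop x34) F x1 x2 x3 x4 =
  \tsum_(x1, x24 <- cop x) \tsum_(x23, x4 <- cop x24) \tsum_(x2, x3 <- cop x23) F x1 x2 x3 x4.
Proof.
move=> hC F1 F2 F3 F4.
rewrite (coassoc (F := fun a b c => \tsum_(x3, x4 <- cop c) F a b x3 x4) x hC); [|mlin..].
by apply: eq_tsum => x1 x24; rewrite (coassoc (F := F x1) x24 hC).
Qed.

(** * The coregular action and the right super adjoint action *)

Section PairingAction.
Variables (k : fieldType) (X Y : dgbialg k) (SX : X -> X) (SY : Y -> Y) (q : Y -> X -> k).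
Hypotheses (hX : is_dgbi X) (hY : is_dgbi Y).
Hypotheses (hSX : is_antipode SX) (hSY : is_antipode SY).
Hypothesis hq : deg0_pairing SX SY q.
Local Notation hgX := (homog (@gpr k X)).
Local Notation hgY := (homog (@gpr k Y)).

Let gY := dgbi_grading hY.
Let q0 := deg0_pairing_bil hq.
Let qs0 := inv_pairing_deg0 hY hSY hq.
Local Notation qs := (inv_pairing SY q).

(** The coregular action of the dual, restricted along the pairing. It is a right action of the
    opposite algebra, which is the one appearing in the double. *)
Definition pact (v : Y) (a : X) : Y := \tsum_(v1, v2 <- cop v) q v2 a *: v1.

Lemma pact_bil : is_bilinear pact.
Proof. by rewrite /pact; mlin. Qed.
Hint Resolve pact_bil : multilinear.

Lemma pact_homog n v a : hgY n v -> hgY n (pact v a).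
Proof.
move=> hv; have [I [d [e [u [w [hu hw D E]]]]]] := cop_expand hY hv.
rewrite /pact E; [|mlin..].
apply: (homog_sum gY) => i _; case: (e i) (hw i) (D i) => [|m] hm.
  by rewrite addn0 => ->; apply: (homogZ gY).
by rewrite (deg0_bil_l q0 _ hm) scale0r => _; exact: homog0.
Qed.

Lemma pact_pos n v a : hgX n.+1 a -> pact v a = 0.
Proof. by move=> ha; apply: tsum0 => v1 v2; rewrite (deg0_bil_r q0 _ ha) scale0r. Qed.

Lemma pact_mul v a b : pact (pact v a) b = pact v (b ∙ a).
Proof.
transitivity (\tsum_(v12, v3 <- cop v) \tsum_(v1, v2 <- cop v12) (q v2 b * q v3 a) *: v1).
  rewrite {2}/pact (lin_tsumE (g := fun v => pact v b)); [|mlin..].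
  apply: eq_tsum => v12 v3; rewrite (linZ (f := fun v => pact v b)); [|mlin..].
  by rewrite /pact tsumZ; apply: eq_tsum => v1 v2; rewrite scalerA mulrC.
rewrite (coassoc v (dgbi_coalg hY)); [|mlin..].
apply: eq_tsum => v1 v23; rewrite (deg0_pairing_mulr hq).
by rewrite (lin_tsumE (g := fun c : k^o => c *: v1)); [|mlin..].
Qed.

Lemma pact_one v : pact v (aone X) = v.
Proof.
rewrite -[RHS](is_coalg_right_counit (dgbi_coalg hY)); apply: eq_tsum => v1 v2.
by rewrite (deg0_pairing_oner hq).
Qed.

Lemma pact_alg_one a : pact (aone Y) a = cou a *: aone Y.
Proof.
rewrite /pact (tsum_cop_one hY); [|mlin..].
by rewrite (deg0_pairing_onel hq).
Qed.

Lemma deg0_cop_mulr (U : lmodType k) (f : Y -> k) (F : Y -> U) v w : deg0_form f -> is_linear F ->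
  \tsum_(z1, z2 <- cop (v ∙ w)) f z2 *: F z1 =
  \tsum_(v1, v2 <- cop v) \tsum_(w1, w2 <- cop w) f (v2 ∙ w2) *: F (v1 ∙ w1).
Proof.
move=> hf Fl; rewrite (tsum_cop_mul hY); [|mlin..].
apply: (tsum_hext _ gY gY); [mlin..|] => m n a b ha hb.
apply: (tsum_hext _ gY gY); [mlin..|] => m' n' a' b' ha' hb'.
hsum_at gY hb.
rewrite (hsum_homog gY ha'); [|mlin..].
case: n hb => [|n] hb; first by rewrite mul0n scale1r.
have := homog_mul hY hb hb'; rewrite addSn => /(deg0_form_van hf) ->.
by rewrite !scale0r scaler0.
Qed.

Lemma pact_alg_mul v w a :
  pact (v ∙ w) a = \tsum_(a1, a2 <- cop a) pact v a1 ∙ pact w a2.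
Proof.
rewrite /pact (deg0_cop_mulr (F := fun z => z)) //; last exact: deg0_form_l.
transitivity (\tsum_(a1, a2 <- cop a) \tsum_(v1, v2 <- cop v) \tsum_(w1, w2 <- cop w)
  (q v2 a1 * q w2 a2) *: (v1 ∙ w1)); last first.
  apply: eq_tsum => a1 a2; rewrite (lin_tsumE (g := fun y => y ∙ _)); [|mlin..].
  apply: eq_tsum => v1 v2; rewrite (lin_tsumE (g := fun y => _ ∙ y)); [|mlin..].
  by apply: eq_tsum => w1 w2; rewrite (mulZl hY) (mulZr hY) scalerA.
rewrite [RHS]exchange_tsum; apply: eq_tsum => v1 v2; rewrite [RHS]exchange_tsum; apply: eq_tsum => w1 w2.
rewrite (deg0_pairing_mull hq).
by rewrite (lin_tsumE (g := fun c : k^o => c *: (v1 ∙ w1))); [|mlin..].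
Qed.

Lemma pact_d v a : pact (gd v) a = gd (pact v a).
Proof.
have dl : is_linear (@gd k Y) by mlin.
rewrite /pact (deg0_cop_dr hY (F := fun z => z)) //; last exact: deg0_form_l.
rewrite (lin_tsumE _ _ dl); apply: eq_tsum => v1 v2.
by rewrite (linZ _ _ dl).
Qed.

Lemma pact_antipode y a : pact (SY y) a = \tsum_(y1, y2 <- cop y) qs y1 a *: SY y2.
Proof.
by rewrite /pact (deg0_cop_antipode hY hSY (F := fun z => z)) //; exact: deg0_form_l.
Qed.

(** The right adjoint action S(y1) v y2 with the Koszul sign of moving y1 past v. *)
Definition super_adj (v y : Y) : Y :=
  \hsum_(v' @ n <- v) \tsum_(y1, y2 <- cop y) \hsum_(y1' @ m <- y1)
    (-1) ^+ (m * n) *: (SY y1' ∙ v' ∙ y2).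

Lemma super_adj_bil : is_bilinear super_adj.
Proof. by rewrite /super_adj; mlin. Qed.
Hint Resolve super_adj_bil : multilinear.

Lemma super_adjE n v y : hgY n v -> super_adj v y =
  \tsum_(y1, y2 <- cop y) \hsum_(y1' @ m <- y1) (-1) ^+ (m * n) *: (SY y1' ∙ v ∙ y2).
Proof. by move=> hv; rewrite /super_adj (hsum_homog gY hv) //; mlin. Qed.

Lemma super_adj_homog m n v y : hgY m v -> hgY n y -> hgY (m + n) (super_adj v y).
Proof.
move=> hv hy; rewrite (super_adjE _ hv).
have [I [d [e [u [w [hu hw D E]]]]]] := cop_expand hY hy.
rewrite E; [|mlin..].
apply: (homog_sum gY) => i _; rewrite (hsum_homog gY (hu i)); [|mlin..].
apply: (homogZ gY); rewrite (D i) addnCA addnA.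
apply: (homog_mul hY) (hw i); apply: (homog_mul hY) hv.
exact: (antipode_homog hY hSY).
Qed.

Lemma super_adj_one v : super_adj v (aone Y) = v.
Proof.
move: v; apply: (homog_ext gY); [mlin|exact: lin_id|] => n v hv.
rewrite (super_adjE _ hv) (tsum_cop_one hY); [|mlin..].
hsum_at gY (homog_one hY).
by rewrite scale1r (antipode_one hY hSY) (dg_mul1 hY) (dg_mulr1 hY).
Qed.

Lemma super_adj_alg_one y : super_adj (aone Y) y = cou y *: aone Y.
Proof.
rewrite (super_adjE _ (homog_one hY)) -(is_antipode_left hSY).
apply: (tsum_hext _ gY gY); [mlin..|] => m n a b ha hb.
hsum_at gY ha.
by rewrite muln0 scale1r (dg_mulr1 hY).
Qed.

Lemma super_adj_mul v y z : super_adj (super_adj v y) z = super_adj v (y ∙ z).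
Proof.
move: v y z; apply: (homog_ext3 gY gY gY); [mlin..|] => l m n v y z hv hy hz.
rewrite (super_adjE _ (super_adj_homog hv hy)) !(super_adjE _ hv).
have [I [d [e [u [w [hu hw D E]]]]]] := cop_expand hY hy.
have [I' [d' [e' [u' [w' [hu' hw' D' E']]]]]] := cop_expand hY hz.
rewrite (tsum_cop_mul hY); [|mlin..].
rewrite !E; [|mlin..]; rewrite E'; [|mlin..].
transitivity (\sum_i' \sum_i (-1) ^+ (d' i' * (l + m)) *: ((-1) ^+ (d i * l) *:
   (SY (u' i') ∙ (SY (u i) ∙ v ∙ w i) ∙ w' i'))).
  apply: eq_bigr => i' _; rewrite (hsum_homog gY (hu' i')); [|mlin..].
  rewrite (lin_sumE (f := fun x => SY (u' i') ∙ x ∙ w' i')); [|mlin..].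
  rewrite scaler_sumr; apply: eq_bigr => i _.
  hsum_at gY (hu i).
  by rewrite (mulZr hY) (mulZl hY).
rewrite exchange_big; apply: eq_bigr => i _; rewrite E'; [|mlin..].
apply: eq_bigr => i' _.
hsum_at gY (hw i).
hsum_at gY (hu' i').
hsum_at gY (homog_mul hY (hu i) (hu' i')).
rewrite (antipode_mul hY hSY (hu i) (hu' i')) !(mulZl hY) !(dg_mulA hY) (D i).
signs.
Qed.

(** Insert y2 S(y3) = ε between v and w in S(y1) v w y4 and read off the two adjoint actions; [T] is
    the resulting expression in the four legs of y. *)
Lemma super_adj_alg_mul n v w y : hgY n w ->
  super_adj (v ∙ w) y = \tsum_(y1, y2 <- cop y) \hsum_(y1' @ m <- y1)
    (-1) ^+ (n * m) *: (super_adj v y1' ∙ super_adj w y2).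
Proof.
move=> hw; move: v; apply: (homog_ext gY); [mlin..|] => l v hv.
pose T (y1 y2 y3 y4 : Y) : Y := \hsum_(y1' @ a <- y1) \hsum_(y2' @ b <- y2) \hsum_(y3' @ c <- y3)
   (-1) ^+ ((l + n) * a + n * (b + c)) *: (SY y1' ∙ v ∙ (y2' ∙ SY y3') ∙ w ∙ y4).
have TE a b c (y1 y2 y3 y4 : Y) : hgY a y1 -> hgY b y2 -> hgY c y3 -> T y1 y2 y3 y4 =
   (-1) ^+ ((l + n) * a + n * (b + c)) *: (SY y1 ∙ v ∙ (y2 ∙ SY y3) ∙ w ∙ y4).
  move=> h1 h2 h3; rewrite /T (hsum_homog gY h1); [|mlin..].
  hsum_at gY h2.
  by hsum_at gY h3.
have T1 y2 y3 y4 : is_linear (fun y1 => T y1 y2 y3 y4) by rewrite /T; mlin.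
have T2 y1 y3 y4 : is_linear (fun y2 => T y1 y2 y3 y4) by rewrite /T; mlin.
have T3 y1 y2 y4 : is_linear (fun y3 => T y1 y2 y3 y4) by rewrite /T; mlin.
have T4 y1 y2 y3 : is_linear (fun y4 => T y1 y2 y3 y4) by rewrite /T; mlin.
clearbody T.
transitivity (\tsum_(y12, y34 <- cop y) \tsum_(y1, y2 <- cop y12) \tsum_(y3, y4 <- cop y34)
  T y1 y2 y3 y4); last first.
  apply: (tsum_hext _ gY gY); [mlin..|] => i j a b ha hb.
  hsum_at gY ha.
  rewrite (super_adjE _ hv) (super_adjE _ hw).
  have [I [da [ea [ua [va [hua hva Da Ea]]]]]] := cop_expand hY ha.
  have [J [db [eb [ub [vb [hub hvb Db Eb]]]]]] := cop_expand hY hb.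
  rewrite !Ea; [|mlin..].
  rewrite (lin_sumE (f := fun x => x ∙ _)) ?scaler_sumr; [|mlin..].
  apply: eq_bigr => o _; rewrite !Eb; [|mlin..].
  rewrite (lin_sumE (f := fun x => _ ∙ x)) ?scaler_sumr; [|mlin..].
  apply: eq_bigr => o' _.
  rewrite (TE _ _ _ _ _ _ _ (hua o) (hva o) (hub o')).
  hsum_at gY (hua o).
  hsum_at gY (hub o').
  rewrite (mulZl hY) (mulZr hY) !(dg_mulA hY) (Da o); signs.
rewrite coassoc4 //; last exact: dgbi_coalg.
rewrite (super_adjE _ (homog_mul hY hv hw)).
apply: (tsum_hext _ gY gY); [mlin..|] => i j a b ha hb.
hsum_at gY ha.
transitivity (\tsum_(b1, b2 <- cop b) cou b1 *: ((-1) ^+ (i * (l + n)) *: (SY a ∙ (v ∙ w) ∙ b2))).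
  by rewrite (counitl (F := fun b => (-1) ^+ (i * (l + n)) *: (SY a ∙ (v ∙ w) ∙ b))) //; mlin.
apply: (tsum_hext _ gY gY); [mlin..|] => i' j' a' b' ha' hb'.
have [I [d [e [u [z [hu hz D E]]]]]] := cop_expand hY ha'.
transitivity ((-1) ^+ ((l + n) * i + n * i') *:
   (SY a ∙ v ∙ (\tsum_(x1, x2 <- cop a') x1 ∙ SY x2) ∙ w ∙ b')).
  rewrite (is_antipode_right hSY) (mulZr hY) !(mulZl hY) (dg_mulr1 hY) (dg_mulA hY).
  case: i' ha' {D} => [|i'] ha'.
    by rewrite muln0 addn0 scalerA mulrC -scalerA mulnC.
  by rewrite (dgbi_cou_degree hY ha') !scale0r scaler0.
rewrite !E; [|mlin..].
rewrite (lin_sumE (f := fun x => SY a ∙ v ∙ x ∙ w ∙ b')) ?scaler_sumr; [|mlin..].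
by apply: eq_bigr => o _; rewrite (TE _ _ _ _ _ _ _ ha (hu o) (hz o)) (D o).
Qed.

Lemma super_adj_d n v y : hgY n v ->
  gd (super_adj v y) = super_adj (gd v) y + (-1) ^+ n *: super_adj v (gd y).
Proof.
move=> hv; have dl : is_linear (@gd k Y) by mlin.
have leib := is_dga_leibniz (dgbi_dga hY).
move: y; apply: (homog_ext gY); [mlin..|] => j y hy.
rewrite (super_adjE _ (homog_d hY hv)) !(super_adjE _ hv).
rewrite (tsum_cop_d hY); [|mlin..].
have [I [d [e [u [z [hu hz D E]]]]]] := cop_expand hY hy.
rewrite !E; [|mlin..].
rewrite (lin_sumE _ _ _ dl) scaler_sumr -big_split; apply: eq_bigr => i _ /=.
rewrite !(hsum_homog gY (hu i)); [|mlin..].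
hsum_at gY (homog_d hY (hu i)).
have hSu := antipode_homog hY hSY (hu i).
rewrite (linZ _ _ dl) (leib _ _ _ (homog_mul hY hSu hv)) (leib _ _ _ hSu).
rewrite (antipode_d hY hSY) (mulDl hY) (mulZl hY) !scalerDr addrAC [RHS]addrC.
rewrite -!addrA; congr (_ + _); first signs.
by congr (_ + _); signs.
Qed.

(** The exchange relation of the double. The pairing action respects products, so it is applied to
    each factor of S(y1) v y2. On S(y1) it yields the inverse pairing, since S reverses the
    coproduct, and on y2 it yields the pairing with the last leg. *)
Lemma pact_super_adj v y t : pact (super_adj v y) t =
  \tsum_(y1, y23 <- cop y) \tsum_(y2, y3 <- cop y23) \tsum_(t1, t23 <- cop t)
  \tsum_(t2, t3 <- cop t23) (qs y1 t1 * q y3 t3) *: super_adj (pact v t2) y2.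
Proof.
move: v; apply: (homog_ext gY); [mlin..|] => n v hv.
pose G (y1 y2 y3 y4 : Y) : Y := \hsum_(y2' @ b <- y2) \tsum_(t1, t23 <- cop t) \tsum_(t2, t3 <- cop t23)
  (-1) ^+ (b * n) *: ((qs y1 t1 * q y4 t3) *: (SY y2' ∙ pact v t2 ∙ y3)).
have G1 y2 y3 y4 : is_linear (fun y1 => G y1 y2 y3 y4) by rewrite /G; mlin.
have G2 y1 y3 y4 : is_linear (fun y2 => G y1 y2 y3 y4) by rewrite /G; mlin.
have G3 y1 y2 y4 : is_linear (fun y3 => G y1 y2 y3 y4) by rewrite /G; mlin.
have G4 y1 y2 y3 : is_linear (fun y4 => G y1 y2 y3 y4) by rewrite /G; mlin.
have GE b (y1 y2 y3 y4 : Y) : hgY b y2 -> G y1 y2 y3 y4 =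
  \tsum_(t1, t23 <- cop t) \tsum_(t2, t3 <- cop t23)
  (-1) ^+ (b * n) *: ((qs y1 t1 * q y4 t3) *: (SY y2 ∙ pact v t2 ∙ y3)).
  by move=> h2; rewrite /G (hsum_homog gY h2); [|mlin..].
clearbody G.
transitivity (\tsum_(y1, y24 <- cop y) \tsum_(y23, y4 <- cop y24) \tsum_(y2, y3 <- cop y23)
  G y1 y2 y3 y4); last first.
  apply: eq_tsum => y1 y24; apply: eq_tsum => y23 y4.
  transitivity (\tsum_(y2, y3 <- cop y23) \tsum_(t1, t23 <- cop t) \tsum_(t2, t3 <- cop t23)
    (qs y1 t1 * q y4 t3) *: \hsum_(y2' @ b <- y2) (-1) ^+ (b * n) *: (SY y2' ∙ pact v t2 ∙ y3)).
    apply: (tsum_hext _ gY gY); [mlin..|] => i j a b ha hb; rewrite (GE _ _ _ _ _ ha).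
    apply: eq_tsum => t1 t23; apply: eq_tsum => t2 t3.
    by rewrite (hsum_homog gY ha) ?scalerA 1?mulrC //; mlin.
  rewrite exchange_tsum; apply: eq_tsum => t1 t23; rewrite exchange_tsum; apply: eq_tsum => t2 t3.
  by rewrite (super_adjE _ (pact_homog t2 hv)) tsumZ.
rewrite -coassoc4 //; last exact: dgbi_coalg.
rewrite (super_adjE _ hv) (lin_tsumE (g := fun v => pact v t)); [|mlin..].
apply: (tsum_hext _ gY gY); [mlin..|] => i j a b ha hb.
hsum_at gY ha.
rewrite (linZ (f := fun v => pact v t)); [|mlin..].
have [I [d [e [u [z [hu hz D E]]]]]] := cop_expand hY ha.
transitivity (\tsum_(a1, a2 <- cop a) \tsum_(b1, b2 <- cop b) \tsum_(t1, t23 <- cop t)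
  \tsum_(t2, t3 <- cop t23) (-1) ^+ (i * n) *: ((qs a1 t1 * q b2 t3) *: (SY a2 ∙ pact v t2 ∙ b1))).
  rewrite pact_alg_mul.
  transitivity ((-1) ^+ (i * n) *: \tsum_(t1, t23 <- cop t) \tsum_(t2, t3 <- cop t23)
     ((pact (SY a) t1 ∙ pact v t2) ∙ pact b t3)).
    congr (_ *: _).
    rewrite -(coassoc (F := fun t1 t2 t3 => pact (SY a) t1 ∙ pact v t2 ∙ pact b t3) _
      (dgbi_coalg hX)); [|mlin..].
    apply: eq_tsum => t12 t3; rewrite pact_alg_mul.
    by rewrite (lin_tsumE (g := fun x => x ∙ pact b t3)); [|mlin..].
  transitivity (\tsum_(t1, t23 <- cop t) \tsum_(t2, t3 <- cop t23)
    \tsum_(a1, a2 <- cop a) \tsum_(b1, b2 <- cop b)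
    (-1) ^+ (i * n) *: ((qs a1 t1 * q b2 t3) *: (SY a2 ∙ pact v t2 ∙ b1))).
    rewrite tsumZ; apply: eq_tsum => t1 t23; rewrite tsumZ; apply: eq_tsum => t2 t3.
    rewrite pact_antipode.
    rewrite (lin_tsumE (g := fun x => (-1) ^+ (i * n) *: (x ∙ pact v t2 ∙ pact b t3))); [|mlin..].
    apply: eq_tsum => a1 a2; rewrite [pact b t3]/pact.
    rewrite (lin_tsumE (g := fun x => (-1) ^+ (i * n) *: ((qs a1 t1 *: SY a2) ∙ pact v t2 ∙ x)));
      last by mlin.
    by apply: eq_tsum => b1 b2; rewrite !(mulZl hY) !(mulZr hY) scalerA.
  transitivity (\tsum_(t1, t23 <- cop t) \tsum_(a1, a2 <- cop a) \tsum_(b1, b2 <- cop b)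
    \tsum_(t2, t3 <- cop t23)
    (-1) ^+ (i * n) *: ((qs a1 t1 * q b2 t3) *: (SY a2 ∙ pact v t2 ∙ b1))).
    apply: eq_tsum => t1 t23; rewrite exchange_tsum; apply: eq_tsum => a1 a2.
    exact: exchange_tsum.
  by rewrite exchange_tsum; apply: eq_tsum => a1 a2; exact: exchange_tsum.
rewrite !E; [|mlin..]; apply: eq_bigr => o _; apply: eq_tsum => b1 b2.
rewrite (GE _ _ _ _ _ (hz o)); apply: eq_tsum => t1 t23; apply: eq_tsum => t2 t3.
(* The leg paired with t has degree 0, so splitting it off does not change the degree in the
   sign. *)
case: (d o) (hu o) (D o) => [|m] hm; first by rewrite add0n => ->.
by rewrite (deg0_bil_l qs0 _ hm) mul0r !scale0r !scaler0.
Qed.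

End PairingAction.

#[global] Hint Resolve pact_bil super_adj_bil : multilinear.

(** * The action of the exterior double on Ω(H) *)

Section RightAction.
Variables (k : fieldType) (A H : bialg k).
Variables (SA : A -> A) (SH : H -> H) (p : H -> A -> k).
Variables (OA OH : dgbialg k) (iA : A -> OA) (iH : H -> OH).
Variables (SOA : OA -> OA) (SOH : OH -> OH).
Hypotheses (hA : is_hopf SA) (hH : is_hopf SH) (hp : dually_paired SA SH p).
Hypotheses (hOA : is_strongly_bicovariant iA SOA) (hOH : is_strongly_bicovariant iH SOH).
Local Notation q := (extend_pairing iA iH p).
Local Notation qs := (inv_pairing SOH q).
Local Notation D := (quantum_double SH p).
Local Notation OD := (ext_double iA iH SOH p).
Local Notation iD := (tmap iA iH : D -> OD).
Local Notation hgA := (homog (@gpr k OA)).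
Local Notation hgH := (homog (@gpr k OH)).
Local Notation hg := (homog (@gpr k OD)).
Local Notation ract := (double_right_act SH p : H -> D -> H).
Local Notation oract := (ext_double_right_act iA iH SOH p : OH -> OD -> OH).

Let hX := strongly_bicovariant_dgbi hOA.
Let hY := strongly_bicovariant_dgbi hOH.
Let hSY := bicovariant_antipode hOH.
Let hq := extend_pairing_deg0 hA hH hp hOA hOH.
Let hEA := bicovariant_exterior hOA.
Let hEH := bicovariant_exterior hOH.
Let iAl : is_linear iA := exterior_linear hEA.
Let iHl : is_linear iH := exterior_linear hEH.
Let gX := dgbi_grading hX.
Let gY := dgbi_grading hY.
Let q0 := deg0_pairing_bil hq.
Let hOD : is_dgbi OD := ext_double_is_dgbi hA hH hp hOA hOH.
Let gOD : is_grading (@gpr k OD) := dgbi_grading hOD.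
Let pB : is_bilinear (p : H -> A -> k^o) := pairing_bilinear hp.

Lemma ract_ext_bil : is_bilinear oract.
Proof. by rewrite /ext_double_right_act; mlin. Qed.
Let oractB := ract_ext_bil.

Lemma ract_bil : is_bilinear ract.
Proof. by rewrite /double_right_act; mlin. Qed.
Let ractB := ract_bil.

Lemma ract_extE n x (w : OA) (y : OH) : hgH n x -> oract x (w ⊗ y) =
  \tsum_(x1, x2 <- cop x) \tsum_(y1, y2 <- cop y) \hsum_(y1' @ m <- y1)
    (-1) ^+ (m * n) *: (q x2 w *: (SOH y1' ∙ x1 ∙ y2)).
Proof.
move=> hx; rewrite /ext_double_right_act tsum_tens; [|mlin..].
by hsum_at gY hx.
Qed.

(** The pairing only removes the last leg of x, and with degree 0, so the sign depends on |x| alone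
    and the adjoint action may be formed afterwards. *)
Lemma ract_ext_adj x (w : OA) (y : OH) : oract x (w ⊗ y) = super_adj SOH (pact q x w) y.
Proof.
move: x; apply: (homog_ext gY); [mlin..|] => n x hx.
rewrite (ract_extE _ _ hx) (super_adjE hY hSY _ (pact_homog hY hq w hx)).
rewrite exchange_tsum; apply: (tsum_hext _ gY gY); [mlin..|] => i j a b ha hb.
hsum_at gY ha.
rewrite /pact (lin_tsumE (g := fun x => (-1) ^+ (i * n) *: (SOH a ∙ x ∙ b))); [|mlin..].
apply: eq_tsum => x1 x2; rewrite (hsum_homog gY ha); [|mlin..].
by rewrite (mulZr hY) (mulZl hY).
Qed.

Lemma ract_ext_pos n x (w : OA) (y : OH) : hgA n.+1 w -> oract x (w ⊗ y) = 0.
Proof.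
move=> hw; rewrite ract_ext_adj (pact_pos hq _ hw).
by apply: (lin0 (f := fun x => super_adj SOH x y)); mlin.
Qed.

Lemma ract_ext_incl b x : oract (iH b) (iD x) = iH (ract b x).
Proof.
have iDl : is_linear (tmap iA iH : A ⊗ H -> OA ⊗ OH) by exact: tmap_lin.
suff E (t : A ⊗ H) : oract (iH b) (iD t) = iH (ract b t) by exact: E.
move: t; apply: tens_ext; [mlin..|] => a h.
rewrite (double_inclE SH p hOA hOH) (ract_extE _ _ (homog_incl hOH b)).
rewrite (tsum_cop_incl hOH); [|mlin..].
rewrite /double_right_act tsum_tens; [|mlin..].
rewrite (lin_tsumE _ _ iHl); apply: eq_tsum => b1 b2.
rewrite (tsum_cop_incl hOH); [|mlin..].
rewrite (lin_tsumE _ _ iHl); apply: eq_tsum => h1 h2.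
hsum_at gY (homog_incl hOH h1).
rewrite scale1r (linZ _ _ iHl) !(exterior_mul hEH) (antipode_incl hH hOH).
by rewrite /extend_pairing (deg0K hOA) (deg0K hOH).
Qed.

(** The exchange relation moves t past y exactly as the product of the double does; what is left is
    that each of the two partial actions is an action. *)
Lemma ract_ext_mul x (s t : OD) : oract (oract x s) t = oract x (s ∙ t).
Proof.
have mB : is_bilinear (@amul k OD) := mul_bil (dgbi_alg hOD).
have mB' : is_bilinear (@amul k OD : OA ⊗ OH -> OA ⊗ OH -> OA ⊗ OH) := mB.
suff E (s' t' : OA ⊗ OH) : oract (oract x s') t' = oract x (@amul k OD s' t') by exact: E.
move: s' t'; apply: (tens_hext2 gX gY gX gY); [mlin..|] => i j l n w y t' z hw hy ht hz.
rewrite -[@amul k OD _ _]/(ext_double_mul iA iH SOH p _ _).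
rewrite (ext_double_mulE hX hY hSY hq _ hw hy ht).
rewrite (linZ (f := fun s : OA ⊗ OH => oract x s)); [|mlin..].
have E : oract (oract x (w ⊗ y)) (t' ⊗ z) = \tsum_(y1, y23 <- cop y) \tsum_(y2, y3 <- cop y23)
    \tsum_(t1, t23 <- cop t') \tsum_(t2, t3 <- cop t23)
      (qs y1 t1 * q y3 t3) *: oract x ((t2 ∙ w) ⊗ (y2 ∙ z)).
  rewrite !ract_ext_adj (pact_super_adj hX hY hSY hq).
  rewrite (lin_tsumE (g := fun v => super_adj SOH v z)); [|mlin..].
  apply: eq_tsum => y1 y23; rewrite (lin_tsumE (g := fun v => super_adj SOH v z)); [|mlin..].
  apply: eq_tsum => y2 y3; rewrite (lin_tsumE (g := fun v => super_adj SOH v z)); [|mlin..].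
  apply: eq_tsum => t1 t23; rewrite (lin_tsumE (g := fun v => super_adj SOH v z)); [|mlin..].
  apply: eq_tsum => t2 t3; rewrite (linZ (f := fun v => super_adj SOH v z)); [|mlin..].
  by rewrite (pact_mul hY hq) (super_adj_mul hY hSY) ract_ext_adj.
(* The sign may be inserted: if t has positive degree the action of t ⊗ z is zero, otherwise the
   exponent is 0. *)
transitivity ((-1) ^+ ((j + i) * l) *: oract (oract x (w ⊗ y)) (t' ⊗ z)).
  case: l ht => [|l] ht; first by rewrite muln0 scale1r.
  by rewrite (ract_ext_pos _ _ ht) scaler0.
congr (_ *: _); rewrite E.
rewrite (lin_tsumE (g := fun v : OA ⊗ OH => oract x v)); [|mlin..].
apply: eq_tsum => y1 y23; rewrite (lin_tsumE (g := fun v : OA ⊗ OH => oract x v)); [|mlin..].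
apply: eq_tsum => y2 y3; rewrite (lin_tsumE (g := fun v : OA ⊗ OH => oract x v)); [|mlin..].
apply: eq_tsum => t1 t23; rewrite (lin_tsumE (g := fun v : OA ⊗ OH => oract x v)); [|mlin..].
apply: eq_tsum => t2 t3; rewrite (linZ (f := fun v : OA ⊗ OH => oract x v)) //; mlin.
Qed.

Lemma ract_ext_one x : oract x (aone OD) = x.
Proof. by rewrite ract_ext_adj (pact_one hY hq) (super_adj_one hY hSY). Qed.

Lemma ract_ext_alg_one (s : OD) : oract (aone OH) s = cou s *: aone OH.
Proof.
have cl : is_linear (@ext_double_cou k OA OH : OA ⊗ OH -> k^o) := stens_cou_lin hX hY.
suff E (t : OA ⊗ OH) : oract (aone OH) t = ext_double_cou t *: aone OH by exact: E.
move: t; apply: tens_ext; [mlin..|] => w y; rewrite (stens_couE hX hY).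
rewrite ract_ext_adj (pact_alg_one hY hq).
rewrite (linZ (f := fun v => super_adj SOH v y)); [|mlin..].
by rewrite (super_adj_alg_one hY hSY) scalerA.
Qed.

Lemma ract_ext_homog m n x (s : OD) : hgH m x -> hg n s -> hgH (m + n) (oract x s).
Proof.
move=> hx /(stens_expand hX hY)[I [d [e [v [w [hv hw Dd ->]]]]]].
rewrite (lin_sumE (f := fun s : OA ⊗ OH => oract x s)); [|mlin..].
apply: (homog_sum gY) => i _; case: (d i) (hv i) (Dd i) => [|l] hl; last first.
  by rewrite (ract_ext_pos _ _ hl) => _; exact: homog0.
rewrite add0n ract_ext_adj => ->; apply: (super_adj_homog hY hSY) => //.
exact: (pact_homog hY hq).
Qed.

Lemma ract_ext_alg_mul n v w (s : OD) : hgH n w ->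
  oract (v ∙ w) s = \tsum_(s1, s2 <- cop s) \hsum_(s1' @ m <- s1)
    (-1) ^+ (n * m) *: (oract v s1' ∙ oract w s2).
Proof.
move=> hw; have cl : is_linear (@ext_double_cop k OA OH) := stens_cop_lin hX hY.
have cl' : is_linear (@ext_double_cop k OA OH : OA ⊗ OH -> OD ⊗ OD) := cl.
suff E (t : OA ⊗ OH) : oract (v ∙ w) t = \tsum_(s1, s2 <- (ext_double_cop t : OD ⊗ OD))
    \hsum_(s1' @ m <- s1) (-1) ^+ (n * m) *: (oract v s1' ∙ oract w s2) by exact: E.
move: t; apply: (tens_hext gX gY); [mlin..|] => i j t y ht hy.
rewrite (tsum_stens_cop hX hY); [|mlin..].
rewrite ract_ext_adj (pact_alg_mul hY hq).
rewrite (lin_tsumE (g := fun v => super_adj SOH v y)); [|mlin..].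
apply: (tsum_hext _ gX gX); [mlin..|] => a b t1 t2 ht1 ht2.
rewrite (super_adj_alg_mul hY hSY _ _ (pact_homog hY hq t2 hw)).
apply: (tsum_hext _ gY gY); [mlin..|] => c d y1 y2 hy1 hy2.
hsum_at gX ht2.
rewrite !(hsum_homog gY hy1); [|mlin..].
hsum_at gOD (homog_stens hX hY ht1 hy1).
rewrite !ract_ext_adj.
(* Only terms with t1 and t2 of degree 0 survive, and in these the Koszul sign of the coproduct is
   trivial. *)
case: a ht1 => [|a] ht1; last first.
  rewrite (pact_pos hq _ ht1) (lin0 (_ : is_linear (fun x => super_adj SOH x y1 ∙ _))) ?scaler0 //.
  by mlin.
case: b ht2 => [|b] ht2; first by rewrite add0n mul0n scale1r.
rewrite (pact_pos hq _ ht2) (lin0 (_ : is_linear (fun x => _ ∙ super_adj SOH x y2))) ?scaler0 //.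
by mlin.
Qed.

Lemma ract_ext_d n v (s : OD) : hgH n v ->
  gd (oract v s) = oract (gd v) s + (-1) ^+ n *: oract v (gd s).
Proof.
move=> hv; have dl : is_linear (@gd k OH) by mlin.
have dl' : is_linear (@super_tensor_d k OA OH) := stens_d_lin hX hY.
suff E (t : OA ⊗ OH) : gd (oract v t) = oract (gd v) t + (-1) ^+ n *: oract v (super_tensor_d t)
  by exact: E.
move: t; apply: (tens_hext gX gY); [mlin..|] => i j w y hw hy.
rewrite (stens_dE hX hY _ hw) (linD (f := fun s : OA ⊗ OH => oract v s)); [|mlin..].
rewrite (linZ (f := fun s : OA ⊗ OH => oract v s)); [|mlin..].
rewrite (ract_ext_pos _ _ (homog_d hX hw)) add0r.
case: i hw => [|i] hw; last first.
  by rewrite !(ract_ext_pos _ _ hw) !scaler0 addr0 (lin0 dl).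
rewrite scale1r !ract_ext_adj (pact_d hY hq).
exact: (super_adj_d hY hSY _ (pact_homog hY hq w hv)).
Qed.

Lemma ract_ext_differentiable : is_right_differentiable_extension iD iH ract oract.
Proof.
split; [exact: ract_ext_incl| |exact: ract_ext_d].
split; [exact: ract_ext_bil|exact: ract_ext_homog|exact: ract_ext_mul|exact: ract_ext_one| |].
- by move=> v n w x; exact: ract_ext_alg_mul.
- exact: ract_ext_alg_one.
Qed.

(** The axioms are those of the extended action restricted to degree 0, where all signs are 1. *)
Lemma ract_module : is_right_module_algebra ract.
Proof.
have inj := exterior_injective hEH.
split; first exact: ract_bil.
- move=> v x y; apply: inj.
  by rewrite -!ract_ext_incl ract_ext_mul (double_incl_mul hA hH hp hOA hOH).
- by move=> v; apply: inj; rewrite -ract_ext_incl (double_incl_one SH p hOA hOH) ract_ext_one.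
- move=> v w x; apply: inj; rewrite -ract_ext_incl (exterior_mul hEH).
  rewrite (ract_ext_alg_mul _ _ (homog_incl hOH w)) (lin_tsumE _ _ iHl).
  rewrite (tsum_cop_sub (double_incl_cop hA hH hp hOA hOH)); [|mlin..].
  apply: eq_tsum => x1 x2.
  hsum_at gOD (homog_double_incl hA hH hp hOA hOH x1).
  by rewrite scale1r !ract_ext_incl (exterior_mul hEH).
- move=> x; apply: inj; rewrite -ract_ext_incl (exterior_one hEH) ract_ext_alg_one.
  by rewrite (double_incl_cou hA hH hOA hOH) (linZ _ _ iHl) (exterior_one hEH).
Qed.

Lemma ract_ext_coaction n x a (y : OH) : hgH n x ->
  oract x (iA a ⊗ y) = \tsum_(x0, x1 <- right_coaction iH x) \tsum_(y1, y2 <- cop y)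
    \hsum_(y1' @ m <- y1) (-1) ^+ (m * n) *: (p x1 a *: (SOH y1' ∙ x0 ∙ y2)).
Proof.
move=> hx; rewrite (ract_extE _ _ hx) /right_coaction tsum_tsum; [|mlin..].
have dl := deg0_lin hOH.
apply: eq_tsum => x1 x2; rewrite tsum_tens; [|mlin..].
by rewrite /extend_pairing (deg0K hOA).
Qed.

End RightAction.

(** * The left action *)

#[global] Hint Resolve ract_ext_bil : multilinear.

Section SuperFlip.
Variables (k : fieldType) (X Y : dgbialg k).
Hypotheses (hX : is_dgbi X) (hY : is_dgbi Y).
Local Notation hgX := (homog (@gpr k X)).
Local Notation hgY := (homog (@gpr k Y)).

Let gX := dgbi_grading hX.
Let gY := dgbi_grading hY.

Definition super_flip (t : X ⊗ Y) : Y ⊗ X :=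
  \tsum_(x, y <- t) \hsum_(x' @ m <- x) \hsum_(y' @ n <- y) (-1) ^+ (m * n) *: (y' ⊗ x').

Lemma super_flip_lin : is_linear super_flip.
Proof. by rewrite /super_flip; mlin. Qed.
Hint Resolve super_flip_lin : multilinear.

Lemma super_flipE m n (x : X) (y : Y) : hgX m x -> hgY n y ->
  super_flip (x ⊗ y) = (-1) ^+ (m * n) *: (y ⊗ x).
Proof.
move=> hx hy; rewrite /super_flip tsum_tens; [|mlin..].
by rewrite (hsum_homog gX hx) ?(hsum_homog gY hy) //; mlin.
Qed.

Lemma super_flip_homog n t : homog (@gpr k (stens X Y)) n t ->
  homog (@gpr k (stens Y X)) n (super_flip t).
Proof.
have gYX := stens_grading hY hX.
move=> /(stens_expand hX hY)[I [d [e [v [w [hv hw D ->]]]]]].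
rewrite (lin_sumE _ _ _ super_flip_lin); apply: (homog_sum gYX) => i _.
rewrite (super_flipE (hv i) (hw i)); apply: (homogZ gYX).
by rewrite (D i) addnC; exact: homog_stens.
Qed.

Lemma super_flip_d t : super_flip (super_tensor_d t) = super_tensor_d (super_flip t).
Proof.
have dl := stens_d_lin hX hY; have dl' := stens_d_lin hY hX.
move: t; apply: (tens_hext gX gY); [mlin..|] => i j x y hx hy.
rewrite (super_flipE hx hy) (linZ _ _ dl') (stens_dE hX hY _ hx) (stens_dE hY hX _ hy).
rewrite (linD _ _ super_flip_lin) (linZ _ _ super_flip_lin).
rewrite (super_flipE (homog_d hX hx) hy) (super_flipE hx (homog_d hY hy)) scalerDr addrC.
by congr (_ + _); signs.
Qed.

(** The flip keeps the order of the legs: the signs of flipping each leg, together with those of the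
    two coproducts, add up to the sign of flipping the whole. *)
Lemma tsum_super_flip_cop (U : lmodType k) (F : Y ⊗ X -> Y ⊗ X -> U) t : is_bilinear F ->
  tsum F (ext_double_cop (super_flip t)) =
  \tsum_(t1, t2 <- ext_double_cop t) F (super_flip t1) (super_flip t2).
Proof.
have cl := stens_cop_lin hX hY; have cl' := stens_cop_lin hY hX.
move=> FB; move: t; apply: (tens_hext gX gY); [mlin..|] => i j x y hx hy.
rewrite (super_flipE hx hy) (linZ (f := fun t => tsum F (ext_double_cop t))); [|mlin..].
rewrite (tsum_stens_cop hX hY) ?(tsum_stens_cop hY hX); [|mlin..].
rewrite exchange_tsum tsumZ.
have [I [d [e [u [v [hu hv D E]]]]]] := cop_expand hX hx.
have [J [d' [e' [u' [v' [hu' hv' D' E']]]]]] := cop_expand hY hy.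
rewrite !E; [|mlin..]; apply: eq_bigr => o _.
rewrite !E'; [|mlin..]; rewrite scaler_sumr; apply: eq_bigr => o' _.
hsum_at gY (hv' o').
hsum_at gX (hu o).
hsum_at gX (hv o).
hsum_at gY (hu' o').
rewrite (super_flipE (hu o) (hu' o')) (super_flipE (hv o) (hv' o')).
rewrite (linZ (f := fun t => F t _)); [|mlin..].
rewrite (linZ (f := fun t => F _ t)); [|mlin..].
rewrite (D o) (D' o'); signs.
Qed.

Lemma super_flip_cou t : ext_double_cou (super_flip t) = ext_double_cou t.
Proof.
have cl := stens_cou_lin hX hY; have cl' := stens_cou_lin hY hX.
move: t; apply: (tens_hext (f := fun t => (ext_double_cou (super_flip t) : k^o)) gX gY); [mlin..|].
move=> i j x y hx hy; rewrite (super_flipE hx hy) (linZ _ _ cl') (stens_couE hX hY) (stens_couE hY hX).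
case: i hx => [|i] hx; first by rewrite mul0n scale1r mulrC.
by rewrite (dgbi_cou_degree hX hx) mulr0 mul0r scaler0.
Qed.

End SuperFlip.

Lemma dually_paired_sym (k : fieldType) (A H : bialg k) (SA : A -> A) (SH : H -> H)
    (p : H -> A -> k) : dually_paired SA SH p -> dually_paired SH SA (fun a h => p h a).
Proof.
case=> [[b1 b2] ml mr ol or an].
by split=> //; split.
Qed.

(** * The action on Ω(A), transported along the super flip *)

Section LeftAction.
Variables (k : fieldType) (A H : bialg k).
Variables (SA : A -> A) (SH : H -> H) (p : H -> A -> k).
Variables (OA OH : dgbialg k) (iA : A -> OA) (iH : H -> OH).
Variables (SOA : OA -> OA) (SOH : OH -> OH).
Hypotheses (hA : is_hopf SA) (hH : is_hopf SH) (hp : dually_paired SA SH p).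
Hypotheses (hOA : is_strongly_bicovariant iA SOA) (hOH : is_strongly_bicovariant iH SOH).
Local Notation q := (extend_pairing iA iH p).
Local Notation qs := (inv_pairing SOH q).
Local Notation p' := (fun a h => p h a).
Local Notation q' := (extend_pairing iH iA p').
Local Notation qs' := (inv_pairing SOA q').
Local Notation D := (quantum_double SH p).
Local Notation OD := (ext_double iA iH SOH p).
Local Notation OD' := (ext_double iH iA SOA p').
Local Notation iD := (tmap iA iH : D -> OD).
Local Notation hgA := (homog (@gpr k OA)).
Local Notation hgH := (homog (@gpr k OH)).
Local Notation hg := (homog (@gpr k OD)).
Local Notation lact := (double_left_act SA SH p : D -> A -> A).
Local Notation olact := (ext_double_left_act iA iH SOA SOH p : OD -> OA -> OA).
Local Notation oract := (ext_double_right_act iH iA SOA p' : OA -> OD' -> OA).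
Local Notation flip := (@super_flip k OA OH : OD -> OD').

Let hp' := dually_paired_sym hp.
Let hX := strongly_bicovariant_dgbi hOA.
Let hY := strongly_bicovariant_dgbi hOH.
Let hSX := bicovariant_antipode hOA.
Let hSY := bicovariant_antipode hOH.
Let hq := extend_pairing_deg0 hA hH hp hOA hOH.
Let hq' := extend_pairing_deg0 hH hA hp' hOH hOA.
Let hEA := bicovariant_exterior hOA.
Let hEH := bicovariant_exterior hOH.
Let iAl : is_linear iA := exterior_linear hEA.
Let iHl : is_linear iH := exterior_linear hEH.
Let gX := dgbi_grading hX.
Let q0 := deg0_pairing_bil hq.
Let qs0 := inv_pairing_deg0 hY hSY hq.
Let hOD : is_dgbi OD := ext_double_is_dgbi hA hH hp hOA hOH.
Let hOD' : is_dgbi OD' := ext_double_is_dgbi hH hA hp' hOH hOA.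
Let gOD : is_grading (@gpr k OD) := dgbi_grading hOD.
Let gOD' : is_grading (@gpr k OD') := dgbi_grading hOD'.
Let pB : is_bilinear (p : H -> A -> k^o) := pairing_bilinear hp.
Let flipl' : is_linear (@super_flip k OA OH) := super_flip_lin hX hY.

Lemma lact_ext_bil : is_bilinear olact.
Proof. by rewrite /ext_double_left_act; mlin. Qed.
Let lB := lact_ext_bil.

Lemma lact_bil : is_bilinear lact.
Proof. by rewrite /double_left_act; mlin. Qed.
Let actB' : is_bilinear (lact : A ⊗ H -> A -> A) := lact_bil.

Lemma lact_extE n v (w : OA) (y : OH) : hgA n v -> olact (w ⊗ y) v =
  \tsum_(v1, v2 <- cop v) \tsum_(w1, w2 <- cop w) \hsum_(w2' @ m <- w2)
    (-1) ^+ (m * n) *: (q y v2 *: (SOA w1 ∙ v1 ∙ w2')).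
Proof.
move=> hv; rewrite /ext_double_left_act tsum_tens; [|mlin..].
by hsum_at gX hv.
Qed.

Lemma lact_ext_pos n v (w : OA) (y : OH) : hgH n.+1 y -> olact (w ⊗ y) v = 0.
Proof.
move=> hy; move: v; apply: (homog_ext gX); [mlin|exact: lin_zero|] => m v hv.
rewrite (lact_extE _ _ hv); apply: tsum0 => v1 v2; apply: tsum0 => w1 w2.
rewrite (deg0_bil_l q0 _ hy) /hsum; apply: fsbig1 => i _.
by rewrite scale0r scaler0.
Qed.

(** Both actions vanish unless y has degree 0, and then the flip has no sign. What remains is
    (-1)^(|w||v|) (-1)^(|w1||v|) = (-1)^(|w2||v|). *)
Lemma lact_ext_flip N n (s : OD) v : hg N s -> hgA n v ->
  olact s v = (-1) ^+ (N * n) *: oract v (flip s).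
Proof.
move=> /(stens_expand hX hY)[I [d [e [w [y [hw hy Dd ->]]]]]] hv.
rewrite (lin_sumE (f := fun s : OA ⊗ OH => olact s v)); [|mlin..].
rewrite (lin_sumE _ _ _ flipl').
rewrite (lin_sumE (f := fun s : OH ⊗ OA => oract v s)); [|mlin..].
rewrite scaler_sumr; apply: eq_bigr => i _; rewrite (super_flipE hX hY (hw i) (hy i)).
rewrite (linZ (f := fun s : OH ⊗ OA => oract v s)); [|mlin..].
case: (e i) (hy i) (Dd i) => [|m] hm; last first.
  by rewrite (lact_ext_pos _ _ hm) (ract_ext_pos hH hA hp' hOH hOA _ _ hm) !scaler0.
rewrite addn0 muln0 scale1r => ->.
rewrite (lact_extE _ _ hv) (ract_extE hH hA hp' hOH hOA _ _ hv) tsumZ.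
apply: eq_tsum => v1 v2.
have [J [d' [e' [u' [v' [hu' hv' D' E']]]]]] := cop_expand hX (hw i).
rewrite !E'; [|mlin..]; rewrite scaler_sumr; apply: eq_bigr => o _.
hsum_at gX (hv' o).
hsum_at gX (hu' o).
rewrite [RHS]scalerA -exprD (D' o); apply: (congr1 (fun c => c *: _)); parity.
Qed.

Let flip_homog n s : hg n s -> homog (@gpr k OD') n (flip s).
Proof. exact: super_flip_homog. Qed.

(** The pairings on the outer legs force these into degree 0, so the middle legs carry the full
    degrees of y and t, and only there do F and G have to agree. *)
Lemma double_sandwich_hext (U : lmodType k) (F G : OA -> OH -> U) j l (y : OH) (t : OA) :
  hgH j y -> hgA l t -> is_bilinear F -> is_bilinear G ->
  (forall t' y', hgA l t' -> hgH j y' -> F t' y' = G t' y') ->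
  \tsum_(y1, y23 <- cop y) \tsum_(y2, y3 <- cop y23) \tsum_(t1, t23 <- cop t)
    \tsum_(t2, t3 <- cop t23) (qs y1 t1 * q y3 t3) *: F t2 y2 =
  \tsum_(y1, y23 <- cop y) \tsum_(y2, y3 <- cop y23) \tsum_(t1, t23 <- cop t)
    \tsum_(t2, t3 <- cop t23) (qs y1 t1 * q y3 t3) *: G t2 y2.
Proof.
move=> hy ht FB GB FG.
have z0 c d (f : OA -> OH -> U) t2 y2 : c = 0 -> (c * d) *: f t2 y2 = 0.
  by move=> ->; rewrite mul0r scale0r.
apply: (cop_hext hY hy); [mlin..|] => -[|a] b y1 y23; last first.
  move=> _ h1 _; rewrite !tsum0 // => a1 a2; rewrite tsum0 // => b1 b2; rewrite tsum0 // => c1 c2;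
  by rewrite (deg0_bil_l qs0 _ h1) mul0r scale0r.
rewrite add0n => -> _ h23; apply: (cop_hext hY h23); [mlin..|] => b1 [|c] y2 y3; last first.
  move=> _ _ h3; rewrite !tsum0 // => a1 a2; rewrite tsum0 // => c1 c2;
  by rewrite (deg0_bil_l q0 _ h3) mulr0 scale0r.
rewrite addn0 => -> h2 _; apply: (cop_hext hX ht); [mlin..|] => -[|d] e t1 t23; last first.
  move=> _ h1 _; rewrite !tsum0 // => c1 c2;
  by rewrite (deg0_bil_r qs0 _ h1) mul0r scale0r.
rewrite add0n => -> _ h23'; apply: (cop_hext hX h23'); [mlin..|] => d1 [|f] t2 t3; last first.
  by move=> _ _ h3; rewrite (deg0_bil_r q0 _ h3) mulr0 !scale0r.
by rewrite addn0 => -> h2' _; rewrite FG.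
Qed.

(** Up to sign, both products put the same middle legs between the same pairings, because <Sy1, t1>
    = <y1, St1>; their coproducts are only taken in a different order. *)
Lemma flip_mul M N (s t : OD) : hg M s -> hg N t ->
  flip (s ∙ t) = (-1) ^+ (M * N) *: @amul k OD' (flip t) (flip s).
Proof.
have mB : is_bilinear (@amul k OD : OA ⊗ OH -> OA ⊗ OH -> OA ⊗ OH) := mul_bil (dgbi_alg hOD).
have mB' : is_bilinear (@amul k OD' : OH ⊗ OA -> OH ⊗ OA -> OH ⊗ OA) := mul_bil (dgbi_alg hOD').
move=> /(stens_expand hX hY)[I [d [e [w [y [hw hy Dd ->]]]]]].
move=> /(stens_expand hX hY)[J [d' [e' [t' [z [ht hz Dd' ->]]]]]].
rewrite (lin_sumE (f := fun t : OA ⊗ OH => super_flip (@amul k OD _ t))); [|mlin..].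
rewrite (lin_sumE _ _ _ flipl').
rewrite (lin_sumE (f := fun t : OH ⊗ OA => @amul k OD' t _)) ?scaler_sumr; [|mlin..].
apply: eq_bigr => b _.
rewrite (lin_sumE (f := fun t : OA ⊗ OH => super_flip (@amul k OD t _))); [|mlin..].
rewrite (lin_sumE _ _ _ flipl').
rewrite (lin_sumE (f := fun t : OH ⊗ OA => @amul k OD' _ t)) ?scaler_sumr; [|mlin..].
apply: eq_bigr => a _.
rewrite (super_flipE hX hY (hw a) (hy a)) (super_flipE hX hY (ht b) (hz b)).
rewrite (linZ (f := fun t : OH ⊗ OA => @amul k OD' t _)); [|mlin..].
rewrite (linZ (f := fun t : OH ⊗ OA => @amul k OD' _ t)); [|mlin..].
rewrite -[@amul k OD _ _]/(ext_double_mul iA iH SOH p _ _).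
rewrite -[@amul k OD' _ _]/(ext_double_mul iH iA SOA p' _ _).
rewrite (ext_double_mulE hX hY hSY hq _ (hw a) (hy a) (ht b)).
rewrite (ext_double_mulE hY hX hSX hq' _ (hz b) (ht b) (hy a)).
rewrite (linZ _ _ flipl').
transitivity ((-1) ^+ ((e a + d a) * d' b) *: \tsum_(y1, y23 <- cop (y a)) \tsum_(y2, y3 <- cop y23)
    \tsum_(t1, t23 <- cop (t' b)) \tsum_(t2, t3 <- cop t23) (qs y1 t1 * q y3 t3) *:
    ((-1) ^+ ((d' b + d a) * (e a + e' b)) *: (y2 ∙ z b ⊗ (t2 ∙ w a)))).
  congr (_ *: _).
  rewrite -(double_sandwich_hext (hy a) (ht b) (F := fun t2 y2 => super_flip (t2 ∙ w a ⊗ (y2 ∙ z b))));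
    [|mlin..|]; last first.
    by move=> t2 y2 h2 h2'; rewrite (super_flipE hX hY (homog_mul hX h2 (hw a)) (homog_mul hY h2' (hz b))).
  rewrite (lin_tsumE _ _ flipl'); apply: eq_tsum => y1 y23.
  rewrite (lin_tsumE _ _ flipl'); apply: eq_tsum => y2 y3.
  rewrite (lin_tsumE _ _ flipl'); apply: eq_tsum => t1 t23.
  rewrite (lin_tsumE _ _ flipl'); apply: eq_tsum => t2 t3.
  by rewrite (linZ _ _ flipl').
rewrite !scalerA -!exprD.
transitivity ((-1) ^+ ((e a + d a) * d' b + (d' b + d a) * (e a + e' b)) *:
    \tsum_(y1, y23 <- cop (y a)) \tsum_(y2, y3 <- cop y23)
    \tsum_(t1, t23 <- cop (t' b)) \tsum_(t2, t3 <- cop t23) (qs y1 t1 * q y3 t3) *: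
    (y2 ∙ z b ⊗ (t2 ∙ w a))).
  rewrite exprD -scalerA; congr (_ *: _).
  rewrite tsumZ; apply: eq_tsum => y1 y23; rewrite tsumZ; apply: eq_tsum => y2 y3.
  rewrite tsumZ; apply: eq_tsum => t1 t23; rewrite tsumZ; apply: eq_tsum => t2 t3.
  by rewrite !scalerA [X in X *: _ = _]mulrC.
rewrite (Dd a) (Dd' b).
(* Modulo 2 the exponent is the sum of MN, of the exponents from flipping t and s, and of the one in
   the product of the exterior double of (H, A). *)
transitivity ((-1) ^+ ((d a + e a) * (d' b + e' b) + (d' b * e' b + (d a * e a + (d' b + e' b) * e a))) *:
    \tsum_(y1, y23 <- cop (y a)) \tsum_(y2, y3 <- cop y23)
    \tsum_(t1, t23 <- cop (t' b)) \tsum_(t2, t3 <- cop t23) (qs y1 t1 * q y3 t3) *: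
    (y2 ∙ z b ⊗ (t2 ∙ w a))).
  apply: (congr1 (fun c => c *: _)); parity.
rewrite !addnA; congr (_ *: _).
transitivity (\tsum_(y1, y23 <- cop (y a)) \tsum_(t1, t23 <- cop (t' b))
    \tsum_(y2, y3 <- cop y23) \tsum_(t2, t3 <- cop t23) (qs y1 t1 * q y3 t3) *:
    (y2 ∙ z b ⊗ (t2 ∙ w a))).
  by apply: eq_tsum => y1 y23; exact: exchange_tsum.
rewrite exchange_tsum; apply: eq_tsum => t1 t23.
transitivity (\tsum_(y1, y23 <- cop (y a))
    \tsum_(t2, t3 <- cop t23) \tsum_(y2, y3 <- cop y23) (qs y1 t1 * q y3 t3) *:
    (y2 ∙ z b ⊗ (t2 ∙ w a))).
  by apply: eq_tsum => y1 y23; exact: exchange_tsum.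
rewrite exchange_tsum; apply: eq_tsum => t2 t3; apply: eq_tsum => y1 y23; apply: eq_tsum => y2 y3.
congr (_ * _ *: _).
by rewrite /inv_pairing (deg0_pairing_antipode hq).
Qed.

Lemma lact_ext_incl b x : olact (iD x) (iA b) = iA (lact x b).
Proof.
have iDl : is_linear (tmap iA iH : A ⊗ H -> OA ⊗ OH) by exact: tmap_lin.
suff E (t : A ⊗ H) : olact (iD t) (iA b) = iA (lact t b) by exact: E.
move: t; apply: tens_ext; [mlin..|] => a h.
rewrite (double_inclE SH p hOA hOH) (lact_extE _ _ (homog_incl hOA b)).
rewrite (tsum_cop_incl hOA); [|mlin..].
rewrite /double_left_act tsum_tens; [|mlin..].
rewrite (lin_tsumE _ _ iAl); apply: eq_tsum => b1 b2.
rewrite (tsum_cop_incl hOA); [|mlin..].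
rewrite (lin_tsumE _ _ iAl); apply: eq_tsum => a1 a2.
hsum_at gX (homog_incl hOA a2).
rewrite muln0 scale1r (linZ _ _ iAl) !(exterior_mul hEA) (antipode_incl hA hOA).
by rewrite /extend_pairing (deg0K hOA) (deg0K hOH).
Qed.

Lemma lact_ext_homog m n v (s : OD) : hgA m v -> hg n s -> hgA (n + m) (olact s v).
Proof.
move=> hv hs; rewrite (lact_ext_flip hs hv) addnC; apply: (homogZ gX).
exact: (ract_ext_homog hH hA hp' hOH hOA hv (flip_homog hs)).
Qed.

(** The flip exchanges the order of s and t, turning the right action into a left one; its sign
    |s||t| cancels the one from letting s act on an element of degree |t| + |v|. *)
Lemma lact_ext_mul v (s t : OD) : olact s (olact t v) = olact (s ∙ t) v.
Proof.
have mB : is_bilinear (@amul k OD) := mul_bil (dgbi_alg hOD).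
have mB' : is_bilinear (@amul k OD : OA ⊗ OH -> OA ⊗ OH -> OA ⊗ OH) := mB.
move: s t v; apply: (homog_ext3 gOD gOD gX); [mlin..|] => l m n s t v hs ht hv.
rewrite (lact_ext_flip hs (lact_ext_homog hv ht)) (lact_ext_flip ht hv).
rewrite (lact_ext_flip (homog_mul hOD hs ht) hv) (flip_mul hs ht).
rewrite (linZ (f := fun v => oract v _)); [|mlin..].
rewrite (linZ (f := fun t : OH ⊗ OA => oract v t)); [|mlin..].
by rewrite (ract_ext_mul hH hA hp' hOH hOA); signs.
Qed.

Lemma lact_ext_one v : olact (aone OD) v = v.
Proof.
move: v; apply: (homog_ext gX); [mlin|exact: lin_id|] => n v hv.
rewrite (lact_ext_flip (homog_one hOD) hv) mul0n scale1r.
rewrite (super_flipE hX hY (homog_one hX) (homog_one hY)) muln0 scale1r.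
exact: (ract_ext_one hH hA hp' hOH hOA).
Qed.

Lemma lact_ext_alg_one (s : OD) : olact s (aone OA) = cou s *: aone OA.
Proof.
have cl : is_linear (@ext_double_cou k OA OH : OA ⊗ OH -> k^o) := stens_cou_lin hX hY.
have cl' : is_linear (@cou k OD : OD -> k^o) := cl.
move: s; apply: (homog_ext gOD); [mlin..|] => n s hs.
rewrite (lact_ext_flip hs (homog_one hX)) muln0 scale1r.
rewrite (ract_ext_alg_one hH hA hp' hOH hOA).
by congr (_ *: _); exact: (super_flip_cou hX hY s).
Qed.

(** The right module algebra axiom at the flipped element, with Δ carried across the flip. The total
    sign reduces to that of moving s2 past v. *)
Lemma lact_ext_alg_mul n v w (s : OD) : hgA n v ->
  olact s (v ∙ w) = \tsum_(s1, s2 <- cop s) \hsum_(s2' @ m <- s2)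
    (-1) ^+ (m * n) *: (olact s1 v ∙ olact s2' w).
Proof.
move=> hv; have cl : is_linear (@cop k OD) := stens_cop_lin hX hY.
move: w s; apply: (homog_ext2 gX gOD); [mlin..|] => l N w s hw hs.
rewrite (lact_ext_flip hs (homog_mul hX hv hw)).
rewrite (ract_ext_alg_mul hH hA hp' hOH hOA _ _ hw).
rewrite -[@cop k OD' _]/(ext_double_cop _) (tsum_super_flip_cop hX hY); [|mlin..].
rewrite -[ext_double_cop s]/(@cop k OD s) tsumZ.
apply: (cop_hext hOD hs); [mlin..|] => i j s1 s2 <- h1 h2.
rewrite (hsum_homog gOD' (flip_homog h1)); [|mlin..].
hsum_at gOD h2.
rewrite (lact_ext_flip h1 hv) (lact_ext_flip h2 hw) (mulZl hX) (mulZr hX).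
by signs.
Qed.

Lemma lact_ext_d n v (s : OD) : hg n s ->
  gd (olact s v) = olact (gd s) v + (-1) ^+ n *: olact s (gd v).
Proof.
move=> hs; have dl : is_linear (@gd k OA) by mlin.
have dl' : is_linear (@gd k OD) := stens_d_lin hX hY.
move: v; apply: (homog_ext gX); [mlin..|] => m v hv.
rewrite (lact_ext_flip hs hv) (linZ _ _ dl) (ract_ext_d hH hA hp' hOH hOA _ hv).
rewrite (lact_ext_flip (homog_d hOD hs) hv) (lact_ext_flip hs (homog_d hX hv)).
rewrite -[flip (gd s)]/(super_flip (super_tensor_d s)) (super_flip_d hX hY).
rewrite scalerDr addrC; congr (_ + _); signs.
Qed.

Lemma lact_ext_differentiable : is_left_differentiable_extension iD iA lact olact.
Proof.
split; [exact: lact_ext_incl| |by move=> n v s; exact: lact_ext_d].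
split; [exact: lact_ext_bil|exact: lact_ext_homog|exact: lact_ext_mul|exact: lact_ext_one| |].
- by move=> n v w x; exact: lact_ext_alg_mul.
- exact: lact_ext_alg_one.
Qed.

(** As for the right action, restriction of the extended action to degree 0. *)
Lemma lact_module : is_left_module_algebra lact.
Proof.
have inj := exterior_injective hEA.
split; first exact: lact_bil.
- move=> v x y; apply: inj.
  by rewrite -!lact_ext_incl lact_ext_mul (double_incl_mul hA hH hp hOA hOH).
- by move=> v; apply: inj; rewrite -lact_ext_incl (double_incl_one SH p hOA hOH) lact_ext_one.
- move=> v w x; apply: inj; rewrite -lact_ext_incl (exterior_mul hEA).
  rewrite (lact_ext_alg_mul _ _ (homog_incl hOA v)) (lin_tsumE _ _ iAl).
  rewrite (tsum_cop_sub (double_incl_cop hA hH hp hOA hOH)); [|mlin..].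
  apply: eq_tsum => x1 x2.
  hsum_at gOD (homog_double_incl hA hH hp hOA hOH x2).
  by rewrite mul0n scale1r !lact_ext_incl (exterior_mul hEA).
- move=> x; apply: inj; rewrite -lact_ext_incl (exterior_one hEA) lact_ext_alg_one.
  by rewrite (double_incl_cou hA hH hOA hOH) (linZ _ _ iAl) (exterior_one hEA).
Qed.

Lemma lact_ext_coaction n v h (w : OA) : hgA n v ->
  olact (w ⊗ iH h) v = \tsum_(v0, v1 <- right_coaction iA v) \tsum_(w1, w2 <- cop w)
    \hsum_(w2' @ m <- w2) (-1) ^+ (m * n) *: (p h v1 *: (SOA w1 ∙ v0 ∙ w2')).
Proof.
move=> hv; rewrite (lact_extE _ _ hv) /right_coaction tsum_tsum; [|mlin..].
have dl := deg0_lin hOA.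
apply: eq_tsum => v1 v2; rewrite tsum_tens; [|mlin..].
by rewrite /extend_pairing (deg0K hOH).
Qed.

End LeftAction.

Theorem proposition3p3 (k : fieldType) (A H : bialg k)
    (SA : A -> A) (SH : H -> H) (p : H -> A -> k)
    (OA OH : dgbialg k) (iA : A -> OA) (iH : H -> OH)
    (SOA : OA -> OA) (SOH : OH -> OH)
    (hA : is_hopf SA) (hH : is_hopf SH) (hSA : bijective SA)
    (hp : dually_paired SA SH p)
    (hOA : is_strongly_bicovariant iA SOA)
    (hOH : is_strongly_bicovariant iH SOH) :
  let D := quantum_double SH p in
  let OD := ext_double iA iH SOH p in
  let iD : D -> OD := tmap iA iH in
  let ract : H -> D -> H := double_right_act SH p in
  let oract : OH -> OD -> OH := ext_double_right_act iA iH SOH p in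
  let lact : D -> A -> A := double_left_act SA SH p in
  let olact : OD -> OA -> OA := ext_double_left_act iA iH SOA SOH p in
  (exists (SD : D -> D) (SOD : OD -> OD),
     is_hopf SD /\ is_strongly_bicovariant iD SOD) /\
  (forall n (w : OA) (y : OH), homog (@gpr k OA) n w ->
     @gd k OD (w ⊗ y) = gd w ⊗ y + (-1) ^+ n *: (w ⊗ gd y)) /\
  (is_right_module_algebra ract /\
   right_differentiable iD iH ract /\
   is_right_differentiable_extension iD iH ract oract /\
   (forall n (x : OH) (a : A) (y : OH), homog (@gpr k OH) n x ->
      oract x (iA a ⊗ y) =
      \tsum_(x0, x1 <- right_coaction iH x) \tsum_(y1, y2 <- cop y)
        \hsum_(y1' @ m <- y1)
          (-1) ^+ (m * n) *: (p x1 a *: (SOH y1' ∙ x0 ∙ y2))) /\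
   (forall n (x : OH) (w : OA) (y : OH), homog (@gpr k OA) n.+1 w ->
      oract x (w ⊗ y) = 0)) /\
  (is_left_module_algebra lact /\
   left_differentiable iD iA lact /\
   is_left_differentiable_extension iD iA lact olact /\
   (forall n (v : OA) (h : H) (w : OA), homog (@gpr k OA) n v ->
      olact (w ⊗ iH h) v =
      \tsum_(v0, v1 <- right_coaction iA v) \tsum_(w1, w2 <- cop w)
        \hsum_(w2' @ m <- w2)
          (-1) ^+ (m * n) *: (p h v1 *: (SOA w1 ∙ v0 ∙ w2'))) /\
   (forall n (v : OA) (w : OA) (y : OH), homog (@gpr k OH) n.+1 y ->
      olact (w ⊗ y) v = 0)).
Proof.
split; first exact: ext_double_strongly_bicovariant hA hH hp hOA hOH hSA.
split.
  move=> n w y hw.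
  exact: (stens_dE (strongly_bicovariant_dgbi hOA) (strongly_bicovariant_dgbi hOH) y hw).
have rd := ract_ext_differentiable hA hH hp hOA hOH.
have ld := lact_ext_differentiable hA hH hp hOA hOH.
split.
- split; first exact: ract_module hA hH hp hOA hOH.
  split; first by eexists; exact: rd.
  split; first exact: rd.
  split; first by move=> n x a y; exact: (ract_ext_coaction hA hH hp hOA hOH).
  by move=> n x w y; exact: (ract_ext_pos hA hH hp hOA hOH).
- split; first exact: lact_module hA hH hp hOA hOH.
  split; first by eexists; exact: ld.
  split; first exact: ld.
  split; first by move=> n v h w; exact: (lact_ext_coaction hA hH hp hOA hOH).
  by move=> n v w y; exact: (lact_ext_pos hA hH hp hOA hOH).
Qed.
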